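(* Let $G$ be an infinite locally finite graph. The following three statements are equivalent: (1) $G$ has a Hamiltonian circle. (2) $G$ has a spanning subgraph $F$ that is faithful to $G$, such that $F$ has a Hamiltonian curve and every end $\alpha$ of $F$ has degree $d(\alpha)=2$ (degree taken in $F$). (3) $G$ has a spanning subgraph $F$ that is faithful to $G$, such that $F$ has a Hamiltonian curve and every end $\alpha$ of $F$ has degree $d(\alpha)\le 3$ (degree taken in $F$).
   Context: A graph is locally finite if every vertex has finite degree. A ray is a one-way infinite path; its subrays are its tails. Two rays $R_1,R_2$ of a graph $H$ are equivalent in $H$ if for every finite $S\subseteq V(H)$ some component of $H-S$ contains tails of both; the equivalence classes are the ends of $H$. For finite $S$ and an end $\alpha$, $C(S,\alpha)$ is the component of $H-S$ containing tails of the rays of $\alpha$. The Freudenthal compactification $|H|$ is the 1-complex of $H$ (each edge a copy of $[0,1]$) together with its ends, where a basic open neighbourhood of an end $\alpha$ is, for finite $S$, the union of $C(S,\alpha)$, all ends whose rays have tails in $C(S,\alpha)$, and the inner points of edges between $S$ and $C(S,\alpha)$. A circle of $H$ is the image of a homeomorphic embedding of the unit circle $S^1$ into $|H|$; it is Hamiltonian if it contains every vertex of $H$. A Hamiltonian curve of $H$ is the image of a continuous map $\sigma:S^1\to|H|$ whose image contains every vertex of $H$ and such that every vertex has exactly one preimage (ends may be visited more than once). A subgraph $F$ of $G$ is faithful to $G$ if (i) every end of $G$ contains a ray of $F$, and (ii) any two rays of $F$ are equivalent in $F$ if and only if they are equivalent in $G$. The degree $d(\alpha)$ of an end $\alpha$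 is the maximum number of pairwise vertex-disjoint rays in $\alpha$. *)

(* Defs.v *)
From Stdlib Require Import Reals List ClassicalEpsilon.
Open Scope R_scope.

Section Graphs.
Variable V : Type.

(** A graph on V is a symmetric irreflexive relation [H : V -> V -> Prop]. *)
Definition finite_pred (P : V -> Prop) : Prop :=
  exists l : list V, forall x, P x -> In x l.

Definition locally_finite (H : V -> V -> Prop) : Prop :=
  forall v, finite_pred (fun w => H v w).

Definition infinite_vertices : Prop :=
  ~ exists l : list V, forall x : V, In x l.

Definition spanning_subgraph (F G : V -> V -> Prop) : Prop :=
  (forall u v, F u v -> F v u) /\ (forall u v, F u v -> G u v).

Definition is_ray (H : V -> V -> Prop) (r : nat -> V) : Prop :=
  (forall i j, r i = r j -> i = j) /\ (forall i, H (r i) (r (S i))).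

Inductive reach_avoid (H : V -> V -> Prop) (S : list V) : V -> V -> Prop :=
| ra_refl x : ~ In x S -> reach_avoid H S x x
| ra_step x y z : ~ In x S -> H x y -> reach_avoid H S y z -> reach_avoid H S x z.

Definition tails_same_comp (H : V -> V -> Prop) (S : list V) (r1 r2 : nat -> V) : Prop :=
  exists n m, forall i j, reach_avoid H S (r1 (n + i)%nat) (r2 (m + j)%nat).

Definition ray_equiv (H : V -> V -> Prop) (r1 r2 : nat -> V) : Prop :=
  forall S : list V, tails_same_comp H S r1 r2.

Definition is_end (H : V -> V -> Prop) (A : (nat -> V) -> Prop) : Prop :=
  exists r, is_ray H r /\ A = (fun r' => is_ray H r' /\ ray_equiv H r r').

Definition compE (H : V -> V -> Prop) (S : list V) (A : (nat -> V) -> Prop) (x : V) : Prop :=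
  exists r, A r /\ exists n, forall i, reach_avoid H S (r (n + i)%nat) x.

(** Points of |H|: the 1-complex is realised inside V -> R (a vertex v is the
    indicator of v, an inner point of the edge uv is t*u + (1-t)*v), and ends
    are sets of rays. *)
Definition pt : Type := ((V -> R) + ((nat -> V) -> Prop))%type.

Definition vtx (v : V) : V -> R :=
  fun x => if excluded_middle_informative (x = v) then 1 else 0.

Definition ept (u v : V) (t : R) : V -> R :=
  fun x => if excluded_middle_informative (x = u) then t
           else if excluded_middle_informative (x = v) then 1 - t else 0.

Definition in_cplx (H : V -> V -> Prop) (p : pt) : Prop :=
  (exists v, p = inl (vtx v)) \/
  (exists u v t, H u v /\ 0 < t < 1 /\ p = inl (ept u v t)) \/
  (exists A, is_end H A /\ p = inr A).

Definition star (H : V -> V -> Prop) (v : V) (eps : R) : pt -> Prop :=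
  fun p => p = inl (vtx v) \/
           exists u t, H v u /\ 0 < t < 1 /\ 1 - eps < t /\ p = inl (ept v u t).

Definition seg (u v : V) (a b : R) : pt -> Prop :=
  fun p => exists t, a < t < b /\ p = inl (ept u v t).

Definition end_nbhd (H : V -> V -> Prop) (S : list V) (A : (nat -> V) -> Prop) : pt -> Prop :=
  fun p =>
    (exists x, compE H S A x /\ p = inl (vtx x)) \/
    (exists u v t, H u v /\ 0 < t < 1 /\ compE H S A u /\
                   (compE H S A v \/ In v S) /\ p = inl (ept u v t)) \/
    (exists B, is_end H B /\
               (forall r, B r -> exists n, forall i, compE H S A (r (n + i)%nat)) /\
               p = inr B).

Definition basic_nbhd (H : V -> V -> Prop) (p : pt) (N : pt -> Prop) : Prop :=
  (exists v eps, p = inl (vtx v) /\ 0 < eps <= 1 /\ N = star H v eps) \/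
  (exists u v t a b, H u v /\ 0 < a /\ a < t /\ t < b /\ b < 1 /\
                     p = inl (ept u v t) /\ N = seg u v a b) \/
  (exists A S, is_end H A /\ p = inr A /\ N = end_nbhd H S A).

Definition open_F (H : V -> V -> Prop) (O : pt -> Prop) : Prop :=
  (forall p, O p -> in_cplx H p) /\
  (forall p, O p -> exists N, basic_nbhd H p N /\ forall q, N q -> O q).

Definition S1 (z : R * R) : Prop := (fst z) ^ 2 + (snd z) ^ 2 = 1.

Definition open_S1 (U : R * R -> Prop) : Prop :=
  (forall z, U z -> S1 z) /\
  (forall z, U z -> exists eps, 0 < eps /\
     forall w, S1 w -> (fst w - fst z) ^ 2 + (snd w - snd z) ^ 2 < eps ^ 2 -> U w).

Definition cont_S1 (H : V -> V -> Prop) (sigma : R * R -> pt) : Prop :=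
  (forall z, S1 z -> in_cplx H (sigma z)) /\
  (forall O, open_F H O -> open_S1 (fun z => S1 z /\ O (sigma z))).

Definition embedding_S1 (H : V -> V -> Prop) (sigma : R * R -> pt) : Prop :=
  cont_S1 H sigma /\
  (forall z w, S1 z -> S1 w -> sigma z = sigma w -> z = w) /\
  (forall U, open_S1 U -> exists O, open_F H O /\
       forall z, S1 z -> (U z <-> O (sigma z))).

Definition ham_circle (H : V -> V -> Prop) : Prop :=
  exists sigma, embedding_S1 H sigma /\
    forall v, exists z, S1 z /\ sigma z = inl (vtx v).

Definition ham_curve (H : V -> V -> Prop) : Prop :=
  exists sigma, cont_S1 H sigma /\
    forall v, exists! z, S1 z /\ sigma z = inl (vtx v).

Definition faithful (F G : V -> V -> Prop) : Prop :=
  (forall A, is_end G A -> exists r, is_ray F r /\ A r) /\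
  (forall r1 r2, is_ray F r1 -> is_ray F r2 ->
     (ray_equiv F r1 r2 <-> ray_equiv G r1 r2)).

Definition has_disjoint_rays (A : (nat -> V) -> Prop) (k : nat) : Prop :=
  exists rs : nat -> (nat -> V),
    (forall i, (i < k)%nat -> A (rs i)) /\
    (forall i j, (i < k)%nat -> (j < k)%nat -> i <> j ->
       forall m n, rs i m <> rs j n).

Definition end_degree_eq (A : (nat -> V) -> Prop) (k : nat) : Prop :=
  has_disjoint_rays A k /\ ~ has_disjoint_rays A (S k).

Definition end_degree_le (A : (nat -> V) -> Prop) (k : nat) : Prop :=
  ~ has_disjoint_rays A (S k).

End Graphs.

Arguments infinite_vertices : clear implicits.

(* Main.v *)
Require Import Defs.
From Stdlib Require Import Reals List ClassicalEpsilon.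
From Stdlib Require Import Wf_nat Classical FunctionalExtensionality PropExtensionality Lra Lia Psatz.
From Coquelicot Require Coquelicot.
Open Scope R_scope.

(** Closed curves through a vertex [v0] are treated as loops [f : [0,1] -> |H|] with [f 0 = f 1 = v0].

    (1) => (2).  In a simple loop every open arc has a connected set of vertices, because each end inside
    the arc has a connected neighbourhood [C(S, alpha)] whose vertices lie in the arc.  Choose finite sets
    [T 0 = {v0}], [T 1], ... exhausting the vertices such that, within every gap of [T n] on the circle, the
    vertices of [T (n+1)] are connected in [G].  Keep the edges of the circle and the edges of [G] joining
    vertices of [T (n+1)] in a common gap of [T n].  Every gap remains connected and is left by at most two
    kept edges, so ends are the same as in [G] and no three disjoint rays enter a gap, while the two sides
    of an end on the circle give two disjoint rays.

    (3) => (1).  If the curve visits an end twice with vertices on both sides, then it passes four times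
    between that end and fixed vertices; every set separating the end from these meets all four passages in
    different vertices, as each vertex is visited once.  By Menger's theorem, applied to a sequence of minimum
    separators converging to the end, the end then has four disjoint rays.  So the preimage of an end is an
    interval, and collapsing these intervals and straightening the curve on edges gives a simple loop. *)

(** * Compactness of the interval and the circle *)

(** The circle edges alone need not be faithful: they may fall apart into double rays that split one
    end of the graph into several, while keeping all edges may leave ends of large degree. Hence the
    levels: an added edge is either trapped in a gap or has both endpoints in the finite set
    bounding it, so only circle edges leave a gap. Conversely, a curve can fail to be a circle in
    three ways: it can move back and forth on an edge, rest at an end, or return to an end after
    meeting vertices. Only the third is a matter of the graph, and the degree bound excludes it; the
    other two are repaired by reparametrisation. The parameters mapped to ends may form a
    Cantor-like set, so the collapsing map cannot be assembled interval by interval; it is an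
    integral. Infinitely many vertices exclude the degenerate loop that runs forth and back along
    one edge. Since 0 and 1 are the same point of the circle, a vertex is placed there; ends then
    have inner parameters, and only this vertex needs exceptional treatment. Rays are never
    concatenated from paths: a successor function that increases a rank is iterated, which makes
    repetition impossible. *)

Lemma cousin (a b : R) (Q : R -> R -> Prop) :
  a <= b ->
  (forall x y z, a <= x <= y -> y <= z <= b -> Q x y -> Q y z -> Q x z) ->
  (forall x, a <= x <= b -> exists d, 0 < d /\
     forall y z, a <= y <= x -> x <= z <= b -> x - d < y -> z < x + d -> Q y z) ->
  Q a b.
Proof.
  intros Hab Hcat Hloc.
  (* The supremum of the right ends reachable from [a] is itself reachable by the local hypothesis,
     and half a local step beyond it would contradict maximality unless [b] has been reached. *)
  set (E := fun t => a <= t <= b /\ Q a t).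
  assert (HEa : E a).
  { split; [lra|]. destruct (Hloc a) as [d [Hd H]]; [lra|]. apply H; lra. }
  destruct (completeness E) as [s [Hs1 Hs2]].
  { exists b. intros t [Ht _]. lra. }
  { exists a; exact HEa. }
  assert (Has : a <= s) by (apply Hs1; exact HEa).
  assert (Hsb : s <= b) by (apply Hs2; intros t [Ht _]; lra).
  destruct (Hloc s) as [d [Hd H]]; [lra|].
  assert (exists t, E t /\ s - d < t) as [t [[Ht HQ] Htd]].
  { apply NNPP; intro Hn. assert (s <= s - d); [|lra]. apply Hs2. intros t Ht.
    destruct (Rle_dec t (s - d)); auto. exfalso; apply Hn; exists t; split; auto; lra. }
  assert (Hts : t <= s) by (apply Hs1; split; auto).
  set (u := Rmin b (s + d / 2)).
  assert (Hu : s <= u <= b /\ u < s + d /\ (u = b \/ u = s + d/2)).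
  { unfold u, Rmin; destruct (Rle_dec b (s + d/2)); lra. }
  assert (HQu : Q a u). { apply Hcat with t; try lra; auto. apply H; lra. }
  destruct Hu as [Hu1 [Hu2 [Hu3|Hu3]]].
  - rewrite <- Hu3; exact HQu.
  - assert (u <= s) by (apply Hs1; split; auto; lra). lra.
Qed.

(** The supremum of the initial segments inside [P] cannot satisfy [P], because [P] is relatively
    open. It locates the points where a loop leaves an edge or a neighbourhood of an end. *)
Lemma first_exit (a b : R) (P : R -> Prop) :
  a <= b -> P a -> ~ P b ->
  (forall x, a <= x <= b -> P x -> exists d, 0 < d /\
     forall y, a <= y <= b -> x - d < y < x + d -> P y) ->
  exists c, a < c <= b /\ ~ P c /\ forall x, a <= x < c -> P x.
Proof.
  intros Hab Ha Hb Hop.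
  set (E := fun t => a <= t <= b /\ forall x, a <= x <= t -> P x).
  assert (HEa : E a).
  { split; [lra|]. intros x Hx. replace x with a by lra; exact Ha. }
  destruct (completeness E) as [c [Hc1 Hc2]].
  { exists b. intros t [Ht _]. lra. }
  { exists a; exact HEa. }
  assert (Hac : a <= c) by (apply Hc1; exact HEa).
  assert (Hcb : c <= b) by (apply Hc2; intros t [Ht _]; lra).
  assert (Hlt : forall x, a <= x < c -> P x).
  { intros x Hx. apply NNPP; intro Hn. assert (c <= x); [|lra]. apply Hc2. intros t [Ht Ht2].
    destruct (Rle_dec t x); auto. exfalso; apply Hn, Ht2; lra. }
  assert (Hc : ~ P c).
  { intro Hc. destruct (Hop c) as [d [Hd H]]; [lra|auto|].
    destruct (Req_dec c b) as [->|Hne]; [auto|].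
    set (u := Rmin b (c + d / 2)).
    assert (Hu : c < u <= b /\ u < c + d).
    { unfold u, Rmin; destruct (Rle_dec b (c + d/2)); lra. }
    assert (u <= c); [|lra]. apply Hc1. split; [lra|]. intros x Hx.
    destruct (Rlt_dec x c); [apply Hlt; lra|]. apply H; lra. }
  exists c. split; [|auto]. split; [|lra].
  destruct (Req_dec a c) as [He|]; [|lra]. exfalso; apply Hc; rewrite <- He; exact Ha.
Qed.

Definition circ (x : R) : R * R := (cos (2 * PI * x), sin (2 * PI * x)).

Lemma circ_S1 x : S1 (circ x).
Proof.
  unfold S1, circ; simpl. generalize (sin2_cos2 (2 * PI * x)); unfold Rsqr; lra.
Qed.

Lemma chord x y :
  (fst (circ x) - fst (circ y)) ^ 2 + (snd (circ x) - snd (circ y)) ^ 2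
  = 4 * (sin (PI * (x - y))) ^ 2.
Proof.
  unfold circ; simpl fst; simpl snd.
  assert (H1 := sin2_cos2 (2 * PI * x)). assert (H2 := sin2_cos2 (2 * PI * y)).
  assert (H3 := cos_minus (2 * PI * x) (2 * PI * y)).
  assert (H4 := cos_2a_sin (PI * (x - y))).
  replace (2 * (PI * (x - y))) with (2 * PI * x - 2 * PI * y) in H4 by ring.
  unfold Rsqr in *. nra.
Qed.

Lemma circ_period x : circ (x + 1) = circ x.
Proof.
  unfold circ. replace (2 * PI * (x + 1)) with (2 * PI * x + 2 * PI) by ring.
  rewrite cos_plus, sin_plus, cos_2PI, sin_2PI. f_equal; ring.
Qed.

Lemma circ_inj x y : Rabs (x - y) <= 1 -> circ x = circ y -> x = y \/ Rabs (x - y) = 1.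
Proof.
  intros Hd He. assert (H := chord x y). rewrite He in H.
  assert (Hs : sin (PI * (x - y)) = 0) by nra. clear H He.
  assert (HP := PI_RGT_0).
  destruct (Req_dec x y) as [|Hne]; [auto|right].
  unfold Rabs in *; destruct (Rcase_abs (x - y)).
  - destruct (Req_dec (-(x-y)) 1); auto. exfalso.
    assert (0 < sin (PI * (y - x))) by (apply sin_gt_0; nra).
    replace (PI * (y - x)) with (- (PI * (x - y))) in * by ring. rewrite sin_neg in *. lra.
  - destruct (Req_dec (x-y) 1); auto. exfalso.
    assert (0 < sin (PI * (x - y))) by (apply sin_gt_0; nra). lra.
Qed.

Lemma circ_surj z : S1 z -> exists x, 0 <= x < 1 /\ circ x = z.
Proof.
  destruct z as [a b]; unfold S1; simpl; intros H.
  assert (Ha : -1 <= a <= 1) by nra. assert (HP := PI_RGT_0).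
  assert (Hb := acos_bound a). assert (Hc := cos_acos a Ha). assert (Hs := sin_acos a Ha).
  destruct (Rle_dec 0 b) as [Hb0|Hb0].
  - exists (acos a / (2 * PI)). split.
    + split; [apply Rle_mult_inv_pos; lra|]. apply Rmult_lt_reg_r with (2 * PI); [lra|]; field_simplify; lra.
    + unfold circ. replace (2 * PI * (acos a / (2 * PI))) with (acos a) by (field; lra).
      rewrite Hc, Hs. f_equal. replace (1 - a²) with (b²) by (unfold Rsqr; nra).
      apply sqrt_Rsqr; lra.
  - assert (acos a <> 0). { intro H0. rewrite H0, sin_0 in Hs. symmetry in Hs.
      apply sqrt_eq_0 in Hs; unfold Rsqr in *; nra. }
    exists (1 - acos a / (2 * PI)). split.
    + assert (0 < acos a / (2 * PI)) by (apply Rdiv_lt_0_compat; lra).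
      assert (acos a / (2 * PI) < 1) by (apply Rmult_lt_reg_r with (2 * PI); [lra|]; field_simplify; lra). lra.
    + unfold circ. replace (2 * PI * (1 - acos a / (2 * PI))) with (2 * PI - acos a) by (field; lra).
      rewrite cos_minus, sin_minus, cos_2PI, sin_2PI, Hc, Hs.
      replace (1 - a²) with ((-b)²) by (unfold Rsqr; nra).
      rewrite sqrt_Rsqr by lra. f_equal; ring.
Qed.

Lemma circ_continuous x eps : 0 < eps -> exists d, 0 < d /\ forall y, x - d < y < x + d ->
  (fst (circ y) - fst (circ x)) ^ 2 + (snd (circ y) - snd (circ x)) ^ 2 < eps ^ 2.
Proof.
  intros He. assert (HP := PI_RGT_0).
  assert (Hc := continuity_sin 0). unfold continuity_pt, continue_in, limit1_in, limit_in in Hc.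
  destruct (Hc (eps / 2)) as [d [Hd H]]; [lra|]. simpl in H. unfold Rdist in H.
  exists (d / PI). split; [apply Rdiv_lt_0_compat; lra|].
  intros y Hy. rewrite chord.
  destruct (Req_dec y x) as [->|Hne].
  - replace (PI * (x - x)) with 0 by ring. rewrite sin_0. nra.
  - assert (Hs : Rabs (sin (PI * (y - x)) - sin 0) < eps / 2).
    { apply H. split. { split; [exact I|]. intro H0. apply Hne.
        symmetry in H0. apply Rmult_integral in H0. lra. }
      replace (PI * (y - x) - 0) with (PI * (y - x)) by ring.
      rewrite Rabs_mult, (Rabs_right PI) by lra.
      assert (Rabs (y - x) < d / PI) by (apply Rabs_def1; lra).
      apply Rmult_lt_compat_l with (r := PI) in H0; [|lra].
      replace (PI * (d / PI)) with d in H0 by (field; lra). exact H0. }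
    rewrite sin_0, Rminus_0_r in Hs. apply Rabs_def2 in Hs. nra.
Qed.

(** The second alternative is the seam: parameters near 0 and near 1 are far apart in the interval
    but close on the circle. *)
Lemma circ_inverse x d : 0 <= x <= 1 -> 0 < d -> exists eps, 0 < eps /\
  forall y, 0 <= y <= 1 ->
  (fst (circ y) - fst (circ x)) ^ 2 + (snd (circ y) - snd (circ x)) ^ 2 < eps ^ 2 ->
  Rabs (y - x) < d \/ 1 - d < Rabs (y - x).
Proof.
  intros Hx Hd. assert (HP := PI_RGT_0).
  (* The cap 1/2 keeps the angle within the range where the sine increases. *)
  set (e := Rmin d (1/2)).
  assert (He : 0 < e <= 1/2 /\ e <= d) by (unfold e, Rmin; destruct (Rle_dec d (1/2)); lra).
  assert (Hs : 0 < sin (PI * e)) by (apply sin_gt_0; nra).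
  exists (sin (PI * e)). split; auto. intros y Hy. rewrite chord. intros H.
  assert (Hsq : sin (PI * (y - x)) ^ 2 = sin (PI * Rabs (y - x)) ^ 2).
  { unfold Rabs; destruct (Rcase_abs (y - x)); [|reflexivity].
    replace (PI * - (y - x)) with (- (PI * (y - x))) by ring. rewrite sin_neg; ring. }
  rewrite Hsq in H.
  assert (Hr : 0 <= Rabs (y - x) <= 1).
  { split; [apply Rabs_pos|]. apply Rabs_le; lra. }
  set (r := Rabs (y - x)) in *.
  destruct (Rlt_dec r d); auto. destruct (Rlt_dec (1 - d) r); auto. exfalso.
  assert (sin (PI * e) <= sin (PI * r)); [|nra].
  destruct (Rle_dec r (1/2)).
  - apply sin_incr_1; nra.
  - replace (sin (PI * r)) with (sin (PI * (1 - r))).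
    2:{ replace (PI * (1 - r)) with (PI - PI * r) by ring. apply sin_PI_x. }
    apply sin_incr_1; nra.
Qed.

(** * Connectivity and ends *)

Arguments is_ray {V}. Arguments reach_avoid {V}. Arguments tails_same_comp {V}.
Arguments ray_equiv {V}. Arguments compE {V}. Arguments vtx {V}. Arguments ept {V}.
Arguments in_cplx {V}. Arguments star {V}. Arguments seg {V}. Arguments end_nbhd {V}.
Arguments basic_nbhd {V}. Arguments open_F {V}. Arguments cont_S1 {V}.
Arguments embedding_S1 {V}. Arguments has_disjoint_rays {V}.

Record lf_graph {V : Type} (H : V -> V -> Prop) : Prop := {
  lf_sym : forall u v, H u v -> H v u;
  lf_irr : forall v, ~ H v v;
  lf_fin : locally_finite V H }.

Section Connectivity.
Context {V : Type}.
Implicit Types (H : V -> V -> Prop) (D : V -> Prop) (S : list V) (r : nat -> V).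

(** Generalises [reach_avoid] from complements of finite sets to arbitrary vertex sets, because arcs
    and gaps of the circle have to be connected within themselves. *)
Inductive conn H D : V -> V -> Prop :=
| conn_refl x : D x -> conn H D x x
| conn_step x y z : D x -> H x y -> conn H D y z -> conn H D x z.

Definition avoid S : V -> Prop := fun v => ~ In v S.

Lemma reach_conn H S x y : reach_avoid H S x y <-> conn H (avoid S) x y.
Proof.
  split; induction 1; try (constructor; assumption); econstructor; eauto.
Qed.

Lemma conn_dom_l H D x y : conn H D x y -> D x.
Proof. destruct 1; auto. Qed.

Lemma conn_dom_r H D x y : conn H D x y -> D y.
Proof. induction 1; auto. Qed.

Lemma conn_trans H D x y z : conn H D x y -> conn H D y z -> conn H D x z.
Proof. induction 1; auto. intros; econstructor; eauto. Qed.

Lemma conn_edge H D x y : D x -> D y -> H x y -> conn H D x y.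
Proof. intros; econstructor; eauto using conn_refl. Qed.

Lemma conn_sym H D x y : (forall u v, H u v -> H v u) -> conn H D x y -> conn H D y x.
Proof.
  intros Hs; induction 1; [constructor; auto|].
  eapply conn_trans; eauto. apply conn_edge; auto. eapply conn_dom_l; eauto.
Qed.

Lemma conn_mono H H' D D' x y :
  (forall u v, H u v -> H' u v) -> (forall v, D v -> D' v) -> conn H D x y -> conn H' D' x y.
Proof. intros HH HD; induction 1; [constructor; auto|econstructor; eauto]. Qed.

Lemma conn_exit H D x y (P : V -> Prop) : conn H D x y -> P x -> ~ P y ->
  exists u w, conn H (fun v => D v /\ P v) x u /\ H u w /\ ~ P w /\ D w /\ conn H D w y.
Proof.
  induction 1 as [x Hx|x y z Hx Hxy Hyz IH]; intros Px Pz; [contradiction|].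
  destruct (classic (P y)) as [Py|Py].
  - destruct (IH Py Pz) as [u [w [A [B C]]]]. exists u, w. split; auto.
    econstructor; eauto.
  - exists x, y. repeat split; auto. constructor; auto. eapply conn_dom_l; eauto.
Qed.

Lemma conn_inv H D x y (P : V -> Prop) : conn H D x y -> P x ->
  (forall u w, D u -> P u -> H u w -> D w -> P w) -> conn H (fun v => D v /\ P v) x y.
Proof.
  induction 1 as [x Hx|x y z Hx Hxy Hyz IH]; intros Px HP; [constructor; auto|].
  econstructor; eauto. apply IH; auto. eapply HP; eauto. eapply conn_dom_l; eauto.
Qed.

(** The third clause serves finite closures: vertices that enter a finite set as part of a
    connecting walk stay attached to the end of that walk. *)
Lemma conn_support H D x y : conn H D x y ->
  exists l, (forall v, In v l -> D v) /\ conn H (fun v => In v l) x y /\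
    (forall v, In v l -> conn H (fun v => In v l) v y).
Proof.
  induction 1 as [x Hx|x y z Hx Hxy Hyz [l [A [B C]]]].
  - exists (x :: nil). split; [|split].
    + intros v [->|[]]; auto.
    + constructor; left; auto.
    + intros v [->|[]]; constructor; left; auto.
  - exists (x :: l). assert (E : conn H (fun v => In v (x :: l)) x z).
    { econstructor; [left; auto|eauto|]. eapply conn_mono; [| |exact B]; auto. intros; right; auto. }
    split; [|split]; auto.
    + intros v [->|Hv]; auto.
    + intros v [<-|Hv]; auto.
      eapply conn_mono; [| |exact (C v Hv)]; auto. intros; right; auto.
Qed.

Definition ev_in r (C : V -> Prop) : Prop := exists n, forall i, (n <= i)%nat -> C (r i).

Lemma ev_in_mono r (C C' : V -> Prop) : (forall v, C v -> C' v) -> ev_in r C -> ev_in r C'.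
Proof. intros HC [n Hn]; exists n; auto. Qed.

Lemma ev_in_and r (C C' : V -> Prop) : ev_in r C -> ev_in r C' -> ev_in r (fun v => C v /\ C' v).
Proof. intros [n Hn] [m Hm]; exists (max n m); split; [apply Hn|apply Hm]; lia. Qed.

Lemma ev_in_ex r (C : V -> Prop) : ev_in r C -> exists i, C (r i).
Proof. intros [n Hn]; exists n; auto. Qed.

Lemma ray_avoid H r S : is_ray H r -> ev_in r (avoid S).
Proof.
  intros [Hi _]. induction S as [|s S [n Hn]]; [exists O; intros i _ []|].
  destruct (classic (exists i, r i = s)) as [[i Hs]|Hno].
  - exists (max n (i + 1)). intros j Hj [He|He]; [|apply (Hn j); auto; lia].
    assert (i = j) by (apply Hi; congruence). lia.
  - exists n. intros j Hj [He|He]; [apply Hno; eauto|apply (Hn j); auto].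
Qed.

Lemma ray_conn H r D n : (forall u v, H u v -> H v u) -> is_ray H r ->
  (forall i, (n <= i)%nat -> D (r i)) ->
  forall i j, (n <= i)%nat -> (n <= j)%nat -> conn H D (r i) (r j).
Proof.
  intros Hs [_ Hr] HD.
  assert (Hfw : forall k i, (n <= i)%nat -> conn H D (r i) (r (k + i)%nat)).
  { induction k; intros i Hi; [constructor; auto|].
    apply conn_trans with (r (k + i)%nat); auto.
    apply conn_edge; [apply HD; lia..|]. apply (Hr (k + i)%nat). }
  intros i j Hi Hj. destruct (Nat.le_ge_cases i j).
  - replace j with ((j - i) + i)%nat by lia; auto.
  - apply conn_sym; auto. replace i with ((i - j) + j)%nat by lia; auto.
Qed.

(** The vertex set of [C(S, alpha)], where [alpha] is the end of the ray [r]. *)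
Definition rcomp H S r (x : V) : Prop := ev_in r (fun y => conn H (avoid S) y x).

Lemma comp_avoid H S r x : rcomp H S r x -> ~ In x S.
Proof. intros [n Hn]. exact (conn_dom_r _ _ _ _ (Hn n (le_n n))). Qed.

Lemma comp_closed H S r x y : rcomp H S r x -> conn H (avoid S) x y -> rcomp H S r y.
Proof. intros Hx Hxy. eapply ev_in_mono; [|exact Hx]. intros z Hz; cbv beta in *. eapply conn_trans; eauto. Qed.

Lemma comp_edge H S r x y : rcomp H S r x -> H x y -> ~ In y S -> rcomp H S r y.
Proof.
  intros Hx Hxy Hy. eapply comp_closed; eauto. apply conn_edge; auto.
  exact (comp_avoid _ _ _ _ Hx).
Qed.

Lemma comp_conn0 H S r x y : (forall u v, H u v -> H v u) ->
  rcomp H S r x -> rcomp H S r y -> conn H (avoid S) x y.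
Proof.
  intros Hs Hx Hy. destruct (ev_in_ex _ _ (ev_in_and _ _ _ Hx Hy)) as [i [A B]].
  eapply conn_trans; [apply conn_sym|]; eauto.
Qed.

Lemma comp_conn H S r x y : (forall u v, H u v -> H v u) ->
  rcomp H S r x -> rcomp H S r y -> conn H (rcomp H S r) x y.
Proof.
  intros Hs Hx Hy. assert (A := comp_conn0 _ _ _ _ _ Hs Hx Hy).
  eapply conn_mono; [intros u v E; exact E| |apply (conn_inv _ _ _ _ (rcomp H S r) A Hx)].
  - intros v [_ ?]; auto.
  - intros u w _ Hu Huw Hw. eapply comp_edge; eauto.
Qed.

Lemma comp_tail H S r : (forall u v, H u v -> H v u) -> is_ray H r -> ev_in r (rcomp H S r).
Proof.
  intros Hs Hr. destruct (ray_avoid H r S Hr) as [n Hn]. exists n. intros i Hi.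
  exists n. intros j Hj. apply (ray_conn H r _ n); auto.
Qed.

Lemma comp_equiv H S r r' x : (forall u v, H u v -> H v u) ->
  ray_equiv H r r' -> rcomp H S r x <-> rcomp H S r' x.
Proof.
  intros Hs He. destruct (He S) as [n [m Hnm]]. split; intros Hx.
  - destruct (ev_in_ex _ _ (ev_in_and _ _ (fun v => exists i, v = r (n + i)%nat) Hx ltac:(exists n; intros i Hi; exists (i - n)%nat; f_equal; lia))) as [i [A [k Hk]]].
    exists m. intros j Hj. specialize (Hnm k (j - m)%nat). rewrite reach_conn in Hnm.
    replace (m + (j - m))%nat with j in Hnm by lia. rewrite <- Hk in Hnm.
    eapply conn_trans; [apply conn_sym|]; eauto.
  - destruct (ev_in_ex _ _ (ev_in_and _ _ (fun v => exists i, v = r' (m + i)%nat) Hx ltac:(exists m; intros i Hi; exists (i - m)%nat; f_equal; lia))) as [i [A [k Hk]]].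
    exists n. intros j Hj. specialize (Hnm (j - n)%nat k). rewrite reach_conn in Hnm.
    replace (n + (j - n))%nat with j in Hnm by lia. rewrite <- Hk in Hnm.
    eapply conn_trans; eauto.
Qed.

(** Components are equal or disjoint, so one common vertex for each [S] decides equivalence; most
    later proofs of equivalence use this form. *)
Lemma ray_equivE H r r' : (forall u v, H u v -> H v u) -> is_ray H r -> is_ray H r' ->
  ray_equiv H r r' <-> forall S, exists x, rcomp H S r x /\ rcomp H S r' x.
Proof.
  intros Hs Hr Hr'. split.
  - intros He S. destruct (ev_in_ex _ _ (comp_tail H S r Hs Hr)) as [i Hi].
    exists (r i). split; auto. apply (comp_equiv H S r r'); auto.
  - intros Hx S. destruct (Hx S) as [x [[n Hn] [m Hm]]]. exists n, m. intros i j.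
    rewrite reach_conn. eapply conn_trans; [apply Hn; lia|]. apply conn_sym; auto.
    apply Hm; lia.
Qed.

Lemma comp_meet H S r r' x : (forall u v, H u v -> H v u) ->
  rcomp H S r x -> rcomp H S r' x -> forall y, rcomp H S r y <-> rcomp H S r' y.
Proof.
  intros Hs A B y; split; intros C.
  - apply comp_closed with x; auto. apply (comp_conn0 _ _ _ _ _ Hs A C).
  - apply comp_closed with x; auto. apply (comp_conn0 _ _ _ _ _ Hs B C).
Qed.

Lemma ray_equiv_comp H r r' : (forall u v, H u v -> H v u) -> is_ray H r -> is_ray H r' ->
  (forall S, ev_in r' (rcomp H S r)) -> ray_equiv H r r'.
Proof.
  intros Hs Hr Hr' Hx. apply ray_equivE; auto. intros S.
  destruct (ev_in_ex _ _ (ev_in_and _ _ _ (Hx S) (comp_tail H S r' Hs Hr'))) as [i [A B]].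
  eauto.
Qed.

Lemma ray_equiv_refl H r : (forall u v, H u v -> H v u) -> is_ray H r -> ray_equiv H r r.
Proof.
  intros Hs Hr. apply ray_equivE; auto. intros S.
  destruct (ev_in_ex _ _ (comp_tail H S r Hs Hr)); eauto.
Qed.

Lemma ray_equiv_sym H r r' : (forall u v, H u v -> H v u) -> is_ray H r -> is_ray H r' ->
  ray_equiv H r r' -> ray_equiv H r' r.
Proof.
  intros Hs Hr Hr'. rewrite !ray_equivE; auto. intros E S; destruct (E S) as [x []]; eauto.
Qed.

Lemma ray_equiv_trans H r r' r'' : (forall u v, H u v -> H v u) ->
  is_ray H r -> is_ray H r' -> is_ray H r'' ->
  ray_equiv H r r' -> ray_equiv H r' r'' -> ray_equiv H r r''.
Proof.
  intros Hs Hr Hr' Hr'' A B. rewrite ray_equivE; auto. intros S.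
  destruct (ev_in_ex _ _ (comp_tail H S r' Hs Hr')) as [i Hi].
  exists (r' i). split; [apply (comp_equiv H S r r')|apply (comp_equiv H S r' r'')]; auto.
Qed.

Definition endof H r : (nat -> V) -> Prop := fun r' => is_ray H r' /\ ray_equiv H r r'.

Lemma endof_self H r : (forall u v, H u v -> H v u) -> is_ray H r -> endof H r r.
Proof. intros; split; auto using ray_equiv_refl. Qed.

Lemma endof_eq H r r' : (forall u v, H u v -> H v u) -> is_ray H r -> is_ray H r' ->
  endof H r = endof H r' <-> ray_equiv H r r'.
Proof.
  intros Hs Hr Hr'. split.
  - intros He. assert (A : endof H r r') by (rewrite He; apply endof_self; auto). apply A.
  - intros He. apply functional_extensionality; intros q. apply propositional_extensionality.
    split; intros [A B]; split; auto.
    + apply ray_equiv_trans with r; auto. apply ray_equiv_sym; auto.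
    + apply ray_equiv_trans with r'; auto.
Qed.

Lemma endof_end H r : is_ray H r -> is_end V H (endof H r).
Proof. intros; exists r; auto. Qed.

Lemma compE_endof H S r x : (forall u v, H u v -> H v u) -> is_ray H r ->
  compE H S (endof H r) x <-> rcomp H S r x.
Proof.
  intros Hs Hr. split.
  - intros [r' [[Hr' He] [n Hn]]]. apply (comp_equiv H S r r'); auto.
    exists n. intros i Hi. apply reach_conn. replace i with (n + (i - n))%nat by lia. auto.
  - intros [n Hn]. exists r. split; [apply endof_self; auto|]. exists n. intros i.
    apply reach_conn, Hn; lia.
Qed.

Lemma end_nbhdE H S r p : (forall u v, H u v -> H v u) -> is_ray H r ->
  end_nbhd H S (endof H r) p <->
  (exists x, rcomp H S r x /\ p = inl (vtx x)) \/
  (exists u v t, H u v /\ 0 < t < 1 /\ rcomp H S r u /\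
                 (rcomp H S r v \/ In v S) /\ p = inl (ept u v t)) \/
  (exists r', is_ray H r' /\ ev_in r' (rcomp H S r) /\ p = inr (endof H r')).
Proof.
  intros Hs Hr. unfold end_nbhd. split.
  - intros [[x [A B]]|[[u [v [t [A [B [C [D E]]]]]]]|[B [[r' [A1 A2]] [C D]]]]].
    + left; exists x. rewrite compE_endof in A; auto.
    + right; left; exists u, v, t. rewrite !compE_endof in *; auto.
    + right; right. exists r'. split; auto. change (B = endof H r') in A2. subst B. split; auto.
      destruct (C r') as [n Hn]; [apply endof_self; auto|]. exists n. intros i Hi.
      apply compE_endof; auto. replace i with (n + (i - n))%nat by lia. auto.
  - intros [[x [A B]]|[[u [v [t [A [B [C [D E]]]]]]]|[r' [A [B C]]]]].
    + left; exists x. rewrite compE_endof; auto.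
    + right; left; exists u, v, t. rewrite !compE_endof; auto.
    + right; right. exists (endof H r'). split; [apply endof_end; auto|]. split; auto.
      intros q [Hq Hqe].
      assert (E : ev_in q (rcomp H S r)).
      { destruct (ev_in_ex _ _ (ev_in_and _ _ _ B (comp_tail H S r' Hs A))) as [i [E1 E2]].
        eapply ev_in_mono; [|apply (comp_tail H S q Hs Hq)]. intros v Hv.
        apply (comp_meet H S r r' (r' i) Hs E1 E2). apply (comp_equiv H S r' q); auto. }
      destruct E as [n Hn]. exists n. intros i. apply compE_endof; auto. apply Hn; lia.
Qed.

Lemma comp_mono H S S' r x : incl S S' -> rcomp H S' r x -> rcomp H S r x.
Proof.
  intros Hi. apply ev_in_mono. intros y. apply conn_mono; auto.
  intros v Hv Hv'; apply Hv, Hi, Hv'.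
Qed.

Lemma end_nbhd_mono H S S' r p : (forall u v, H u v -> H v u) -> is_ray H r -> incl S S' ->
  end_nbhd H S' (endof H r) p -> end_nbhd H S (endof H r) p.
Proof.
  intros Hs Hr Hi. rewrite !end_nbhdE; auto.
  intros [[x [A B]]|[[u [v [t [A [B [C [D E]]]]]]]|[r' [A [B C]]]]].
  - left; exists x; split; auto. eapply comp_mono; eauto.
  - right; left; exists u, v, t. assert (C' := comp_mono _ _ _ _ _ Hi C).
    repeat split; auto; try lra. destruct (classic (In v S)); auto.
    left. eapply comp_edge; eauto.
  - right; right. exists r'. repeat split; auto; try apply A. eapply ev_in_mono; [|exact B].
    intros; eapply comp_mono; eauto.
Qed.

End Connectivity.

(** * The topology of the Freudenthal compactification *)

Section Topology.
Context {V : Type}.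
Implicit Types (H : V -> V -> Prop).

Lemma vtx_inj (v w : V) : vtx v = vtx w -> v = w.
Proof.
  intros E. assert (A := f_equal (fun f => f v) E). unfold vtx in A.
  destruct (excluded_middle_informative (v = v)); [|congruence].
  destruct (excluded_middle_informative (v = w)); auto; lra.
Qed.

Lemma ept_l (u v : V) t : ept u v t u = t.
Proof. unfold ept. destruct (excluded_middle_informative (u = u)); congruence. Qed.

Lemma ept_r (u v : V) t : u <> v -> ept u v t v = 1 - t.
Proof.
  unfold ept; intros. destruct (excluded_middle_informative (v = u)); [congruence|].
  destruct (excluded_middle_informative (v = v)); congruence.
Qed.

Lemma ept_other (u v x : V) t : x <> u -> x <> v -> ept u v t x = 0.
Proof.
  unfold ept; intros. destruct (excluded_middle_informative (x = u)); [congruence|].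
  destruct (excluded_middle_informative (x = v)); congruence.
Qed.

Lemma ept_swap (u v : V) t : u <> v -> ept u v t = ept v u (1 - t).
Proof.
  intros Hn. apply functional_extensionality; intros x.
  destruct (classic (x = u)) as [->|Hu]; [rewrite ept_l, ept_r; auto; lra|].
  destruct (classic (x = v)) as [->|Hv]; [rewrite ept_l, ept_r; auto; lra|].
  rewrite !ept_other; auto.
Qed.

Lemma ept_supp (u v x : V) t : u <> v -> 0 < t < 1 -> ept u v t x <> 0 <-> x = u \/ x = v.
Proof.
  intros Hn Ht. destruct (classic (x = u)) as [->|Hu]; [rewrite ept_l; split; auto; lra|].
  destruct (classic (x = v)) as [->|Hv]; [rewrite ept_r; auto; split; auto; lra|].
  rewrite ept_other; auto. split; [lra|tauto].
Qed.

(** The support of the function is the pair of endpoints, which recovers the edge up to orientation;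
    the value at [u] then gives the position. *)
Lemma ept_inj (u v u' v' : V) t t' : u <> v -> u' <> v' -> 0 < t < 1 -> 0 < t' < 1 ->
  ept u v t = ept u' v' t' -> (u = u' /\ v = v' /\ t = t') \/ (u = v' /\ v = u' /\ t = 1 - t').
Proof.
  intros Hn Hn' Ht Ht' E.
  assert (A : u = u' \/ u = v').
  { apply (ept_supp u' v' u t'); auto. rewrite <- E. apply ept_supp; auto. }
  assert (B : v = u' \/ v = v').
  { apply (ept_supp u' v' v t'); auto. rewrite <- E. apply ept_supp; auto. }
  assert (C := f_equal (fun f => f u) E). cbv beta in C. rewrite ept_l in C.
  destruct A as [->| ->], B as [->| ->]; try congruence.
  - left. rewrite ept_l in C. auto.
  - right. rewrite ept_r in C; auto.
Qed.

Lemma vtx_ept (u v w : V) t : u <> v -> 0 < t < 1 -> vtx w <> ept u v t.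
Proof.
  intros Hn Ht E. assert (A := f_equal (fun f => f w) E). cbv beta in A.
  unfold vtx in A. destruct (excluded_middle_informative (w = w)); [|congruence].
  destruct (classic (w = u)) as [->|Hu]; [rewrite ept_l in A; lra|].
  destruct (classic (w = v)) as [->|Hv]; [rewrite ept_r in A; auto; lra|].
  rewrite ept_other in A; auto; lra.
Qed.

Lemma edge_neq H u v : lf_graph H -> H u v -> u <> v.
Proof. intros OK E ->. exact (lf_irr _ OK _ E). Qed.

Lemma cplx_cases H p : in_cplx H p ->
  (exists v, p = inl (vtx v)) \/
  (exists u v t, H u v /\ 0 < t < 1 /\ p = inl (ept u v t)) \/
  (exists r, is_ray H r /\ p = inr (endof H r)).
Proof.
  intros [A|[A|[A [[r [Hr E]] Hp]]]]; auto. right; right. exists r. split; auto. subst; auto.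
Qed.

Lemma bn_vtx H v N : lf_graph H ->
  basic_nbhd H (inl (vtx v)) N <-> exists eps, 0 < eps <= 1 /\ N = star H v eps.
Proof.
  intros OK. split.
  - intros [[w [eps [E [A B]]]]|[[u [w [t [a [b [A [B [C [D [F [E _]]]]]]]]]]]|[A [S [_ [E _]]]]]].
    + injection E as E. apply vtx_inj in E. subst. eauto.
    + injection E as E. apply vtx_ept in E; [contradiction|eapply edge_neq; eauto|lra].
    + discriminate.
  - intros [eps [A B]]. left. exists v, eps. auto.
Qed.

Lemma seg_swap (u v : V) a b q : u <> v -> seg v u a b q <-> seg u v (1 - b) (1 - a) q.
Proof.
  intros Hn. split; intros [t [A ->]]; exists (1 - t); (split; [lra|]);
    rewrite ept_swap; auto.
Qed.

(** An inner point is presented from either endpoint of its edge, so the neighbourhood is a segment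
    in the given orientation only up to extensional equality. *)
Lemma bn_ept H u v t N : lf_graph H -> H u v -> 0 < t < 1 ->
  basic_nbhd H (inl (ept u v t)) N ->
  exists a b, 0 < a < t /\ t < b < 1 /\ forall q, N q <-> seg u v a b q.
Proof.
  intros OK Huv Ht.
  intros [[w [eps [E _]]]|[[u' [v' [t' [a [b [A [B [C [D [F [E ->]]]]]]]]]]]|[A [S [_ [E _]]]]]].
  - injection E as E. symmetry in E. apply vtx_ept in E; [contradiction|eapply edge_neq; eauto|lra].
  - injection E as E. assert (Hn := edge_neq _ _ _ OK Huv).
    apply ept_inj in E; auto; [|eapply edge_neq; eauto|lra].
    destruct E as [[-> [-> ->]]|[-> [-> ->]]].
    + exists a, b. split; [lra|split; [lra|reflexivity]].
    + exists (1 - b), (1 - a). split; [lra|split; [lra|]]. intros q. apply seg_swap; auto.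
  - discriminate.
Qed.

Lemma bn_seg H u v t a b : H u v -> 0 < a -> a < t -> t < b -> b < 1 ->
  basic_nbhd H (inl (ept u v t)) (seg u v a b).
Proof. intros. right; left. exists u, v, t, a, b. repeat split; auto. Qed.

Lemma bn_end H r N : lf_graph H -> is_ray H r ->
  basic_nbhd H (inr (endof H r)) N <-> exists S, N = end_nbhd H S (endof H r).
Proof.
  intros OK Hr. split.
  - intros [[w [eps [E _]]]|[[u' [v' [t' [a [b [A [B [C [D [F [E _]]]]]]]]]]]|[A [S [_ [E ->]]]]]];
      try discriminate. injection E as <-. eauto.
  - intros [S ->]. right; right. exists (endof H r), S. split; auto. apply endof_end; auto.
Qed.

Lemma bn_ex H p : in_cplx H p -> exists N, basic_nbhd H p N.
Proof.
  intros [[v ->]|[[u [v [t [A [B ->]]]]]|[A [HA ->]]]].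
  - exists (star H v 1). left. exists v, 1. repeat split; auto; lra.
  - exists (seg u v (t/2) ((1+t)/2)). apply bn_seg; auto; lra.
  - exists (end_nbhd H nil A). right; right. exists A, nil; auto.
Qed.

Lemma end_nbhd_self H S r : lf_graph H -> is_ray H r -> end_nbhd H S (endof H r) (inr (endof H r)).
Proof.
  intros OK Hr. rewrite end_nbhdE; auto; [|apply OK]. right; right. exists r.
  repeat split; auto; try apply Hr. apply comp_tail; auto. apply OK.
Qed.

Lemma bn_self H p N : lf_graph H -> basic_nbhd H p N -> N p.
Proof.
  intros OK [[w [eps [-> [A ->]]]]|[[u [v [t [a [b [A [B [C [D [F [-> ->]]]]]]]]]]]|[A [S [[r [Hr ->]] [-> ->]]]]]].
  - left; auto.
  - exists t; auto.
  - exact (end_nbhd_self H S r OK Hr).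
Qed.

Lemma bn_open H p N : lf_graph H -> basic_nbhd H p N -> open_F H N.
Proof.
  intros OK [[w [eps [-> [A ->]]]]|[[u [v [t [a [b [A [B [C [D [F [-> ->]]]]]]]]]]]|[A [S [[r [Hr ->]] [-> ->]]]]]].
  - split.
    + intros p [->|[u [t [B [C [D ->]]]]]]; [left; eauto|right; left; exists w, u, t; auto].
    + intros p [->|[u [t [B [C [D ->]]]]]].
      * exists (star H w eps). split; auto. left; exists w, eps; auto.
      * exists (seg w u ((1 - eps + t)/2) ((1 + t)/2)). split; [apply bn_seg; auto; lra|].
        intros q [s [E ->]]. right. exists u, s. repeat split; auto; lra.
  - split.
    + intros p [s [E ->]]. right; left; exists u, v, s; repeat split; auto; lra.
    + intros p [s [E ->]]. exists (seg u v a b). split; [apply bn_seg; auto; lra|auto].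
  - change (fun r' => is_ray H r' /\ ray_equiv H r r') with (endof H r). assert (Hs := lf_sym _ OK). split.
    + intros p. rewrite end_nbhdE; auto.
      intros [[x [A B]]|[[u [v [t [A [B [C [D E]]]]]]]|[r' [A [B C]]]]].
      * left; eauto.
      * right; left; exists u, v, t; auto.
      * right; right. exists (endof H r'). split; auto. apply endof_end; auto.
    + intros p. rewrite end_nbhdE; auto.
      intros [[x [A ->]]|[[u [v [t [A [B [C [D ->]]]]]]]|[r' [A [B ->]]]]].
      * exists (star H x 1). split; [left; exists x, 1; repeat split; auto; lra|].
        intros q [->|[u [t [B [C [D ->]]]]]]; rewrite end_nbhdE; auto; [left; eauto|].
        right; left. exists x, u, t. repeat split; auto; try lra.
        destruct (classic (In u S)); auto. left. eapply comp_edge; eauto.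
      * exists (seg u v (t/2) ((1+t)/2)). split; [apply bn_seg; auto; lra|].
        intros q [s [E ->]]. rewrite end_nbhdE; auto. right; left. exists u, v, s.
        repeat split; auto; lra.
      (* The same [S] works at any other end inside the neighbourhood, since both ends have the same
         component after deleting [S]. *)
      * exists (end_nbhd H S (endof H r')). split; [apply bn_end; eauto|].
        assert (Hm : exists x, rcomp H S r x /\ rcomp H S r' x).
        { destruct (ev_in_ex _ _ (ev_in_and _ _ _ B (comp_tail H S r' Hs A))) as [i [? ?]]; eauto. }
        destruct Hm as [x [Hx Hx']]. assert (M := comp_meet H S r r' x Hs Hx Hx').
        intros q. rewrite !end_nbhdE; auto.
        intros [[y [C D]]|[[u [v [t [C [D [E [F G]]]]]]]|[r'' [C [D E]]]]].
        -- left; exists y. rewrite M; auto.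
        -- right; left; exists u, v, t. rewrite !M; auto.
        -- right; right. exists r''. split; auto. split; auto. eapply ev_in_mono; [|exact D].
           intros y; apply M.
Qed.

Lemma bn_inter H p N1 N2 : lf_graph H -> basic_nbhd H p N1 -> basic_nbhd H p N2 ->
  exists N, basic_nbhd H p N /\ forall q, N q -> N1 q /\ N2 q.
Proof.
  intros OK B1 B2.
  destruct B1 as [[w [eps [-> [A ->]]]]|[[u [v [t [a [b [A [B [C [D [F [-> ->]]]]]]]]]]]|[A [S [[r [Hr E]] [-> ->]]]]]].
  - apply bn_vtx in B2; auto. destruct B2 as [eps' [A' ->]].
    assert (M := Rmin_l eps eps'). assert (M' := Rmin_r eps eps').
    exists (star H w (Rmin eps eps')). split.
    + left. exists w, (Rmin eps eps'). repeat split; auto; [|lra]. apply Rmin_glb_lt; lra.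
    + intros q [->|[u [t [B [C [D ->]]]]]]; [split; left; auto|].
      split; right; exists u, t; repeat split; auto; lra.
  - apply bn_ept in B2; auto; [|lra]. destruct B2 as [a' [b' [A' [B' N2E]]]].
    exists (seg u v (Rmax a a') (Rmin b b')). split.
    + apply bn_seg; auto.
      * apply Rlt_le_trans with a; auto. apply Rmax_l.
      * apply Rmax_lub_lt; lra.
      * apply Rmin_glb_lt; lra.
      * apply Rle_lt_trans with b; auto. apply Rmin_l.
    + assert (M1 := Rmax_l a a'). assert (M2 := Rmax_r a a').
      assert (M3 := Rmin_l b b'). assert (M4 := Rmin_r b b').
      intros q [s [Hs ->]]. rewrite N2E. split; exists s; split; auto; lra.
  - change (A = endof H r) in E. subst A. apply bn_end in B2; auto. destruct B2 as [S' ->].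
    exists (end_nbhd H (S ++ S') (endof H r)). split; [apply bn_end; eauto|].
    assert (Hs := lf_sym _ OK).
    intros q Hq. split; (eapply end_nbhd_mono; [exact Hs|exact Hr| |exact Hq]).
    + apply incl_appl, incl_refl.
    + apply incl_appr, incl_refl.
Qed.

Lemma end_nbhd_vtx H S r v : lf_graph H -> is_ray H r ->
  end_nbhd H S (endof H r) (inl (vtx v)) <-> rcomp H S r v.
Proof.
  intros OK Hr. rewrite end_nbhdE; auto; [|apply OK]. split; [|left; eauto].
  intros [[x [A B]]|[[u [w [t [A [B [C [D E]]]]]]]|[r' [A [B C]]]]]; try discriminate.
  - injection B as B. apply vtx_inj in B. congruence.
  - injection E as E. apply vtx_ept in E; [contradiction|eapply edge_neq; eauto|lra].
Qed.

Lemma end_nbhd_ept H S r u v t : lf_graph H -> is_ray H r -> H u v -> 0 < t < 1 ->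
  end_nbhd H S (endof H r) (inl (ept u v t)) <->
  (rcomp H S r u \/ rcomp H S r v) /\ (rcomp H S r u \/ In u S) /\ (rcomp H S r v \/ In v S).
Proof.
  intros OK Hr Huv Ht. assert (Hs := lf_sym _ OK). assert (Hn := edge_neq _ _ _ OK Huv).
  rewrite end_nbhdE; auto. split.
  - intros [[x [A B]]|[[u' [w' [t' [A [B [C [D E]]]]]]]|[r' [A [B C]]]]]; try discriminate.
    + injection B as B. symmetry in B. apply vtx_ept in B; [contradiction|auto|lra].
    + injection E as E. apply ept_inj in E; auto; [|eapply edge_neq; eauto].
      destruct E as [[-> [-> ->]]|[-> [-> ->]]]; tauto.
  - intros [[A|A] [B C]]; right; left.
    + exists u, v, t. auto.
    + exists v, u, (1 - t). repeat split; auto; try lra. rewrite ept_swap; auto.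
Qed.

Lemma end_nbhd_end H S r r' : lf_graph H -> is_ray H r -> is_ray H r' ->
  end_nbhd H S (endof H r) (inr (endof H r')) <-> ev_in r' (rcomp H S r).
Proof.
  intros OK Hr Hr'. assert (Hs := lf_sym _ OK). rewrite end_nbhdE; auto. split.
  - intros [[x [A B]]|[[u' [w' [t' [A [B [C [D E]]]]]]]|[q [A [B C]]]]]; try discriminate.
    injection C as C. apply endof_eq in C; auto.
    destruct (ev_in_ex _ _ (ev_in_and _ _ _ B (comp_tail H S q Hs A))) as [i [E1 E2]].
    eapply ev_in_mono; [|apply (comp_tail H S r' Hs Hr')]. intros v Hv.
    apply (comp_meet H S r q (q i) Hs E1 E2). apply (comp_equiv H S r' q); auto.
  - intros E. right; right. exists r'. auto.
Qed.

Lemma star_ept H v eps u w t : lf_graph H -> H u w -> 0 < t < 1 -> 0 < eps ->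
  star H v eps (inl (ept u w t)) <-> (v = u /\ 1 - eps < t) \/ (v = w /\ t < eps).
Proof.
  intros OK Huw Ht He. assert (Hn := edge_neq _ _ _ OK Huw). split.
  - intros [E|[x [s [A [B [C E]]]]]]; injection E as E.
    + symmetry in E; apply vtx_ept in E; [contradiction|auto|lra].
    + apply ept_inj in E; auto; [|eapply edge_neq; eauto].
      destruct E as [[-> [-> ->]]|[-> [-> ->]]]; [left|right]; split; auto; lra.
  - intros [[-> A]|[-> A]]; right.
    + exists w, t. repeat split; auto; lra.
    + exists u, (1 - t). repeat split; try lra. apply OK; auto. rewrite ept_swap; auto.
Qed.

Lemma star_vtx H v eps w : lf_graph H -> star H v eps (inl (vtx w)) <-> v = w.
Proof.
  intros OK. split; [|intros ->; left; auto].
  intros [E|[x [s [A [B [C E]]]]]]; injection E as E.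
  - apply vtx_inj in E; auto.
  - apply vtx_ept in E; [contradiction|eapply edge_neq; eauto|lra].
Qed.

Definition separated H (p q : pt V) : Prop := exists N1 N2,
  basic_nbhd H p N1 /\ basic_nbhd H q N2 /\ forall x, N1 x -> N2 x -> False.

Lemma separated_sym H p q : separated H p q -> separated H q p.
Proof. intros [N1 [N2 [A [B C]]]]. exists N2, N1. repeat split; eauto. Qed.

Lemma bn_star H v eps : 0 < eps <= 1 -> basic_nbhd H (inl (vtx v)) (star H v eps).
Proof. intros. left. exists v, eps; auto. Qed.

Lemma sep_vtx_vtx H v w : lf_graph H -> v <> w -> separated H (inl (vtx v)) (inl (vtx w)).
Proof.
  intros OK Hn. exists (star H v (1/2)), (star H w (1/2)).
  split; [apply bn_star; lra|]. split; [apply bn_star; lra|].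
  intros x [->|[u [t [A [B [C ->]]]]]] D.
  - apply star_vtx in D; auto.
  - apply star_ept in D; auto; [|lra]. destruct D as [[D E]|[D E]]; [auto|lra].
Qed.

Lemma sep_vtx_ept H v u w t : lf_graph H -> H u w -> 0 < t < 1 ->
  separated H (inl (vtx v)) (inl (ept u w t)).
Proof.
  intros OK Huw Ht. assert (Hn := edge_neq _ _ _ OK Huw).
  set (e := Rmin (t/2) ((1-t)/2)).
  assert (He : 0 < e <= t/2 /\ e <= (1-t)/2).
  { unfold e, Rmin; destruct (Rle_dec (t/2) ((1-t)/2)); lra. }
  exists (star H v e), (seg u w (t/2) ((1+t)/2)).
  split; [apply bn_star; lra|]. split; [apply bn_seg; auto; lra|].
  intros x A [s [B ->]]. apply star_ept in A; auto; try lra.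
Qed.

Lemma sep_ept_ept H u w t u' w' t' : lf_graph H -> H u w -> 0 < t < 1 -> H u' w' -> 0 < t' < 1 ->
  ept u w t <> ept u' w' t' -> separated H (inl (ept u w t)) (inl (ept u' w' t')).
Proof.
  intros OK Huw Ht Huw' Ht' Hd. assert (Hn := edge_neq _ _ _ OK Huw).
  assert (Hn' := edge_neq _ _ _ OK Huw').
  assert (Same : forall s, 0 < s < 1 -> ept u w t <> ept u w s ->
     separated H (inl (ept u w t)) (inl (ept u w s))).
  { intros s Hs Hd'. assert (t <> s) by congruence.
    destruct (Rlt_dec t s).
    - exists (seg u w (t/2) ((t+s)/2)), (seg u w ((t+s)/2) ((1+s)/2)).
      split; [apply bn_seg; auto; lra|]. split; [apply bn_seg; auto; lra|].
      intros x [a [A ->]] [b [B E]]. injection E as E.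
      assert (C := f_equal (fun f => f u) E). cbv beta in C. rewrite !ept_l in C. lra.
    - exists (seg u w ((t+s)/2) ((1+t)/2)), (seg u w (s/2) ((t+s)/2)).
      split; [apply bn_seg; auto; lra|]. split; [apply bn_seg; auto; lra|].
      intros x [a [A ->]] [b [B E]]. injection E as E.
      assert (C := f_equal (fun f => f u) E). cbv beta in C. rewrite !ept_l in C. lra. }
  destruct (classic (u = u' /\ w = w')) as [[<- <-]|H1]; [auto|].
  destruct (classic (u = w' /\ w = u')) as [[<- <-]|H2].
  { rewrite (ept_swap w u t') in *; auto. apply Same; auto; lra. }
  exists (seg u w (t/2) ((1+t)/2)), (seg u' w' (t'/2) ((1+t')/2)).
  split; [apply bn_seg; auto; lra|]. split; [apply bn_seg; auto; lra|].
  intros x [a [A ->]] [b [B E]]. injection E as E. apply ept_inj in E; auto; try lra.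
  tauto.
Qed.

(** Local finiteness enters here: once [v] and all its neighbours are deleted, no edge at [v] has an
    endpoint in the remaining component. *)
Lemma sep_vtx_end H v r : lf_graph H -> is_ray H r ->
  separated H (inl (vtx v)) (inr (endof H r)).
Proof.
  intros OK Hr. destruct (lf_fin _ OK v) as [l Hl].
  exists (star H v 1), (end_nbhd H (v :: l) (endof H r)).
  split; [apply bn_star; lra|]. split; [apply bn_end; eauto|].
  intros x [->|[u [t [A [B [C ->]]]]]] D.
  - apply end_nbhd_vtx in D; auto. apply comp_avoid in D. apply D; left; auto.
  - apply end_nbhd_ept in D; auto.
    destruct D as [[D|D] _]; apply comp_avoid in D; apply D; [left|right]; auto.
Qed.

Lemma sep_ept_end H u w t r : lf_graph H -> is_ray H r -> H u w -> 0 < t < 1 ->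
  separated H (inl (ept u w t)) (inr (endof H r)).
Proof.
  intros OK Hr Huw Ht.
  exists (seg u w (t/2) ((1+t)/2)), (end_nbhd H (u :: w :: nil) (endof H r)).
  split; [apply bn_seg; auto; lra|]. split; [apply bn_end; eauto|].
  intros x [s [A ->]] D. apply end_nbhd_ept in D; auto; [|lra].
  destruct D as [[D|D] _]; apply comp_avoid in D; apply D; [left|right; left]; auto.
Qed.

Lemma end_nbhd_disjoint H S r r' : lf_graph H -> is_ray H r -> is_ray H r' ->
  (forall x, rcomp H S r x -> rcomp H S r' x -> False) ->
  forall p, end_nbhd H S (endof H r) p -> end_nbhd H S (endof H r') p -> False.
Proof.
  intros OK Hr Hr' Hd p. assert (Hs := lf_sym _ OK). rewrite (end_nbhdE H S r); auto.
  intros [[x [A ->]]|[[u [v [t [A [B [C [D ->]]]]]]]|[q [A [B ->]]]]] E.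
  - apply end_nbhd_vtx in E; eauto.
  - apply end_nbhd_ept in E; auto. destruct E as [_ [[E|E] _]]; [eauto|].
    apply (comp_avoid _ _ _ _ C); auto.
  - apply end_nbhd_end in E; auto.
    destruct (ev_in_ex _ _ (ev_in_and _ _ _ B E)) as [i [? ?]]; eauto.
Qed.

Lemma not_equiv_sep H r r' : lf_graph H -> is_ray H r -> is_ray H r' -> ~ ray_equiv H r r' ->
  exists S, forall x, rcomp H S r x -> rcomp H S r' x -> False.
Proof.
  intros OK Hr Hr' Hn. assert (Hs := lf_sym _ OK). rewrite ray_equivE in Hn; auto.
  apply not_all_ex_not in Hn. destruct Hn as [S HS]. exists S. intros x A B; eauto.
Qed.

Lemma sep_end_end H r r' : lf_graph H -> is_ray H r -> is_ray H r' ->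
  endof H r <> endof H r' -> separated H (inr (endof H r)) (inr (endof H r')).
Proof.
  intros OK Hr Hr' Hn. assert (Hs := lf_sym _ OK). rewrite endof_eq in Hn; auto.
  destruct (not_equiv_sep H r r' OK Hr Hr' Hn) as [S HS].
  exists (end_nbhd H S (endof H r)), (end_nbhd H S (endof H r')).
  split; [apply bn_end; eauto|]. split; [apply bn_end; eauto|].
  apply end_nbhd_disjoint; auto.
Qed.

Lemma hausdorff H p q : lf_graph H -> in_cplx H p -> in_cplx H q -> p <> q -> separated H p q.
Proof.
  intros OK Hp Hq Hn.
  destruct (cplx_cases H p Hp) as [[v ->]|[[u [w [t [A [B ->]]]]]|[r [A ->]]]];
  destruct (cplx_cases H q Hq) as [[v' ->]|[[u' [w' [t' [A' [B' ->]]]]]|[r' [A' ->]]]].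
  - apply sep_vtx_vtx; auto; congruence.
  - apply sep_vtx_ept; auto.
  - apply sep_vtx_end; auto.
  - apply separated_sym, sep_vtx_ept; auto.
  - apply sep_ept_ept; auto; congruence.
  - apply sep_ept_end; auto.
  - apply separated_sym, sep_vtx_end; auto.
  - apply separated_sym, sep_ept_end; auto.
  - apply sep_end_end; auto; congruence.
Qed.

End Topology.

(** * Loops *)

(** A Hamiltonian curve cut open at the vertex [v0]. Continuity is stated for basic neighbourhoods,
    and uniqueness on the half-open interval because 0 and 1 are one point of the circle. *)
Record loop {V : Type} (H : V -> V -> Prop) (f : R -> pt V) (v0 : V) : Prop := {
  lp_0 : f 0 = inl (vtx v0);
  lp_1 : f 1 = inl (vtx v0);
  lp_in : forall x, 0 <= x <= 1 -> in_cplx H (f x);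
  lp_cont : forall x N, 0 <= x <= 1 -> basic_nbhd H (f x) N ->
    exists d, 0 < d /\ forall y, 0 <= y <= 1 -> x - d < y < x + d -> N (f y);
  lp_ex : forall v, exists x, 0 <= x < 1 /\ f x = inl (vtx v);
  lp_uniq : forall v x y, 0 <= x < 1 -> 0 <= y < 1 ->
    f x = inl (vtx v) -> f y = inl (vtx v) -> x = y }.

Definition simple {V : Type} (f : R -> pt V) : Prop :=
  forall x y, 0 <= x < 1 -> 0 <= y < 1 -> f x = f y -> x = y.

Section Loops.
Context {V : Type}.
Implicit Types (H : V -> V -> Prop) (f : R -> pt V).

Lemma loop_rev H f v0 : loop H f v0 -> loop H (fun x => f (1 - x)) v0.
Proof.
  intros L. split.
  - replace (1 - 0) with 1 by ring. apply L.
  - replace (1 - 1) with 0 by ring. apply L.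
  - intros x Hx. apply L; lra.
  - intros x N Hx HN. destruct (lp_cont _ _ _ L (1 - x) N) as [d [Hd A]]; auto; [lra|].
    exists d. split; auto. intros y Hy Hxy. apply A; lra.
  - intros v. destruct (lp_ex _ _ _ L v) as [x [Hx A]].
    destruct (Req_dec x 0) as [->|Hn].
    + exists 0. split; [lra|]. replace (1 - 0) with 1 by ring.
      rewrite (lp_1 _ _ _ L), <- (lp_0 _ _ _ L). auto.
    + exists (1 - x). split; [lra|]. replace (1 - (1 - x)) with x by ring. auto.
  - assert (Key : forall v x, 0 < x < 1 -> f (1 - 0) = inl (vtx v) -> f (1 - x) = inl (vtx v) -> False).
    { intros v x Hx A B. replace (1 - 0) with 1 in A by ring.
      rewrite (lp_1 _ _ _ L), <- (lp_0 _ _ _ L) in A.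
      assert (0 = 1 - x); [|lra]. apply (lp_uniq _ _ _ L v); auto; lra. }
    intros v x y Hx Hy A B.
    destruct (Req_dec x 0) as [->|Hx0]; destruct (Req_dec y 0) as [->|Hy0]; auto.
    + exfalso; apply (Key v y); auto; lra.
    + exfalso; apply (Key v x); auto; lra.
    + assert (1 - x = 1 - y); [|lra]. apply (lp_uniq _ _ _ L v); auto; lra.
Qed.

Lemma simple_rev H f v0 : loop H f v0 -> simple f -> simple (fun x => f (1 - x)).
Proof.
  intros L Hi. 
  assert (Key : forall x, 0 < x < 1 -> f (1 - 0) = f (1 - x) -> False).
  { intros x Hx A. replace (1 - 0) with 1 in A by ring.
    rewrite (lp_1 _ _ _ L), <- (lp_0 _ _ _ L) in A.
    assert (0 = 1 - x); [|lra]. apply Hi; auto; lra. }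
  intros x y Hx Hy A.
  destruct (Req_dec x 0) as [->|Hx0]; destruct (Req_dec y 0) as [->|Hy0]; auto.
  - exfalso; apply (Key y); auto; lra.
  - exfalso; apply (Key x); auto; lra.
  - assert (1 - x = 1 - y); [|lra]. apply Hi; auto; lra.
Qed.

Definition place f (v : V) : R :=
  epsilon (inhabits 0) (fun x => 0 <= x < 1 /\ f x = inl (vtx v)).

Lemma pos_spec H f v0 v : loop H f v0 -> 0 <= place f v < 1 /\ f (place f v) = inl (vtx v).
Proof. intros L. unfold place. apply epsilon_spec. apply (lp_ex _ _ _ L). Qed.

Lemma pos_eq H f v0 v x : loop H f v0 -> 0 <= x < 1 -> f x = inl (vtx v) -> x = place f v.
Proof. intros L Hx A. destruct (pos_spec _ _ _ v L). eapply (lp_uniq _ _ _ L); eauto. Qed.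

Lemma pos_v0 H f v0 : loop H f v0 -> place f v0 = 0.
Proof. intros L. symmetry. eapply pos_eq; eauto; [lra|apply L]. Qed.

Lemma pos_inj H f v0 v w : loop H f v0 -> place f v = place f w -> v = w.
Proof.
  intros L E. destruct (pos_spec _ _ _ v L) as [_ A]. destruct (pos_spec _ _ _ w L) as [_ B].
  rewrite E, B in A. injection A as A. apply vtx_inj in A. auto.
Qed.

Lemma pos_pos H f v0 v : loop H f v0 -> v <> v0 -> 0 < place f v < 1.
Proof.
  intros L Hn. destruct (pos_spec _ _ _ v L) as [A B].
  destruct (Req_dec (place f v) 0) as [E|E]; [|lra]. exfalso; apply Hn.
  eapply pos_inj; eauto. rewrite (pos_v0 _ _ _ L); auto.
Qed.

Lemma pos_close H f v0 v x : loop H f v0 -> 0 <= x <= 1 -> f x = inl (vtx v) ->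
  x = place f v \/ (x = 1 /\ v = v0).
Proof.
  intros L Hx A. destruct (Req_dec x 1) as [->|Hn].
  - right. split; auto. rewrite (lp_1 _ _ _ L) in A. injection A as A. apply vtx_inj in A; auto.
  - left. eapply pos_eq; eauto. lra.
Qed.

Lemma pos_rev H f v0 v : loop H f v0 -> v <> v0 -> place (fun x => f (1 - x)) v = 1 - place f v.
Proof.
  intros L Hn. symmetry. destruct (pos_pos _ _ _ v L Hn). destruct (pos_spec _ _ _ v L).
  apply (pos_eq H _ v0); [apply loop_rev; auto|lra|].
  replace (1 - (1 - place f v)) with (place f v) by ring. auto.
Qed.

(** A continuous map from a compact space to a Hausdorff space is closed. Each parameter not mapped
    to [p] has an interval whose image misses some neighbourhood of [p], and [cousin] intersects
    finitely many of these neighbourhoods. *)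
Lemma loop_proper H f v0 p (W : R -> Prop) : lf_graph H -> loop H f v0 -> in_cplx H p ->
  (forall x, 0 <= x <= 1 -> f x = p -> exists d, 0 < d /\
     forall y, 0 <= y <= 1 -> x - d < y < x + d -> W y) ->
  exists N, basic_nbhd H p N /\ forall x, 0 <= x <= 1 -> N (f x) -> W x.
Proof.
  intros OK L Hp HW.
  apply (cousin 0 1 (fun a b => exists N, basic_nbhd H p N /\
      forall x, a <= x <= b -> N (f x) -> W x)); [lra| |].
    - intros x y z Hxy Hyz [N1 [A1 B1]] [N2 [A2 B2]].
      destruct (bn_inter H p N1 N2 OK A1 A2) as [N [A B]]. exists N. split; auto.
      intros t Ht HN. destruct (B _ HN). destruct (Rle_dec t y); [apply B1|apply B2]; auto; lra.
    - intros x Hx. destruct (classic (f x = p)) as [E|E].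
      + destruct (HW x Hx E) as [d [Hd HW']]. destruct (bn_ex H p Hp) as [N HN].
        exists d. split; auto. intros y z Hy Hz Hy' Hz'. exists N. split; auto.
        intros t Ht _. apply HW'; lra.
      + destruct (hausdorff H (f x) p OK) as [N1 [N2 [A1 [A2 Hd]]]]; auto.
        { apply L; auto. }
        destruct (lp_cont _ _ _ L x N1 Hx A1) as [d [Hd0 B]].
        exists d. split; auto. intros y z Hy Hz Hy' Hz'. exists N2. split; auto.
        intros t Ht HN. exfalso. apply (Hd (f t)); auto. apply B; lra.
Qed.

(** Rotating the circle by the angle of [v0] brings this vertex to the seam. *)
Lemma curve_loop H : lf_graph H -> forall v0 sigma, cont_S1 H sigma ->
  (forall v, exists! z, S1 z /\ sigma z = inl (vtx v)) ->
  exists th, 0 <= th < 1 /\ loop H (fun x => sigma (circ (th + x))) v0.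
Proof.
  intros OK v0 sigma [Hin Hc] Hv. destruct (Hv v0) as [z0 [[Hz0 Hs0] Hu0]].
  destruct (circ_surj z0 Hz0) as [th [Hth Ez]].
  exists th. split; auto. split.
  - rewrite Rplus_0_r, Ez; auto.
  - rewrite circ_period, Ez; auto.
  - intros x Hx. apply Hin, circ_S1.
  - intros x N Hx HN. destruct (Hc N (bn_open _ _ _ OK HN)) as [_ HU].
    destruct (HU (circ (th + x))) as [eps [He HU']].
    { split; [apply circ_S1|]. eapply bn_self; eauto. }
    destruct (circ_continuous (th + x) eps He) as [d [Hd Hd']].
    exists d. split; auto. intros y Hy Hxy. apply HU'; [apply circ_S1|]. apply Hd'; lra.
  - intros v. destruct (Hv v) as [z [[Hz Hs] Hu]]. destruct (circ_surj z Hz) as [y [Hy Ey]].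
    destruct (Rle_dec th y).
    + exists (y - th). split; [lra|]. replace (th + (y - th)) with y by ring. rewrite Ey; auto.
    + exists (y - th + 1). split; [lra|]. replace (th + (y - th + 1)) with (y + 1) by ring.
      rewrite circ_period, Ey; auto.
  - intros v x y Hx Hy A B. destruct (Hv v) as [z [_ Hu]].
    assert (E : circ (th + x) = circ (th + y)).
    { rewrite <- (Hu (circ (th + x))), <- (Hu (circ (th + y))); auto using circ_S1. }
    apply circ_inj in E.
    + destruct E as [E|E]; [lra|]. unfold Rabs in E; destruct (Rcase_abs (th + x - (th + y))); lra.
    + apply Rabs_le; lra.
Qed.

Definition angle (z : R * R) : R := epsilon (inhabits 0) (fun x => 0 <= x < 1 /\ circ x = z).

Lemma angle_spec z : S1 z -> 0 <= angle z < 1 /\ circ (angle z) = z.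
Proof. intros Hz. unfold angle. apply epsilon_spec. apply circ_surj; auto. Qed.

Lemma angle_circ x : 0 <= x < 1 -> angle (circ x) = x.
Proof.
  intros Hx. destruct (angle_spec (circ x) (circ_S1 x)) as [A B].
  apply circ_inj in B.
  - destruct B as [B|B]; auto. unfold Rabs in B; destruct (Rcase_abs (angle (circ x) - x)); lra.
  - apply Rabs_le; lra.
Qed.

Lemma loop_cont_S1 H f v0 : loop H f v0 -> cont_S1 H (fun z => f (angle z)).
Proof.
  intros L. split.
  - intros z Hz. destruct (angle_spec z Hz). apply L; lra.
  - intros O [HO1 HO2]. split; [tauto|]. intros z [Hz HO]. destruct (angle_spec z Hz) as [A B].
    destruct (HO2 _ HO) as [N [HN HNO]].
    assert (Hd : exists d, 0 < d /\ forall s, 0 <= s < 1 ->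
       Rabs (s - angle z) < d \/ 1 - d < Rabs (s - angle z) -> N (f s)).
    (* At the seam, continuity at 0 and at 1 have to be combined; elsewhere [d] is made so small
       that the wrap-around alternative cannot occur. *)
    { destruct (Req_dec (angle z) 0) as [E|E].
      - rewrite E in *. assert (HN1 := HN). rewrite (lp_0 _ _ _ L), <- (lp_1 _ _ _ L) in HN1.
        destruct (lp_cont _ _ _ L 0 N) as [d0 [Hd0 C0]]; auto; [lra|].
        destruct (lp_cont _ _ _ L 1 N) as [d1 [Hd1 C1]]; auto; [lra|].
        exists (Rmin d0 d1). assert (M := Rmin_l d0 d1). assert (M' := Rmin_r d0 d1).
        split; [apply Rmin_glb_lt; auto|]. intros s Hs. rewrite Rminus_0_r, Rabs_right by lra.
        intros [D|D]; [apply C0|apply C1]; lra.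
      - destruct (lp_cont _ _ _ L (angle z) N) as [d0 [Hd0 C0]]; auto; [lra|].
        set (d := Rmin d0 (Rmin (angle z) (1 - angle z))).
        assert (Hd : 0 < d /\ d <= d0 /\ d <= angle z /\ d <= 1 - angle z).
        { unfold d, Rmin. destruct (Rle_dec (angle z) (1 - angle z)).
          - destruct (Rle_dec d0 (angle z)); lra.
          - destruct (Rle_dec d0 (1 - angle z)); lra. }
        exists d. split; [tauto|]. intros s Hs [D|D].
        + apply Rabs_def2 in D. apply C0; lra.
        + exfalso. unfold Rabs in D; destruct (Rcase_abs (s - angle z)); lra. }
    destruct Hd as [d [Hd0 Hd]].
    destruct (circ_inverse (angle z) d) as [eps [He Hi]]; auto; [lra|].
    exists eps. split; auto. intros w Hw Hdist. split; auto.
    destruct (angle_spec w Hw) as [Aw Bw]. apply HNO, Hd; auto.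
    apply Hi; [lra|]. rewrite B, Bw. auto.
Qed.

Lemma loop_curve H f v0 : loop H f v0 -> ham_curve V H.
Proof.
  intros L. exists (fun z => f (angle z)). split; [eapply loop_cont_S1; eauto|].
  intros v. destruct (lp_ex _ _ _ L v) as [x [Hx A]]. exists (circ x). split.
  - split; [apply circ_S1|]. rewrite angle_circ; auto.
  - intros z [Hz B]. destruct (angle_spec z Hz) as [C D]. rewrite <- D. f_equal.
    eapply (lp_uniq _ _ _ L); eauto.
Qed.

Lemma ham_curve_loop H v0 : lf_graph H -> ham_curve V H -> exists f, loop H f v0.
Proof.
  intros OK [sigma [A B]]. destruct (curve_loop H OK v0 sigma A B) as [th [_ L]]. eauto.
Qed.

Lemma ham_circle_loop H v0 : lf_graph H -> ham_circle V H ->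
  exists f, loop H f v0 /\ simple f.
Proof.
  intros OK [sigma [[A [B C]] D]].
  assert (D' : forall v, exists! z, S1 z /\ sigma z = inl (vtx v)).
  { intros v. destruct (D v) as [z [Hz Hs]]. exists z. split; auto.
    intros w [Hw Hsw]. apply B; auto. congruence. }
  destruct (curve_loop H OK v0 sigma A D') as [th [Hth L]].
  eexists; split; eauto. intros x y Hx Hy E. apply B in E; auto using circ_S1.
  apply circ_inj in E.
  + destruct E as [E|E]; [lra|]. unfold Rabs in E; destruct (Rcase_abs (th + x - (th + y))); lra.
  + apply Rabs_le; lra.
Qed.

Lemma loop_circle H f v0 : lf_graph H -> loop H f v0 -> simple f -> ham_circle V H.
Proof.
  intros OK L Hi. exists (fun z => f (angle z)). split.
  2:{ intros v. destruct (lp_ex _ _ _ L v) as [x [Hx A]]. exists (circ x).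
      split; [apply circ_S1|]. rewrite angle_circ; auto. }
  split; [eapply loop_cont_S1; eauto|]. split.
  - intros z w Hz Hw E. destruct (angle_spec z Hz) as [A B]. destruct (angle_spec w Hw) as [C D].
    rewrite <- B, <- D. f_equal. apply Hi; auto.
  - intros U [HU1 HU2].
    (* The complement of the image of the closed set outside [U]; it is open by [loop_proper]. *)
    exists (fun p => in_cplx H p /\ forall x, 0 <= x <= 1 -> f x = p -> U (circ x)). split.
    + split; [tauto|]. intros p [Hp HpU].
      destruct (loop_proper H f v0 p (fun x => U (circ x)) OK L Hp) as [N [HN HNU]].
      { intros x Hx E. destruct (HU2 (circ x)) as [eps [He HU3]]; [apply HpU; auto|].
        destruct (circ_continuous x eps He) as [d [Hd Hd']]. exists d. split; auto.
        intros y Hy Hxy. apply HU3; [apply circ_S1|]. apply Hd'; lra. }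
      exists N. split; auto. intros q Hq. destruct (bn_open _ _ _ OK HN) as [HN1 _].
      split; auto. intros x Hx <-. auto.
    + intros z Hz. destruct (angle_spec z Hz) as [A B]. split.
      * intros HU. split; [apply L; lra|]. intros x Hx E.
        assert (circ x = z); [|congruence].
        destruct (Req_dec x 1) as [->|Hn].
        -- assert (angle z = 0). { apply Hi; try lra. rewrite (lp_0 _ _ _ L), <- (lp_1 _ _ _ L); auto. }
           replace 1 with (0 + 1) by ring. rewrite circ_period. congruence.
        -- rewrite <- B. f_equal. apply Hi; auto; lra.
      * intros [_ HU]. rewrite <- B. apply HU; auto; lra.
Qed.

End Loops.

(** * Arcs of a loop *)

Lemma loc_const {T : Type} (a b : R) (P : R -> T -> Prop) : a <= b ->
  (forall x, a <= x <= b -> exists d, 0 < d /\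
     forall y, a <= y <= b -> x - d < y < x + d -> forall v, P y v <-> P x v) ->
  forall v, P a v <-> P b v.
Proof.
  intros Hab Hloc.
  apply (cousin a b (fun x y => forall v, P x v <-> P y v)); auto.
  - intros x y z _ _ A B v. rewrite A; auto.
  - intros x Hx. destruct (Hloc x Hx) as [d [Hd A]]. exists d. split; auto.
    intros y z Hy Hz Hy' Hz' v. rewrite (A y), (A z); [reflexivity|lra..].
Qed.

Lemma accumulation (p : nat -> R) : (forall i, 0 <= p i <= 1) ->
  exists x, 0 <= x <= 1 /\ forall d n, 0 < d -> exists i, (n <= i)%nat /\ x - d < p i < x + d.
Proof.
  intros Hp. apply NNPP; intros Hn.
  assert (C : exists n, forall i, (n <= i)%nat -> ~ 0 <= p i <= 1).
  { apply (cousin 0 1 (fun a b => exists n, forall i, (n <= i)%nat -> ~ a <= p i <= b)); [lra| |].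
    - intros x y z _ _ [n A] [m B]. exists (max n m). intros i Hi Hi'.
      destruct (Rle_dec (p i) y); [apply (A i)|apply (B i)]; try lia; lra.
    - intros x Hx. apply NNPP; intros Hn2. apply Hn. exists x. split; auto.
      intros d n Hd. apply NNPP; intros Hn3. apply Hn2. exists d. split; auto.
      intros y z Hy Hz Hy' Hz'. exists n. intros i Hi Hi'. apply Hn3. exists i. split; auto; lra. }
  destruct C as [n A]. apply (A n); auto.
Qed.

Lemma nat_least (P : nat -> Prop) : (exists n, P n) -> exists n, P n /\ forall m, P m -> (n <= m)%nat.
Proof.
  intros [n Hn]. revert n Hn. induction n as [n IH] using (well_founded_induction lt_wf). intros Hn.
  destruct (classic (exists m, (m < n)%nat /\ P m)) as [[m [A B]]|C]; [eauto|].
  exists n. split; auto. intros m Hm. destruct (Nat.le_gt_cases n m); auto. exfalso; eauto.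
Qed.

Section Arcs.
Context {V : Type}.
Implicit Types (H : V -> V -> Prop) (f : R -> pt V).

Lemma inf_fresh : infinite_vertices V -> forall l : list V, exists v, ~ In v l.
Proof. intros Hi l. apply not_all_ex_not. intros A. apply Hi. exists l; auto. Qed.

Lemma neighbours H : locally_finite V H -> exists nb : V -> list V, forall v w, H v w -> In w (nb v).
Proof.
  intros Hl. exists (fun v => proj1_sig (constructive_indefinite_description _ (Hl v))).
  intros v w. destruct (constructive_indefinite_description _ (Hl v)); simpl; auto.
Qed.

Lemma exhaustion H v0 : locally_finite V H -> (forall v, conn H (fun _ => True) v0 v) ->
  exists B : nat -> list V, (forall n, incl (B n) (B (n + 1)%nat)) /\
    (forall v, exists n, In v (B n)).
Proof.
  intros Hl Hc. destruct (neighbours H Hl) as [nb Hnb].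
  set (B := fix B n := match n with O => v0 :: nil | S n => B n ++ flat_map nb (B n) end).
  assert (HB : forall n, incl (B n) (B (n + 1)%nat)).
  { intros n. replace (n + 1)%nat with (S n) by lia. simpl. apply incl_appl, incl_refl. }
  exists B. split; auto.
  assert (K : forall u v, conn H (fun _ => True) u v -> (exists n, In u (B n)) -> exists n, In v (B n)).
  { induction 1 as [|x y z _ Hxy _ IH]; auto. intros [n Hn]. apply IH. exists (S n). simpl.
    apply in_or_app. right. apply in_flat_map. eauto. }
  intros v. apply (K v0 v); auto. exists O; simpl; auto.
Qed.

(** Nothing is demanded of the motion inside the edge: the curve may still go back and forth between
    the two ends of the arc. *)
Definition edge_arc H f (a b : R) (u w : V) : Prop :=
  (0 <= a /\ a < b /\ b <= 1) /\ H u w /\ f a = inl (vtx u) /\ f b = inl (vtx w) /\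
  forall s, a < s < b -> exists t, 0 < t < 1 /\ f s = inl (ept u w t).

Lemma edge_arc_rev H f a b u w : lf_graph H -> edge_arc H f a b u w ->
  edge_arc H (fun x => f (1 - x)) (1 - b) (1 - a) w u.
Proof.
  intros OK [A [B [C [D E]]]]. split; [lra|]. split; [apply OK; auto|].
  replace (1 - (1 - b)) with b by ring. replace (1 - (1 - a)) with a by ring.
  repeat split; auto. intros s Hs. destruct (E (1 - s)) as [t [Ht Et]]; [lra|].
  exists (1 - t). split; [lra|]. rewrite Et, ept_swap; auto. eapply edge_neq; eauto.
Qed.

(** The exit point is a limit of inner points of the edge. Ends, other vertices and other edges have
    neighbourhoods missing the interior of this edge, so the exit point is one of its endpoints. *)
Lemma inner_right H f v0 t u w : lf_graph H -> loop H f v0 -> 0 <= t <= 1 -> H u w ->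
  (exists s, 0 < s < 1 /\ f t = inl (ept u w s)) ->
  exists b, t < b <= 1 /\ (f b = inl (vtx u) \/ f b = inl (vtx w)) /\
    forall x, t <= x < b -> exists s, 0 < s < 1 /\ f x = inl (ept u w s).
Proof.
  intros OK L Ht Huw Hin. assert (Hn := edge_neq _ _ _ OK Huw).
  destruct (first_exit t 1 (fun x => exists s, 0 < s < 1 /\ f x = inl (ept u w s))) as [b [Hb [Hb1 Hb2]]];
    [lra|auto| | |].
  - intros [s [Hs E]]. rewrite (lp_1 _ _ _ L) in E. injection E as E. apply vtx_ept in E; auto.
  - intros x Hx [s [Hs E]].
    destruct (lp_cont _ _ _ L x (seg u w (s/2) ((1+s)/2))) as [d [Hd C]]; [lra|rewrite E; apply bn_seg; auto; lra|].
    exists d. split; auto. intros y Hy Hxy. destruct (C y) as [s' [Hs' E']]; try lra. exists s'.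
    split; auto; lra.
  - exists b. split; auto. split; auto.
    assert (Near : forall N, basic_nbhd H (f b) N -> exists s, 0 < s < 1 /\ N (inl (ept u w s))).
    { intros N HN. destruct (lp_cont _ _ _ L b N) as [d [Hd C]]; auto; [lra|].
      set (x := Rmax t (b - d/2)).
      assert (Hx : t <= x < b /\ b - d < x).
      { unfold x, Rmax; destruct (Rle_dec t (b - d/2)); lra. }
      destruct (Hb2 x) as [s [Hs E]]; [tauto|]. exists s. split; auto. rewrite <- E. apply C; lra. }
    destruct (cplx_cases H (f b)) as [[v E]|[[u' [w' [s' [A [B E]]]]]|[r [Hr E]]]].
    + apply L; lra.
    + destruct (Near (star H v 1)) as [s [Hs C]]; [rewrite E; apply bn_star; lra|].
      apply star_ept in C; auto; [|lra]. rewrite E. destruct C as [[-> _]|[-> _]]; auto.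
    + exfalso. destruct (Near (seg u' w' (s'/2) ((1+s')/2))) as [s [Hs [t' [Ht' C]]]].
      { rewrite E; apply bn_seg; auto; lra. }
      assert (Hn' := edge_neq _ _ _ OK A). injection C as C.
      apply ept_inj in C; auto; [|lra]. apply Hb1.
      destruct C as [[-> [-> _]]|[-> [-> _]]]; [eauto|]. exists (1 - s'). split; [lra|].
      rewrite <- ept_swap; auto.
    + exfalso. destruct (Near (end_nbhd H (u :: w :: nil) (endof H r))) as [s [Hs C]].
      { rewrite E. apply bn_end; eauto. }
      apply end_nbhd_ept in C; auto.
      destruct C as [[C|C] _]; apply comp_avoid in C; apply C; [left|right; left]; auto.
Qed.

(** An excursion into an edge that returned to its starting vertex would occupy the whole parameter
    interval, since a vertex is visited once; a vertex other than the endpoints of the edge and [v0]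
    would then have no place. *)
Lemma inner_arc H f v0 t u w : infinite_vertices V -> lf_graph H -> loop H f v0 -> 0 <= t <= 1 -> H u w ->
  (exists s, 0 < s < 1 /\ f t = inl (ept u w s)) ->
  exists a b, a < t < b /\ (edge_arc H f a b u w \/ edge_arc H f a b w u).
Proof.
  intros HV OK L Ht Huw Hin. assert (Hn := edge_neq _ _ _ OK Huw).
  destruct (inner_right H f v0 t u w OK L Ht Huw Hin) as [b [Hb [Eb Ib]]].
  destruct (inner_right H _ v0 (1 - t) u w OK (loop_rev _ _ _ L)) as [a' [Ha [Ea Ia]]]; auto; [lra| |].
  { replace (1 - (1 - t)) with t by ring; auto. }
  set (a := 1 - a'). assert (Hat : 0 <= a < t) by (unfold a; lra).
  fold a in Ea.
  assert (I : forall s, a < s < b -> exists t0, 0 < t0 < 1 /\ f s = inl (ept u w t0)).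
  { intros s Hs. destruct (Rle_dec t s); [apply Ib; lra|].
    destruct (Ia (1 - s)) as [q Hq]; [unfold a in *; lra|]. exists q.
    replace (1 - (1 - s)) with s in Hq by ring. auto. }
  assert (Hne : f a <> f b).
  { intros E. assert (Hv : exists v, f a = inl (vtx v)) by (destruct Ea; eauto).
    destruct Hv as [v Hv]. assert (Hv2 : f b = inl (vtx v)) by congruence.
    apply (pos_close _ _ _ _ _ L) in Hv; [|lra]. apply (pos_close _ _ _ _ _ L) in Hv2; [|lra].
    destruct Hv as [Hv|Hv]; [|lra]. destruct Hv2 as [Hv2|[Hv2 ->]]; [lra|].
    rewrite (pos_v0 _ _ _ L) in Hv.
    destruct (inf_fresh HV (u :: w :: nil)) as [z Hz].
    destruct (classic (z = v0)) as [->|Hzn].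
    - rewrite Hv, (lp_0 _ _ _ L) in Ea. apply Hz. destruct Ea as [Ea|Ea]; injection Ea as Ea;
      apply vtx_inj in Ea; rewrite Ea; [left|right; left]; auto.
    - destruct (pos_spec _ _ _ z L) as [_ Ez]. destruct (pos_pos _ _ _ z L Hzn).
      destruct (I (place f z)) as [q [Hq Eq]]; [lra|]. rewrite Ez in Eq. injection Eq as Eq.
      apply vtx_ept in Eq; auto. }
  exists a, b. split; [lra|].
  destruct Ea as [Ea|Ea], Eb as [Eb|Eb]; try congruence.
  - left. repeat split; auto; lra.
  - right. repeat split; auto; try lra. { apply OK; auto. }
    intros s Hs. destruct (I s Hs) as [q [Hq Eq]]. exists (1 - q). split; [lra|].
    rewrite <- ept_swap; auto.
Qed.

(** A star neighbourhood of [v] contains no end and no other vertex, so just after [x] the loop is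
    inside an edge at [v]. The arc traversed there cannot begin before [x], as [x] is a vertex, nor
    after [x], as [v] would be visited twice. *)
Lemma succ_arc H f v0 x v : infinite_vertices V -> lf_graph H -> loop H f v0 -> 0 <= x < 1 ->
  f x = inl (vtx v) -> exists b w, edge_arc H f x b v w.
Proof.
  intros HV OK L Hx Ex.
  destruct (lp_cont _ _ _ L x (star H v 1)) as [d [Hd C]]; [lra|rewrite Ex; apply bn_star; lra|].
  set (t := Rmin (x + d/2) ((x + 1)/2)).
  assert (Ht : x < t < 1 /\ t < x + d).
  { unfold t, Rmin; destruct (Rle_dec (x + d/2) ((x+1)/2)); lra. }
  destruct (C t) as [E|[w [s [A [B [_ E]]]]]]; try lra.
  { exfalso. assert (x = t); [|lra]. apply (lp_uniq _ _ _ L v); auto; lra. }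
  destruct (inner_arc H f v0 t v w HV OK L) as [a [b [Hab Harc]]]; auto; [lra|eauto|].
  assert (Hn := edge_neq _ _ _ OK A).
  assert (Hae : exists u, f a = inl (vtx u)) by (destruct Harc as [Ha|Ha]; destruct Ha as [_ [_ [Ha _]]]; eauto).
  assert (Ha0 : 0 <= a) by (destruct Harc as [Ha|Ha]; destruct Ha as [Ha _]; lra).
  destruct Hae as [u Hu].
  assert (Hxa : a = x).
  { destruct (Rtotal_order a x) as [Hlt|[He|Hgt]]; auto; exfalso.
    - assert (I : exists q, 0 < q < 1 /\ f x = inl (ept v w q) \/ 0 < q < 1 /\ f x = inl (ept w v q)).
      { destruct Harc as [Ha|Ha]; destruct Ha as [_ [_ [_ [_ Ha]]]]; destruct (Ha x) as [q Hq]; try lra; eauto. }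
      destruct I as [q [[Hq I]|[Hq I]]]; rewrite Ex in I; injection I as I; apply vtx_ept in I; auto.
    - assert (St : star H v 1 (f a)) by (apply C; lra). rewrite Hu in St. apply star_vtx in St; auto.
      subst u. assert (x = a); [|lra]. apply (lp_uniq _ _ _ L v); auto; lra. }
  subst a. exists b, w. destruct Harc as [Ha|Ha]; auto. exfalso.
  destruct Ha as [_ [_ [Ha _]]]. rewrite Ex in Ha. injection Ha as Ha. apply vtx_inj in Ha. auto.
Qed.

Lemma arc_no_vtx H f a b u w s v : lf_graph H -> edge_arc H f a b u w -> a < s < b -> f s <> inl (vtx v).
Proof.
  intros OK [_ [Huw [_ [_ A]]]] Hs E. destruct (A s Hs) as [q [Hq Eq]]. rewrite E in Eq.
  injection Eq as Eq. apply vtx_ept in Eq; auto. eapply edge_neq; eauto.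
Qed.

Lemma arc_no_end H f a b u w s A : edge_arc H f a b u w -> a < s < b -> f s <> inr A.
Proof. intros [_ [_ [_ [_ B]]]] Hs E. destruct (B s Hs) as [q [Hq Eq]]. congruence. Qed.

Lemma next_vertex H f v0 x z v A : infinite_vertices V -> lf_graph H -> loop H f v0 ->
  0 <= x -> x < z <= 1 -> f x = inl (vtx v) -> f z = inr A ->
  exists y w, x < y < z /\ edge_arc H f x y v w.
Proof.
  intros HV OK L Hx Hz Ex Ez.
  destruct (succ_arc H f v0 x v HV OK L) as [b [w Harc]]; auto; [lra|].
  exists b, w. split; auto. destruct (Rtotal_order b z) as [Hlt|[He|Hgt]].
  - destruct Harc; lra.
  - exfalso. subst b. destruct Harc as [_ [_ [_ [E _]]]]. congruence.
  - exfalso. apply (arc_no_end _ _ _ _ _ _ z A Harc); auto; lra.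
Qed.

(** The set of vertices reachable in [D] from the current point is locally constant along the arc,
    hence the same at both ends. At an end this holds because some component around it lies in [D]
    and is connected. *)
Lemma arc_conn H f v0 (D : V -> Prop) X Y u w : lf_graph H -> loop H f v0 -> 0 <= X <= Y -> Y <= 1 ->
  (forall t v, X <= t <= Y -> f t = inl (vtx v) -> D v) ->
  (forall t r, X <= t <= Y -> is_ray H r -> f t = inr (endof H r) ->
     exists S, forall x, rcomp H S r x -> D x) ->
  f X = inl (vtx u) -> f Y = inl (vtx w) -> conn H D u w.
Proof.
  intros OK L HX HY HD HE Eu Ew. assert (Hs := lf_sym _ OK).
  (* Reachability from a point of the compactification: from the vertex itself, from an endpoint of
     its edge, or from all vertices of some component around the end. The choice of the component
     does not matter, since any two contain a common tail. *)
  set (att := fun t v => (exists w, f t = inl (vtx w) /\ conn H D w v) \/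
    (exists u w s, H u w /\ 0 < s < 1 /\ f t = inl (ept u w s) /\ conn H D u v) \/
    (exists r S, is_ray H r /\ f t = inr (endof H r) /\ forall x, rcomp H S r x -> conn H D x v)).
  assert (att_vtx : forall t x v, f t = inl (vtx x) -> att t v <-> conn H D x v).
  { intros t x v E. split.
    - intros [[y [A B]]|[[y [z [s [A [B [C _]]]]]]|[r [S [A [B _]]]]]].
      + rewrite E in A. injection A as A. apply vtx_inj in A. subst; auto.
      + rewrite E in C. injection C as C. apply vtx_ept in C; [contradiction|eapply edge_neq; eauto|auto].
      + congruence.
    - left; eauto. }
  assert (att_ept : forall t x y s v, H x y -> 0 < s < 1 -> f t = inl (ept x y s) ->
     att t v <-> conn H D x v \/ conn H D y v).
  { intros t x y s v Hxy Hs0 E. assert (Hn := edge_neq _ _ _ OK Hxy). split.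
    - intros [[z [A B]]|[[z [z' [s' [A [B [C F]]]]]]|[r [S [A [B _]]]]]].
      + rewrite E in A. injection A as A. symmetry in A. apply vtx_ept in A; [contradiction|auto|auto].
      + rewrite E in C. injection C as C. apply ept_inj in C; auto; [|eapply edge_neq; eauto].
        destruct C as [[-> _]|[_ [-> _]]]; auto.
      + congruence.
    - intros [A|A]; right; left.
      + exists x, y, s. auto.
      + exists y, x, (1 - s). repeat split; auto; try lra. rewrite <- ept_swap; auto. }
  assert (att_end : forall t r v, is_ray H r -> f t = inr (endof H r) ->
     att t v <-> exists S, forall x, rcomp H S r x -> conn H D x v).
  { intros t r v Hr E. split.
    - intros [[z [A B]]|[[z [z' [s' [A [B [C F]]]]]]|[r' [S [A [B C]]]]]]; try congruence.
      exists S. intros x Hx. apply C. rewrite E in B. injection B as B.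
      apply endof_eq in B; auto. apply (comp_equiv H S r r'); auto.
    - intros [S HS]. right; right. exists r, S. auto. }
  assert (K : att X w <-> att Y w).
  { apply loc_const; [lra|]. intros x Hx.
    destruct (cplx_cases H (f x)) as [[v E]|[[u' [w' [s' [A [B E]]]]]|[r [Hr E]]]].
    - apply L; lra.
    - destruct (lp_cont _ _ _ L x (star H v 1)) as [d [Hd C]]; [lra|rewrite E; apply bn_star; lra|].
      exists d. split; auto. intros y Hy Hxy z. rewrite (att_vtx x v z E).
      destruct (C y) as [F|[q [s [F1 [F2 [_ F]]]]]]; try lra.
      + rewrite (att_vtx y v z F). reflexivity.
      + rewrite (att_ept y v q s z F1 F2 F). split; auto. intros [F3|F3]; auto.
        apply conn_trans with q; auto. apply conn_edge; auto; [apply (HD x); auto|].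
        eapply conn_dom_l; eauto.
    - destruct (lp_cont _ _ _ L x (seg u' w' (s'/2) ((1+s')/2))) as [d [Hd C]];
        [lra|rewrite E; apply bn_seg; auto; lra|].
      exists d. split; auto. intros y Hy Hxy z. destruct (C y) as [q [Hq F]]; try lra.
      rewrite (att_ept x u' w' s' z A B E), (att_ept y u' w' q z); auto; [reflexivity|lra].
    - destruct (HE x r Hx Hr E) as [S HS].
      destruct (lp_cont _ _ _ L x (end_nbhd H S (endof H r))) as [d [Hd C]];
        [lra|rewrite E; apply bn_end; eauto|].
      exists d. split; auto. intros y Hy Hxy z. rewrite (att_end x r z Hr E).
      assert (M : forall a b, rcomp H S r a -> rcomp H S r b -> conn H D a b).
      { intros a b Ha Hb. eapply conn_mono; [intros ? ? Z; exact Z|exact HS|]. apply comp_conn; auto. }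
      assert (M2 : forall a, rcomp H S r a -> ((exists S', forall x, rcomp H S' r x -> conn H D x z) <-> conn H D a z)).
      { intros a Ha. split.
        - intros [S' HS']. destruct (ev_in_ex _ _ (ev_in_and _ _ _ (comp_tail H S r Hs Hr) (comp_tail H S' r Hs Hr))) as [i [I1 I2]].
          apply conn_trans with (r i); auto.
        - intros Hc. exists S. intros b Hb. apply conn_trans with a; auto. }
      assert (Cy := C y ltac:(lra) ltac:(lra)). rewrite end_nbhdE in Cy; auto.
      destruct Cy as [[a [F1 F2]]|[[a [b [s [F1 [F2 [F3 [F4 F5]]]]]]]|[r' [F1 [F2 F3]]]]].
      + rewrite (att_vtx y a z F2). rewrite (M2 a F1). reflexivity.
      + rewrite (att_ept y a b s z F1 F2 F5), (M2 a F3). split; auto. intros [F6|F6]; auto.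
        apply conn_trans with b; auto. apply conn_edge; auto. eapply conn_dom_l; eauto.
      + rewrite (att_end y r' z F1 F3).
        destruct (ev_in_ex _ _ (ev_in_and _ _ _ F2 (comp_tail H S r' Hs F1))) as [i [I1 I2]].
        rewrite (M2 (r' i) I1). split.
        * intros [S' HS']. destruct (ev_in_ex _ _ (ev_in_and _ _ _ F2 (comp_tail H S' r' Hs F1))) as [j [J1 J2]].
          apply conn_trans with (r' j); auto.
        * intros Hc. exists S. intros b Hb. apply conn_trans with (r' i); auto. apply M; auto.
          apply (comp_meet H S r r' (r' i)); auto. }
  apply (att_vtx X u w Eu). apply K. apply (att_vtx Y w w Ew). constructor.
  apply (HD Y); auto; lra.
Qed.

Lemma loop_connected H f v0 v : lf_graph H -> loop H f v0 -> conn H (fun _ => True) v0 v.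
Proof.
  intros OK L. destruct (pos_spec _ _ _ v L) as [A B].
  apply (arc_conn H f v0 _ 0 (place f v)); auto; try lra; [|apply L].
  intros; exists nil; auto.
Qed.

(** The end has [x] as its only preimage, so properness turns the interval around [x] into a
    neighbourhood of the end. *)
Lemma simple_end_nbhd H f v0 x d r : lf_graph H -> loop H f v0 -> simple f -> 0 < x < 1 -> 0 < d ->
  is_ray H r -> f x = inr (endof H r) ->
  exists S, forall v, rcomp H S r v -> x - d < place f v < x + d.
Proof.
  intros OK L Hi Hx Hd Hr E.
  destruct (loop_proper H f v0 (f x) (fun y => x - d < y < x + d) OK L) as [N [HN A]].
  - apply L; lra.
  - intros y Hy Ey. exists d. split; auto. intros z Hz Hzy.
    assert (y = x); [|lra]. apply Hi; auto; [|lra]. destruct (Req_dec y 1) as [->|]; [|lra].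
    rewrite (lp_1 _ _ _ L) in Ey. congruence.
  - rewrite E in HN. apply bn_end in HN; auto. destruct HN as [S ->]. exists S. intros v Hv.
    destruct (pos_spec _ _ _ v L) as [B C]. apply A; [lra|]. rewrite C. apply end_nbhd_vtx; auto.
Qed.

Lemma end_pos H f v0 x A : loop H f v0 -> 0 <= x <= 1 -> f x = inr A -> 0 < x < 1.
Proof.
  intros L Hx E. destruct (Req_dec x 0) as [->|]; [rewrite (lp_0 _ _ _ L) in E; congruence|].
  destruct (Req_dec x 1) as [->|]; [rewrite (lp_1 _ _ _ L) in E; congruence|]. lra.
Qed.

Lemma simple_arc_conn H f v0 u w : lf_graph H -> loop H f v0 -> simple f -> place f u <= place f w ->
  conn H (fun v => place f u <= place f v <= place f w) u w.
Proof.
  intros OK L Hi Huw. destruct (pos_spec _ _ _ u L) as [A B]. destruct (pos_spec _ _ _ w L) as [C D].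
  apply (arc_conn H f v0 _ (place f u) (place f w)); auto; try lra.
  - intros t v Ht E. apply (pos_close _ _ _ _ _ L) in E; lra.
  - intros t r Ht Hr E.
    assert (Ht1 : place f u < t < place f w).
    { destruct (Req_dec t (place f u)) as [->|]; [congruence|].
      destruct (Req_dec t (place f w)) as [->|]; [congruence|]. lra. }
    destruct (simple_end_nbhd H f v0 t (Rmin (t - place f u) (place f w - t)) r) as [S HS]; auto; try lra.
    + apply Rmin_glb_lt; lra.
    + exists S. intros v Hv. apply HS in Hv.
      assert (M := Rmin_l (t - place f u) (place f w - t)).
      assert (M' := Rmin_r (t - place f u) (place f w - t)). lra.
Qed.

(** The positions of the vertices of the ray accumulate by compactness. No vertex or inner point can
    be the limit, as a ray repeats no vertex; a limit end has each of its neighbourhoods met by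
    every tail of the ray, so it is the end of the ray. In particular every end is visited. *)
Lemma ray_limit H f v0 r : lf_graph H -> loop H f v0 -> is_ray H r ->
  exists x, 0 < x < 1 /\ f x = inr (endof H r).
Proof.
  intros OK L Hr. assert (Hs := lf_sym _ OK).
  destruct (accumulation (fun i => place f (r i))) as [x [Hx A]].
  { intros i. destruct (pos_spec _ _ _ (r i) L). lra. }
  assert (Near : forall N n, basic_nbhd H (f x) N -> exists i, (n <= i)%nat /\ N (inl (vtx (r i)))).
  { intros N n HN. destruct (lp_cont _ _ _ L x N Hx HN) as [d [Hd C]].
    destruct (A d n Hd) as [i [Hi Hp]]. exists i. split; auto.
    destruct (pos_spec _ _ _ (r i) L) as [P Q]. rewrite <- Q. apply C; lra. }
  destruct (cplx_cases H (f x)) as [[v E]|[[u' [w' [s' [B [C E]]]]]|[r' [Hr' E]]]].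
  - apply L; lra.
  - exfalso. assert (HN : basic_nbhd H (f x) (star H v 1)) by (rewrite E; apply bn_star; lra).
    destruct (Near _ O HN) as [i [_ Hi]]. destruct (Near _ (i + 1)%nat HN) as [j [Hj Hj']].
    apply star_vtx in Hi; auto. apply star_vtx in Hj'; auto.
    assert (i = j) by (apply Hr; congruence). lia.
  - exfalso. destruct (Near (seg u' w' (s'/2) ((1+s')/2)) O) as [i [_ [q [Hq F]]]].
    { rewrite E; apply bn_seg; auto; lra. }
    injection F as F. apply vtx_ept in F; auto; [eapply edge_neq; eauto|lra].
  - exists x. split; [eapply end_pos; eauto|]. rewrite E. f_equal. apply endof_eq; auto.
    apply ray_equivE; auto. intros S. destruct (comp_tail H S r Hs Hr) as [n Hn].
    destruct (Near (end_nbhd H S (endof H r')) n) as [i [Hi F]].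
    { rewrite E. apply bn_end; eauto. }
    apply end_nbhd_vtx in F; auto. exists (r i). auto.
Qed.

(** Along the orbit the level never drops, and while it stays the same [dd] decreases. So no vertex
    recurs, and each level is left after finitely many steps. *)
Lemma rank_ray H (P : V -> Prop) (phi : V -> V) (lev dd : V -> nat) v :
  (forall v, P v -> P (phi v) /\ H v (phi v) /\
     ((lev (phi v) = lev v /\ dd (phi v) < dd v)%nat \/ (lev v < lev (phi v))%nat)) ->
  P v -> is_ray H (fun i => Nat.iter i phi v) /\ (forall i, P (Nat.iter i phi v)) /\
    forall n, exists m, forall i, (m <= i)%nat -> (n <= lev (Nat.iter i phi v))%nat.
Proof.
  intros Hphi Hv. set (r := fun i => Nat.iter i phi v).
  assert (HP : forall i, P (r i)).
  { induction i; [exact Hv|]. apply (Hphi (r i)); auto. }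
  assert (Hst : forall i, (lev (r (S i)) = lev (r i) /\ dd (r (S i)) < dd (r i))%nat \/ (lev (r i) < lev (r (S i)))%nat).
  { intros i. apply (Hphi (r i)); auto. }
  assert (Hfw : forall k i, (lev (r (S k + i)) = lev (r i) /\ dd (r (S k + i)) < dd (r i))%nat \/ (lev (r i) < lev (r (S k + i)))%nat).
  { induction k; intros i; [apply Hst|]. specialize (IHk i). specialize (Hst (S k + i)%nat).
    change (S (S k) + i)%nat with (S (S k + i))%nat. lia. }
  assert (Hmon : forall i j, (i <= j)%nat -> (lev (r i) <= lev (r j))%nat).
  { intros i j Hij. destruct (Nat.eq_dec i j) as [->|]; auto.
    specialize (Hfw (j - i - 1)%nat i). replace (S (j - i - 1) + i)%nat with j in Hfw by lia. lia. }
  split; [split|split; [exact HP|]].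
  - assert (K : forall i j, (i < j)%nat -> r i <> r j).
    { intros i j Hij E. specialize (Hfw (j - i - 1)%nat i).
      replace (S (j - i - 1) + i)%nat with j in Hfw by lia. rewrite <- E in Hfw. lia. }
    intros i j E. destruct (Nat.lt_trichotomy i j) as [Hl|[?|Hl]]; auto; exfalso.
    + apply (K i j); auto. + apply (K j i); auto.
  - intros i. apply (Hphi (r i)); auto.
  - assert (Up : forall k i, (dd (r i) <= k)%nat -> exists j, (lev (r i) < lev (r j))%nat).
    { induction k; intros i Hk; destruct (Hst i) as [[A B]|A]; eauto; [lia|].
      destruct (IHk (S i)) as [j Hj]; [lia|]. exists j. lia. }
    induction n; [exists O; lia|]. destruct IHn as [m Hm].
    destruct (Up _ m (le_n _)) as [j Hj]. exists (max j m). intros i Hi.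
    change (S n <= lev (r i))%nat. specialize (Hm m (le_n m)). change (n <= lev (r m))%nat in Hm.
    assert (lev (r j) <= lev (r i))%nat by (apply Hmon; lia). lia.
Qed.

(** [lev v] is the last set containing [v], and [dd v] the distance within that set to the next one.
    Stepping to a neighbour that is closer, or already deeper, gives a ray at once, whereas
    concatenated walks could repeat vertices. *)
Lemma nest_ray H (Q : nat -> V -> Prop) :
  (forall n v, Q (S n) v -> Q n v) -> (forall n, exists v, Q n v) -> (forall v, exists n, ~ Q n v) ->
  (forall n u w, Q n u -> Q n w -> conn H (Q n) u w) ->
  exists r, is_ray H r /\ (forall i, Q O (r i)) /\ forall n, ev_in r (Q n).
Proof.
  intros Hdec Hne Hemp Hc.
  assert (Hdec' : forall m n v, (n <= m)%nat -> Q m v -> Q n v).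
  { induction 1; auto. }
  set (lev := fun v => epsilon (inhabits O) (fun n => Q n v /\ ~ Q (S n) v)).
  assert (Hlev : forall v, Q O v -> Q (lev v) v /\ ~ Q (S (lev v)) v).
  { intros v Hv. unfold lev. apply epsilon_spec. destruct (nat_least _ (Hemp v)) as [n [A B]].
    destruct n; [contradiction|]. exists n. split; auto. apply NNPP. intros C. apply B in C. lia. }
  assert (Hlev2 : forall n v, Q n v -> (n <= lev v)%nat).
  { intros n v Hv. destruct (Nat.le_gt_cases n (lev v)); auto. exfalso.
    assert (Hq0 : Q O v) by (apply (Hdec' n); auto; lia). apply (Hlev v Hq0). apply (Hdec' n); auto. }
  set (reach := fix reach n k v := match k with O => Q (S n) v
     | S k => exists w, H v w /\ Q n w /\ reach n k w end).
  assert (Hreach : forall v, Q O v -> exists k, reach (lev v) k v).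
  { intros v Hv. destruct (Hlev v Hv) as [A _]. destruct (Hne (S (lev v))) as [w Hw].
    assert (C := Hc (lev v) v w A (Hdec _ _ Hw)). clear A. revert Hw C. generalize (lev v). clear Hv. intros n Hw C.
    induction C as [x Hx|x y z Hx Hxy Hyz IH]; [exists O; auto|].
    destruct (IH Hw) as [k Hk]. exists (S k). simpl. exists y. split; auto. split; auto.
    eapply conn_dom_l; eauto. }
  set (dd := fun v => epsilon (inhabits O) (fun k => reach (lev v) k v /\ forall m, reach (lev v) m v -> (k <= m)%nat)).
  assert (Hdd : forall v, Q O v -> reach (lev v) (dd v) v /\ forall m, reach (lev v) m v -> (dd v <= m)%nat).
  { intros v Hv.
    apply (epsilon_spec (inhabits O) (fun k => reach (lev v) k v /\ forall m, reach (lev v) m v -> (k <= m)%nat)).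
    apply nat_least, Hreach; auto. }
  set (phi := fun v => epsilon (inhabits v) (fun w => H v w /\ Q (lev v) w /\
     ((lev w = lev v /\ dd w < dd v)%nat \/ (lev v < lev w)%nat))).
  assert (Hphi : forall v, Q O v -> H v (phi v) /\ Q (lev v) (phi v) /\
     ((lev (phi v) = lev v /\ dd (phi v) < dd v)%nat \/ (lev v < lev (phi v))%nat)).
  { intros v Hv.
    apply (epsilon_spec (inhabits v) (fun w => H v w /\ Q (lev v) w /\
     ((lev w = lev v /\ dd w < dd v)%nat \/ (lev v < lev w)%nat))). destruct (Hlev v Hv) as [A B].
    destruct (Hdd v Hv) as [C D]. destruct (dd v) as [|k] eqn:Ek; [contradiction|].
    destruct C as [w [C1 [C2 C3]]]. exists w. repeat split; auto.
    assert (H2 := Hlev2 _ _ C2). destruct (Nat.eq_dec (lev w) (lev v)) as [E|E]; [left|right; lia].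
    split; auto. assert (Qw : Q O w) by (apply (Hdec' (lev v)); auto; lia).
    destruct (Hdd w Qw) as [_ F]. rewrite E in F. specialize (F k C3). lia. }
  destruct (Hne O) as [v Hv].
  destruct (rank_ray H (Q O) phi lev dd v) as [A [B C]]; auto.
  { intros x Hx. destruct (Hphi x Hx) as [P1 [P2 P3]]. repeat split; auto.
    apply (Hdec' (lev x)); auto; lia. }
  exists (fun i => Nat.iter i phi v). split; auto. split; auto.
  intros n. destruct (C n) as [m Hm]. exists m. intros i Hi.
  destruct (Hlev _ (B i)) as [E _]. apply (Hdec' (lev (Nat.iter i phi v))); auto.
Qed.

End Arcs.

(** * Crossing separators *)

Section Crossing.
Context {V : Type}.
Implicit Types (H : V -> V -> Prop) (f : R -> pt V).

(** The boundary of an end neighbourhood consists of vertices of [S]: at the first exit, a vertex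
    outside [S], an inner point of an edge or an end would, as a limit of points of the
    neighbourhood, belong to it. *)
Lemma crossing H f v0 S r x y : lf_graph H -> loop H f v0 -> is_ray H r -> 0 <= x < y -> y <= 1 ->
  end_nbhd H S (endof H r) (f x) -> ~ end_nbhd H S (endof H r) (f y) ->
  exists t s, x < t <= y /\ In s S /\ f t = inl (vtx s).
Proof.
  intros OK L Hr Hx Hy Px Py. assert (Hs := lf_sym _ OK).
  assert (HB : basic_nbhd H (inr (endof H r)) (end_nbhd H S (endof H r))) by (apply bn_end; eauto).
  destruct (first_exit x y (fun t => end_nbhd H S (endof H r) (f t))) as [b [Hb [Nb Pb]]]; auto; [lra| |].
  { intros t Ht Pt. destruct (bn_open _ _ _ OK HB) as [_ O]. destruct (O _ Pt) as [N [HN HNO]].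
    destruct (lp_cont _ _ _ L t N) as [d [Hd C]]; auto; [lra|]. exists d. split; auto.
    intros z Hz Hzt. apply HNO, C; auto; lra. }
  assert (Near : forall N, basic_nbhd H (f b) N -> exists q, N q /\ end_nbhd H S (endof H r) q).
  { intros N HN. destruct (lp_cont _ _ _ L b N) as [d [Hd C]]; auto; [lra|].
    set (z := Rmax x (b - d/2)).
    assert (Hz : x <= z < b /\ b - d < z).
    { unfold z, Rmax; destruct (Rle_dec x (b - d/2)); lra. }
    exists (f z). split; [apply C; lra|apply Pb; tauto]. }
  destruct (cplx_cases H (f b)) as [[v E]|[[u [w [s [A [B E]]]]]|[r' [Hr' E]]]].
  - apply L; lra.
  - destruct (classic (In v S)) as [Hv|Hv]; [exists b, v; auto|]. exfalso. apply Nb. rewrite E.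
    destruct (Near (star H v 1)) as [q [[->|[w [s [F1 [F2 [_ ->]]]]]] F4]]; auto.
    + rewrite E; apply bn_star; lra.
    + apply end_nbhd_ept in F4; auto. apply end_nbhd_vtx; tauto.
  - exfalso. apply Nb. rewrite E. destruct (Near (seg u w (s/2) ((1+s)/2))) as [q [[s' [Hs' ->]] F]].
    + rewrite E; apply bn_seg; auto; lra.
    + apply end_nbhd_ept; auto. apply end_nbhd_ept in F; auto; lra.
  - exfalso. destruct (Near (end_nbhd H S (endof H r'))) as [q [F1 F2]].
    + rewrite E; apply bn_end; eauto.
    + apply (end_nbhd_disjoint H S r' r OK Hr' Hr) with q; auto.
      intros z Hz Hz'. apply Nb. rewrite E. apply end_nbhd_end; auto.
      eapply ev_in_mono; [|apply (comp_tail H S r' Hs Hr')]. intros v Hv.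
      apply (comp_meet H S r r' z Hs Hz' Hz). exact Hv.
Qed.

(** Ends are totally disconnected: a path from one end to another has to leave a neighbourhood
    separating them, and does so through a vertex. *)
Lemma ends_const H f v0 x y : lf_graph H -> loop H f v0 -> 0 <= x <= y -> y <= 1 ->
  (forall t, x <= t <= y -> exists A, f t = inr A) -> f x = f y.
Proof.
  intros OK L Hx Hy HE. destruct (Req_dec x y) as [->|Hne]; auto.
  assert (HE' : forall t, x <= t <= y -> exists r, is_ray H r /\ f t = inr (endof H r)).
  { intros t Ht. destruct (HE t Ht) as [A E].
    destruct (cplx_cases H (f t)) as [[v E']|[[u [w [s [_ [_ E']]]]]|C]]; auto; [apply L; lra|congruence..]. }
  destruct (HE' x) as [r [Hr Er]]; [lra|]. destruct (HE' y) as [r' [Hr' Er']]; [lra|].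
  rewrite Er, Er'. f_equal. apply endof_eq; auto; [apply OK|]. apply NNPP; intros Hn.
  destruct (not_equiv_sep H r r' OK Hr Hr' Hn) as [S HS].
  destruct (crossing H f v0 S r x y OK L Hr) as [t [s [Ht [_ E]]]]; try lra.
  - rewrite Er. apply end_nbhd_self; auto.
  - rewrite Er'. rewrite end_nbhd_end; auto. intros C.
    destruct (ev_in_ex _ _ (ev_in_and _ _ _ C (comp_tail H S r' (lf_sym _ OK) Hr'))) as [i [? ?]]; eauto.
  - destruct (HE t) as [A EA]; [lra|]. congruence.
Qed.

(** A simple loop is not constant just before [x], so by [ends_const] it meets a vertex or an edge
    there; an edge arc is completed before [x], and its last point is a vertex. *)
Lemma vertex_before H f v0 x y A : infinite_vertices V -> lf_graph H -> loop H f v0 -> simple f ->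
  0 <= y < x -> x < 1 -> f x = inr A -> exists v, y < place f v < x.
Proof.
  intros HV OK L Hi Hy Hx E.
  (* Starting from the midpoint makes the position found strictly larger than [y], and a stretch of
     ends from there to [x] would repeat a value. *)
  assert (K : exists z, (y + x)/2 <= z < x /\ forall A, f z <> inr A).
  { apply NNPP; intros Hn. assert ((y + x)/2 = x); [|lra]. apply Hi; try lra.
    apply (ends_const H f v0); auto; try lra. intros t Ht.
    destruct (Req_dec t x) as [->|]; [eauto|]. apply NNPP; intros Hn'. apply Hn. exists t.
    split; [lra|]. intros B EB. apply Hn'; eauto. }
  destruct K as [z [Hz Hz']].
  destruct (cplx_cases H (f z)) as [[v Ev]|[[u [w [s [B [C Ev]]]]]|[r' [Hr' Ev]]]].
  - apply L; lra.
  - exists v. rewrite <- (pos_eq H f v0 v z); auto; lra.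
  - destruct (inner_arc H f v0 z u w HV OK L) as [a [b [Hab Harc]]]; auto; [lra|eauto|].
    assert (Hb : exists v, f b = inl (vtx v)) by (destruct Harc as [[_ [_ [_ [? _]]]]|[_ [_ [_ [? _]]]]]; eauto).
    destruct Hb as [v Hv].
    assert (Hbx : b < x).
    { destruct (Rtotal_order b x) as [|[Heq|Hgt]]; auto; exfalso; [congruence|].
      destruct Harc as [Harc|Harc]; apply (arc_no_end _ _ _ _ _ _ x A Harc); auto; lra. }
    exists v. rewrite <- (pos_eq H f v0 v b); auto; lra.
  - exfalso. eapply Hz'; eauto.
Qed.

Lemma left_ray H f v0 x r : infinite_vertices V -> lf_graph H -> loop H f v0 -> simple f ->
  0 < x < 1 -> is_ray H r -> f x = inr (endof H r) ->
  exists r', endof H r r' /\ forall i, place f (r' i) < x.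
Proof.
  intros HV OK L Hi Hx Hr E. assert (Hs := lf_sym _ OK).
  (* These intervals begin with all positions between 0 and [x] and shrink to [x] from the left;
     each is connected because it contains the arc between any two of its vertices. *)
  destruct (nest_ray H (fun n v => x - x / (INR n + 1) < place f v < x)) as [r' [A [B C]]].
  - intros n v Hv. assert (Hn := pos_INR n). rewrite S_INR in Hv. split; [|lra].
    assert (x / (INR n + 1 + 1) <= x / (INR n + 1)); [|lra].
    apply Rmult_le_compat_l; [lra|]. apply Rinv_le_contravar; lra.
  - intros n. assert (Hn := pos_INR n).
    assert (0 < x / (INR n + 1)) by (apply Rdiv_lt_0_compat; lra).
    assert (x / (INR n + 1) <= x).
    { apply Rmult_le_reg_r with (INR n + 1); [lra|]. unfold Rdiv. rewrite Rmult_assoc, Rinv_l by lra. nra. }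
    apply (vertex_before H f v0 x _ (endof H r)); auto; lra.
  - intros v. destruct (Rlt_dec (place f v) x) as [Hv|Hv]; [|exists O; lra].
    destruct (archimed_cor1 ((x - place f v)/x)) as [n [Hn Hn0]]; [apply Rdiv_lt_0_compat; lra|].
    exists n. intros [D _]. assert (P : 0 < INR n) by (apply lt_0_INR; auto).
    assert (x * / INR n < x - place f v).
    { apply Rmult_lt_compat_l with (r := x) in Hn; [|lra].
      replace (x * ((x - place f v)/x)) with (x - place f v) in Hn by (field; lra). auto. }
    assert (x / (INR n + 1) <= x * / INR n); [|lra].
    apply Rmult_le_compat_l; [lra|]. apply Rinv_le_contravar; lra.
  - intros n u w Hu Hw. destruct (Rle_dec (place f u) (place f w)).
    + eapply conn_mono; [intros ? ? Z; exact Z| |apply (simple_arc_conn H f v0); auto].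
      intros v Hv; cbv beta in Hv; lra.
    + apply conn_sym; auto.
      eapply conn_mono; [intros ? ? Z; exact Z| |apply (simple_arc_conn H f v0); auto; lra].
      intros v Hv; cbv beta in Hv; lra.
  - exists r'. split; [split; auto|intros i; apply B].
    apply ray_equiv_comp; auto. intros S.
    destruct (lp_cont _ _ _ L x (end_nbhd H S (endof H r))) as [d [Hd D]];
      [lra|rewrite E; apply bn_end; eauto|].
    destruct (archimed_cor1 (d / x)) as [n [Hn Hn0]]; [apply Rdiv_lt_0_compat; lra|].
    eapply ev_in_mono; [|apply (C n)]. intros v Hv; cbv beta in Hv.
    destruct (pos_spec _ _ _ v L) as [P1 P2]. apply end_nbhd_vtx; auto. rewrite <- P2. apply D; [lra|].
    assert (P : 0 < INR n) by (apply lt_0_INR; auto).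
    assert (x * / INR n < d).
    { apply Rmult_lt_compat_l with (r := x) in Hn; [|lra].
      replace (x * (d/x)) with d in Hn by (field; lra). auto. }
    assert (x / (INR n + 1) <= x * / INR n); [|lra].
    apply Rmult_le_compat_l; [lra|]. apply Rinv_le_contravar; lra.
Qed.

Lemma two_rays H f v0 r : infinite_vertices V -> lf_graph H -> loop H f v0 -> simple f ->
  is_ray H r -> has_disjoint_rays (endof H r) 2.
Proof.
  intros HV OK L Hi Hr. destruct (ray_limit H f v0 r OK L Hr) as [x [Hx E]].
  destruct (left_ray H f v0 x r HV OK L Hi Hx Hr E) as [r1 [A B]].
  destruct (left_ray H _ v0 (1 - x) r HV OK (loop_rev _ _ _ L) (simple_rev _ _ _ L Hi)) as [r2 [C D]]; auto.
  { lra. } { replace (1 - (1 - x)) with x by ring. auto. }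
  assert (K : forall m n, r1 m = r2 n -> r2 n <> v0 -> False).
  { intros m n Emn Hn. specialize (D n). rewrite (pos_rev _ _ _ _ L Hn) in D. specialize (B m).
    rewrite Emn in B. lra. }
  destruct C as [C1 C2].
  (* Reflecting the loop reflects every position except that of [v0], which remains 0; the second
     ray is therefore shortened to a tail avoiding [v0]. *)
  assert (Ht : exists N, forall n, (N <= n)%nat -> r2 n <> v0).
  { destruct (ray_avoid H r2 (v0 :: nil) C1) as [N HN]. exists N. intros n Hn En.
    apply (HN n Hn). left; auto. }
  destruct Ht as [N HN].
  assert (Hsh : endof H r (fun i => r2 (N + i)%nat)).
  { assert (R2 : is_ray H (fun i => r2 (N + i)%nat)).
    { split.
      - intros i j Eij. apply C1 in Eij. lia.
      - intros i. rewrite Nat.add_succ_r. apply C1. }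
    split; auto. apply ray_equiv_comp; auto; [apply OK|]. intros S.
    destruct (comp_tail H S r2 (lf_sym _ OK) C1) as [m Hm]. exists m. intros i Hi'.
    apply (comp_equiv H S r r2); auto; [apply OK|]. apply Hm. lia. }
  exists (fun i => match i with O => r1 | _ => fun i => r2 (N + i)%nat end). split.
  - intros [|[|i]] Hi'; auto; lia.
  - intros [|[|i]] [|[|j]] Hi' Hj Hij m n Emn; try lia.
    + apply (K m (N + n)%nat Emn). apply HN; lia.
    + apply (K n (N + m)%nat); auto. apply HN; lia.
Qed.

End Crossing.

(** * From a circle to a faithful subgraph *)

Lemma list_dist {T : Type} (p : T -> R) (x : R) (l : list T) : (forall t, In t l -> p t <> x) ->
  exists d, 0 < d /\ forall t, In t l -> p t <= x - d \/ x + d <= p t.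
Proof.
  induction l as [|a l IH]; intros Hl; [exists 1; split; [lra|intros t []]|].
  destruct IH as [d [Hd A]]; [intros; apply Hl; right; auto|].
  assert (Ha : p a <> x) by (apply Hl; left; auto).
  exists (Rmin d (Rabs (p a - x))). assert (M := Rmin_l d (Rabs (p a - x))).
  assert (M' := Rmin_r d (Rabs (p a - x))). split.
  - apply Rmin_glb_lt; auto. apply Rabs_pos_lt; lra.
  - intros t [<-|Ht]; [|destruct (A t Ht); lra].
    unfold Rabs in M'; destruct (Rcase_abs (p a - x)); unfold Rabs; destruct (Rcase_abs (p a - x)); lra.
Qed.

Lemma list_pred {T : Type} (p : T -> R) (x : R) (l : list T) : (exists t, In t l /\ p t < x) ->
  exists t, In t l /\ p t < x /\ forall t', In t' l -> p t' < x -> p t' <= p t.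
Proof.
  induction l as [|a l IH]; intros [t [Ht Hx]]; [destruct Ht|].
  destruct (classic (exists t, In t l /\ p t < x)) as [C|C].
  - destruct (IH C) as [b [B1 [B2 B3]]].
    destruct (Rlt_dec (p b) (p a)) as [Hab|Hab]; [destruct (Rlt_dec (p a) x)|].
    + exists a. split; [left; auto|]. split; auto. intros t' [<-|Ht'] Hl; [lra|].
      specialize (B3 t' Ht' Hl); lra.
    + exists b. split; [right; auto|]. split; auto. intros t' [<-|Ht'] Hl; [lra|auto].
    + exists b. split; [right; auto|]. split; auto. intros t' [<-|Ht'] Hl; [lra|auto].
  - exists a. destruct Ht as [<-|Ht]; [|exfalso; eauto].
    split; [left; auto|]. split; auto. intros t' [<-|Ht'] Hl; [lra|]. exfalso; eauto.
Qed.

Lemma conn_mono_dom {V : Type} (H H' : V -> V -> Prop) (D D' : V -> Prop) x y :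
  (forall u v, D u -> D v -> H u v -> H' u v) -> (forall v, D v -> D' v) ->
  conn H D x y -> conn H' D' x y.
Proof.
  intros HH HD; induction 1 as [|x y z Hx Hxy Hyz IH]; [constructor; auto|].
  econstructor; eauto. apply HH; auto. eapply conn_dom_l; eauto.
Qed.

Lemma lf_subgraph {V : Type} (F G : V -> V -> Prop) : lf_graph G ->
  (forall u v, F u v -> F v u) -> (forall u v, F u v -> G u v) -> lf_graph F.
Proof.
  intros OK Hs HFG. split; auto.
  - intros v Hv. apply (lf_irr _ OK v); auto.
  - intros v. destruct (lf_fin _ OK v) as [l Hl]. exists l. auto.
Qed.

Lemma ray_sub {V : Type} (F G : V -> V -> Prop) r : (forall u v, F u v -> G u v) ->
  is_ray F r -> is_ray G r.
Proof. intros HFG [A B]; split; auto. Qed.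

Lemma rcomp_sub {V : Type} (F G : V -> V -> Prop) S r x : (forall u v, F u v -> G u v) ->
  rcomp F S r x -> rcomp G S r x.
Proof. intros HFG. apply ev_in_mono. intros y. apply conn_mono; auto. Qed.

Section CircleToSubgraph.
Context {V : Type}.
Variables (G : V -> V -> Prop) (f : R -> pt V) (v0 : V).
Hypotheses (HV : infinite_vertices V) (OK : lf_graph G) (L : loop G f v0) (Hi : simple f).

Let p := place f.

(** No element of [T] lies weakly between the position [x] and the vertex [v] on the loop. *)
Definition gap (T : list V) (x : R) (v : V) : Prop :=
  forall t, In t T -> (p t < x /\ p t < p v) \/ (x < p t /\ p v < p t).

Lemma gap_sym T u v : gap T (p u) v -> gap T (p v) u.
Proof. intros A t Ht. destruct (A t Ht); tauto. Qed.

Lemma gap_trans T x u v : gap T x u -> gap T (p u) v -> gap T x v.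
Proof. intros A B t Ht. destruct (A t Ht), (B t Ht); lra. Qed.

Lemma gap_same T x u v : gap T x u -> gap T x v -> gap T (p u) v.
Proof. intros A B t Ht. destruct (A t Ht), (B t Ht); lra. Qed.

Lemma gap_refl T x v : gap T x v -> gap T (p v) v.
Proof. intros A. eapply gap_same; eauto. Qed.

Lemma gap_mono T T' x v : incl T T' -> gap T' x v -> gap T x v.
Proof. intros A B t Ht; auto. Qed.

Lemma gap_notin T x v : gap T x v -> ~ In v T.
Proof. intros A Hv. destruct (A v Hv); lra. Qed.

Lemma gap_between T u w v : gap T (p u) w -> p u <= p v <= p w -> gap T (p u) v.
Proof. intros A Hv t Ht. destruct (A t Ht); lra. Qed.

Lemma gap_conn_G T u w : gap T (p u) w -> conn G (gap T (p u)) u w.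
Proof.
  intros A. destruct (Rle_dec (p u) (p w)) as [Hle|Hle].
  - eapply conn_mono; [intros ? ? Z; exact Z| |apply (simple_arc_conn G f v0); eauto].
    intros v Hv; cbv beta in Hv. eapply gap_between; eauto.
  - apply conn_sym; [apply OK|].
    eapply conn_mono; [intros ? ? Z; exact Z| |apply (simple_arc_conn G f v0); auto; unfold p in *; lra].
    intros v Hv; cbv beta in Hv. apply gap_trans with w; auto. apply gap_between with u; auto.
    apply gap_sym; auto.
Qed.

(** For any two vertices of [Y] in a common gap, the finite support of a connecting walk inside that
    gap is added. The added vertices need no further closure, because within the support they are
    joined to the end of their walk, a vertex of [Y]. *)
Lemma gap_step (T Y : list V) : exists T', incl T T' /\ incl Y T' /\
  forall u w, In u T' -> In w T' -> gap T (p u) w ->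
    conn G (fun v => In v T' /\ gap T (p u) v) u w.
Proof.
  (* Pairs in different gaps contribute nothing, so every vertex added beyond [T] and [Y] lies on a
     walk inside a gap. *)
  assert (HL : exists l : V -> V -> list V, forall u w,
     (gap T (p u) w -> (forall v, In v (l u w) -> gap T (p u) v) /\
        conn G (fun v => In v (l u w)) u w /\
        forall v, In v (l u w) -> conn G (fun v => In v (l u w)) v w) /\
     (~ gap T (p u) w -> l u w = nil)).
  { assert (K : forall u w, exists l : list V,
     (gap T (p u) w -> (forall v, In v l -> gap T (p u) v) /\
        conn G (fun v => In v l) u w /\ forall v, In v l -> conn G (fun v => In v l) v w) /\
     (~ gap T (p u) w -> l = nil)).
    { intros u w. destruct (classic (gap T (p u) w)) as [A|A].
      - destruct (conn_support _ _ _ _ (gap_conn_G T u w A)) as [l Hl]. exists l. tauto.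
      - exists nil. tauto. }
    exists (fun u w => proj1_sig (constructive_indefinite_description _ (K u w))).
    intros u w. exact (proj2_sig (constructive_indefinite_description _ (K u w))). }
  destruct HL as [l Hl].
  set (T' := T ++ Y ++ flat_map (fun u => flat_map (l u) Y) Y).
  assert (HY : incl Y T') by (apply incl_appr, incl_appl, incl_refl).
  assert (HlT : forall u w v, In u Y -> In w Y -> In v (l u w) -> In v T').
  { intros u w v Hu Hw Hv. apply in_or_app; right. apply in_or_app; right.
    apply in_flat_map. exists u. split; auto. apply in_flat_map. eauto. }
  exists T'. split; [apply incl_appl, incl_refl|]. split; auto.
  assert (toY : forall u, In u T' -> gap T (p u) u -> exists y, In y Y /\ gap T (p u) y /\
     conn G (fun v => In v T' /\ gap T (p u) v) u y).
  { intros u Hu Hg. apply in_app_or in Hu. destruct Hu as [Hu|Hu]; [exfalso; eapply gap_notin; eauto|].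
    apply in_app_or in Hu. destruct Hu as [Hu|Hu].
    - exists u. repeat split; auto. constructor. auto.
    - apply in_flat_map in Hu. destruct Hu as [y1 [Hy1 Hu]]. apply in_flat_map in Hu.
      destruct Hu as [y2 [Hy2 Hu]]. destruct (Hl y1 y2) as [A B].
      destruct (classic (gap T (p y1) y2)) as [C|C]; [|rewrite (B C) in Hu; destruct Hu].
      destruct (A C) as [A1 [A2 A3]]. exists y2. split; auto. split.
      + apply gap_same with (p y1); auto.
      + eapply conn_mono; [intros ? ? Z; exact Z| |apply (A3 u Hu)].
        intros v Hv; cbv beta in Hv. split; [exact (HlT y1 y2 v Hy1 Hy2 Hv)|]. apply gap_same with (p y1); auto. }
  intros u w Hu Hw Hg.
  assert (Gu : gap T (p u) u) by (apply gap_trans with w; auto; apply gap_sym; auto).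
  assert (Gw : gap T (p w) w) by (apply gap_refl with (p u); auto).
  destruct (toY u Hu Gu) as [y [Hy [Gy Cy]]]. destruct (toY w Hw Gw) as [z [Hz [Gz Cz]]].
  assert (Gyz : gap T (p y) z).
  { apply gap_same with (p u); auto. apply gap_trans with w; auto. }
  apply conn_trans with y; auto. apply conn_trans with z.
  - destruct (Hl y z) as [A _]. destruct (A Gyz) as [A1 [A2 _]].
    eapply conn_mono; [intros ? ? Z; exact Z| |exact A2].
    intros v Hv; cbv beta in Hv. split; [exact (HlT y z v Hy Hz Hv)|]. apply gap_trans with y; auto.
  - apply conn_sym; [apply OK|]. eapply conn_mono; [intros ? ? Z; exact Z| |exact Cz].
    intros v [Hv1 Hv2]. split; auto. apply gap_trans with w; auto.
Qed.

(** Neighbours of [T n] are put into the next set so that the circle successor of a vertex is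
    present one level later; descending through the levels relies on this. *)
Lemma gap_sequence : exists T : nat -> list V,
  In v0 (T O) /\ (forall n, incl (T n) (T (S n))) /\ (forall v, exists n, In v (T n)) /\
  (forall n u w, In u (T n) -> G u w -> In w (T (S n))) /\
  (forall n u w, In u (T (S n)) -> In w (T (S n)) -> gap (T n) (p u) w ->
     conn G (fun v => In v (T (S n)) /\ gap (T n) (p u) v) u w).
Proof.
  destruct (neighbours G (lf_fin _ OK)) as [nb Hnb].
  destruct (exhaustion G v0 (lf_fin _ OK)) as [B [_ HB]]; [intros; apply (loop_connected G f); auto|].
  set (step := fun T Y => proj1_sig (constructive_indefinite_description _ (gap_step T Y))).
  assert (Hstep : forall T Y, incl T (step T Y) /\ incl Y (step T Y) /\
    forall u w, In u (step T Y) -> In w (step T Y) -> gap T (p u) w ->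
    conn G (fun v => In v (step T Y) /\ gap T (p u) v) u w).
  { intros T Y. exact (proj2_sig (constructive_indefinite_description _ (gap_step T Y))). }
  set (T := fix T n := match n with O => v0 :: nil | S n => step (T n) (B n ++ flat_map nb (T n)) end).
  assert (HT : forall n, T (S n) = step (T n) (B n ++ flat_map nb (T n))) by reflexivity.
  exists T. split; [left; auto|]. split; [intros n; rewrite HT; apply Hstep|]. split; [|split].
  - intros v. destruct (HB v) as [n Hn]. exists (S n). rewrite HT. apply Hstep.
    apply in_or_app; auto.
  - intros n u w Hu Huw. rewrite HT. apply Hstep. apply in_or_app; right. apply in_flat_map; eauto.
  - intros n u w. rewrite HT. apply Hstep.
Qed.

Variable T : nat -> list V.
Hypotheses (T0 : In v0 (T O)) (Tincl1 : forall n, incl (T n) (T (S n)))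
  (Tall : forall v, exists n, In v (T n))
  (Tnb : forall n u w, In u (T n) -> G u w -> In w (T (S n)))
  (Tconn : forall n u w, In u (T (S n)) -> In w (T (S n)) -> gap (T n) (p u) w ->
     conn G (fun v => In v (T (S n)) /\ gap (T n) (p u) v) u w).

Lemma Tincl m n : (m <= n)%nat -> incl (T m) (T n).
Proof. induction 1; [apply incl_refl|]. eapply incl_tran; eauto. Qed.

Lemma Tfin (l : list V) : exists n, incl l (T n).
Proof.
  induction l as [|v l [n Hn]]; [exists O; intros ? []|]. destruct (Tall v) as [m Hm].
  exists (max m n). apply incl_cons.
  - apply (Tincl m); auto; lia.
  - eapply incl_tran; [exact Hn|]. apply Tincl; lia.
Qed.

Lemma T_v0 n : In v0 (T n).
Proof. apply (Tincl O); auto; lia. Qed.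

(** * The subgraph of circle edges and gap edges *)

Definition cadj (u w : V) : Prop := exists a b, edge_arc G f a b u w \/ edge_arc G f a b w u.

Definition sparse (u w : V) : Prop :=
  cadj u w \/ (G u w /\ exists n, In u (T (S n)) /\ In w (T (S n)) /\ gap (T n) (p u) w).

Lemma sparse_sym u w : sparse u w -> sparse w u.
Proof.
  intros [[a [b A]]|[A [n [B [C D]]]]].
  - left. exists a, b. tauto.
  - right. split; [apply OK; auto|]. exists n. repeat split; auto. apply gap_sym; auto.
Qed.

Lemma sparse_sub u w : sparse u w -> G u w.
Proof. intros [[a [b [A|A]]]|[A _]]; auto; [apply A|apply (lf_sym _ OK), A]. Qed.

Lemma sparse_ok : lf_graph sparse.
Proof. apply (lf_subgraph _ G); auto using sparse_sym, sparse_sub. Qed.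

(** Descent by one level: let [t] be the last vertex before [v] in the set one level below that of
    [v], and [w] its circle successor. No element of that set lies between [w] and [v], so they are
    joined by edges of this level, and the circle edge leads from [w] to [t]. *)
Lemma gap_to_level n m v : In v (T (S (m + n))) -> gap (T n) (p v) v ->
  exists y, In y (T (S n)) /\ conn sparse (gap (T n) (p v)) v y.
Proof.
  revert v. induction m as [|m IH]; intros v Hv Hg.
  - exists v. split; auto. constructor; auto.
  - destruct (classic (In v (T (S m + n)%nat))) as [Hin|Hin]; [apply IH; auto|].
    assert (Hv0 : v <> v0) by (intros ->; apply Hin, T_v0).
    destruct (pos_pos G f v0 v L Hv0) as [Hp1 Hp2].
    destruct (list_pred p (p v) (T (S m + n)%nat)) as [t [Ht [Htv Hmax]]].
    { exists v0. split; [apply T_v0|]. unfold p at 1. rewrite (pos_v0 G f v0 L); auto. }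
    destruct (pos_spec G f v0 t L) as [Pt1 Pt2].
    destruct (succ_arc G f v0 (place f t) t HV OK L Pt1 Pt2) as [b [w Harc]].
    destruct (pos_spec G f v0 v L) as [Pv1 Pv2].
    assert (Hbv : b <= p v).
    { destruct (Rle_dec b (p v)); auto. exfalso.
      apply (arc_no_vtx G f _ _ _ _ (p v) v OK Harc); auto. unfold p in *; lra. }
    destruct Harc as [Ha1 [Ha2 [Ha3 [Ha4 Ha5]]]].
    assert (Hbw : b = p w) by (apply (pos_eq G f v0); auto; unfold p in *; lra).
    assert (Hw : In w (T (S (S m + n)))) by (eapply Tnb; eauto).
    assert (Hgw : gap (T (S m + n)%nat) (p v) w).
    { intros t' Ht'. destruct (Rtotal_order (p t') (p v)) as [Hlt|[E|Hgt]].
      - left. split; auto. specialize (Hmax t' Ht' Hlt). unfold p in *; lra.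
      - exfalso. apply Hin. rewrite <- (pos_inj G f v0 t' v); auto.
      - right. split; auto. unfold p in *; lra. }
    assert (Hi1 : incl (T n) (T (S m + n)%nat)) by (apply Tincl; lia).
    assert (C1 : conn sparse (gap (T n) (p v)) v w).
    { eapply conn_mono_dom; [| |apply (Tconn (S m + n)%nat v w); auto].
      - intros x y [X1 X2] [Y1 Y2] Hxy. right. split; auto. exists (S m + n)%nat.
        repeat split; auto. eapply gap_same; eauto.
      - intros x [_ Hx]. eapply gap_mono; eauto. }
    assert (Hwt : sparse w t).
    { left. exists (place f t), b. right. repeat split; auto; lra. }
    (* Otherwise its neighbour [w] would belong to the set at level [S n] and could not lie in a gap
       of the later set. *)
    assert (Htn : ~ In t (T n)).
    { intros C. apply (gap_notin _ _ _ Hgw). apply (Tincl (S n)); [lia|]. eapply Tnb; eauto. }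
    assert (Hgt : gap (T n) (p v) t).
    { intros t' Ht'. destruct (Rtotal_order (p t') (p v)) as [Hlt|[E|Hgt]].
      - left. split; auto. destruct (Hmax t' (Hi1 _ Ht') Hlt) as [|E]; auto.
        exfalso. apply Htn. rewrite <- (pos_inj G f v0 t' t); auto.
      - exfalso. apply Hin. rewrite <- (pos_inj G f v0 t' v); auto.
      - right. split; auto. lra. }
    destruct (IH t) as [y [Hy Cy]]; auto; [eapply gap_refl; eauto|].
    exists y. split; auto. apply conn_trans with w; auto. apply conn_trans with t.
    + apply conn_edge; auto. eapply gap_mono; eauto.
    + eapply conn_mono; [intros ? ? Z; exact Z| |exact Cy]. intros x Hx. eapply gap_trans; eauto.
Qed.

Lemma gap_conn n x u w : gap (T n) x u -> gap (T n) x w -> conn sparse (gap (T n) x) u w.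
Proof.
  assert (K : forall v, gap (T n) x v -> exists y, In y (T (S n)) /\ conn sparse (gap (T n) x) v y).
  { intros v Hv. destruct (Tall v) as [m Hm].
    destruct (gap_to_level n m v) as [y [Hy C]].
    - apply (Tincl m); auto; lia.
    - eapply gap_refl; eauto.
    - exists y. split; auto. eapply conn_mono; [intros ? ? Z; exact Z| |exact C].
      intros z Hz. eapply gap_trans; eauto. }
  intros Hu Hw. destruct (K u Hu) as [y [Hy Cy]]. destruct (K w Hw) as [z [Hz Cz]].
  apply conn_trans with y; auto. apply conn_trans with z; [|apply conn_sym; auto using sparse_sym].
  assert (Gy := conn_dom_r _ _ _ _ Cy). assert (Gz := conn_dom_r _ _ _ _ Cz).
  eapply conn_mono_dom; [| |apply (Tconn n y z); auto].
  - intros a b [A1 A2] [B1 B2] Hab. right. split; auto. exists n. repeat split; auto.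
    apply gap_same with (p y); auto.
  - intros a [_ A]. apply gap_trans with y; auto.
  - eapply gap_same; eauto.
Qed.

Definition extreme n x u : Prop :=
  (forall v, gap (T n) x v -> p u <= p v) \/ (forall v, gap (T n) x v -> p v <= p u).

(** An edge added at level [m] stays inside a gap of [T n] if n is at most m, and has both endpoints
    in [T n] if m is less than n. So only a circle edge can leave, and it does so from the first or
    last vertex of the gap. *)
Lemma gap_exit n x u w : gap (T n) x u -> ~ gap (T n) x w -> sparse u w -> extreme n x u.
Proof.
  intros Hu Hw HF.
  assert (Hw' : ~ gap (T n) (p u) w) by (intros C; apply Hw; eapply gap_trans; eauto).
  assert (Hw2 : exists t, In t (T n) /\ ~ ((p t < p u /\ p t < p w) \/ (p u < p t /\ p w < p t))).
  { apply NNPP; intros C. apply Hw'. intros t Ht. apply NNPP; intros C'. apply C; eauto. }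
  destruct Hw2 as [t [Ht Hnt]].
  assert (Htu : p t <> p u).
  { intros E. apply (gap_notin _ _ _ Hu). rewrite <- (pos_inj G f v0 t u); auto. }
  assert (Hu0 : u <> v0) by (intros ->; apply (gap_notin _ _ _ Hu), T_v0).
  destruct HF as [[a [b [Harc|Harc]]]|[HG [m [M1 [M2 M3]]]]].
  - right. intros v Hv. destruct (Rle_dec (p v) (p u)); auto. exfalso.
    destruct (pos_spec G f v0 v L) as [Pv1 Pv2].
    assert (Harc0 := Harc). destruct Harc as [Ha1 [Ha2 [Ha3 [Ha4 Ha5]]]].
    assert (Ea : a = p u) by (apply (pos_eq G f v0); auto; lra).
    assert (Hbv : b <= p v).
    { destruct (Rle_dec b (p v)); auto. exfalso.
      apply (arc_no_vtx G f _ _ _ _ (p v) v OK Harc0); auto. lra. }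
    assert (Eb : b = p w) by (apply (pos_eq G f v0); auto; unfold p in *; lra).
    assert (Htv := gap_same _ _ _ _ Hu Hv t Ht). lra.
  - left. intros v Hv. destruct (Rle_dec (p u) (p v)); auto. exfalso.
    destruct (pos_spec G f v0 v L) as [Pv1 Pv2].
    assert (Harc0 := Harc). destruct Harc as [Ha1 [Ha2 [Ha3 [Ha4 Ha5]]]].
    assert (Ea : a = p w) by (apply (pos_eq G f v0); auto; lra).
    assert (Eb : b = p u).
    { destruct (pos_close G f v0 u b L) as [|[_ C]]; auto; [lra|contradiction]. }
    assert (Hbv : p v <= a).
    { destruct (Rle_dec (p v) a); auto. exfalso.
      apply (arc_no_vtx G f _ _ _ _ (p v) v OK Harc0); auto. lra. }
    assert (Htv := gap_same _ _ _ _ Hu Hv t Ht). lra.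
  - exfalso. destruct (Nat.le_gt_cases n m) as [Hnm|Hnm].
    + apply Hw'. eapply gap_mono; [|exact M3]. apply Tincl; auto.
    + apply (gap_notin _ _ _ Hu). apply (Tincl (S m)); auto.
Qed.

Lemma tail_gap n x r : is_ray G r -> 0 < x < 1 -> f x = inr (endof G r) -> ev_in r (gap (T n) x).
Proof.
  intros Hr Hx E.
  destruct (list_dist p x (T n)) as [d [Hd A]].
  { intros t Ht C. destruct (pos_spec G f v0 t L) as [_ P]. unfold p in C. rewrite C in P. congruence. }
  destruct (simple_end_nbhd G f v0 x d r) as [S HS]; auto.
  eapply ev_in_mono; [|apply (comp_tail G S r (lf_sym _ OK) Hr)].
  intros v Hv t Ht. apply HS in Hv. destruct (A t Ht); unfold p in *; lra.
Qed.

Lemma gap_comp n x r S y : is_ray sparse r -> ev_in r (gap (T n) x) -> incl S (T n) ->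
  gap (T n) x y -> rcomp sparse S r y.
Proof.
  intros Hr He HS Hy. eapply ev_in_mono; [|exact He]. intros v Hv; cbv beta.
  eapply conn_mono; [intros ? ? Z; exact Z| |apply (gap_conn n x v y); auto].
  intros z Hz Hz'. apply (gap_notin _ _ _ Hz); auto.
Qed.

(** If the rays are equivalent in [G], they converge to the same point of the circle. The gap around
    it in a [T n] containing [S] avoids [S], is connected in [sparse] and contains tails of both. *)
Lemma sparse_equiv r1 r2 : is_ray sparse r1 -> is_ray sparse r2 ->
  ray_equiv sparse r1 r2 <-> ray_equiv G r1 r2.
Proof.
  intros H1 H2. assert (G1 := ray_sub _ G _ sparse_sub H1). assert (G2 := ray_sub _ G _ sparse_sub H2).
  assert (Hs := lf_sym _ OK). split.
  - rewrite (ray_equivE sparse), (ray_equivE G); auto using sparse_sym. intros A S.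
    destruct (A S) as [x [B C]]. exists x. split; apply (rcomp_sub sparse G); auto using sparse_sub.
  - intros A. destruct (ray_limit G f v0 r1 OK L G1) as [x [Hx E]].
    assert (E2 : f x = inr (endof G r2)) by (rewrite E; f_equal; apply endof_eq; auto).
    apply (ray_equivE sparse); auto using sparse_sym. intros S. destruct (Tfin S) as [n Hn].
    assert (K1 := tail_gap n x r1 G1 Hx E). assert (K2 := tail_gap n x r2 G2 Hx E2).
    destruct (ev_in_ex _ _ K1) as [i Hi']. exists (r1 i).
    split; eapply gap_comp; eauto.
Qed.

Lemma sparse_ray x r : is_ray G r -> 0 < x < 1 -> f x = inr (endof G r) ->
  exists r', is_ray sparse r' /\ f x = inr (endof G r').
Proof.
  intros Hr Hx E. assert (Hs := lf_sym _ OK).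
  destruct (nest_ray sparse (fun n => gap (T n) x)) as [r' [A [B C]]].
  - intros n v. apply gap_mono; auto.
  - intros n. destruct (ev_in_ex _ _ (tail_gap n x r Hr Hx E)); eauto.
  - intros v. destruct (Tall v) as [n Hn]. exists n. intros D. apply (gap_notin _ _ _ D); auto.
  - intros n u w. apply gap_conn.
  - exists r'. split; auto. rewrite E. f_equal. assert (Gr := ray_sub _ G _ sparse_sub A).
    apply endof_eq; auto. apply ray_equivE; auto. intros S. destruct (Tfin S) as [n Hn].
    assert (K := tail_gap n x r Hr Hx E). destruct (ev_in_ex _ _ K) as [i Hi']. exists (r i). split.
    + eapply ev_in_mono; [|exact K]. intros v Hv; cbv beta.
      eapply conn_mono; [exact sparse_sub| |apply (gap_conn n x v (r i)); auto].
      intros z Hz Hz'. apply (gap_notin _ _ _ Hz); auto.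
    + eapply rcomp_sub; [exact sparse_sub|]. eapply gap_comp; eauto.
Qed.

(** Vertices and inner points are encoded independently of the graph, so only ends change. An end of
    [G] is cut down to its rays in [sparse]; by [sparse_equiv] these form a single end as soon as
    there is one. *)
Definition lift_end (q : pt V) : pt V :=
  match q with inl a => inl a | inr A => inr (fun r => is_ray sparse r /\ A r) end.

Lemma lift_endof r : is_ray sparse r -> lift_end (inr (endof G r)) = inr (endof sparse r).
Proof.
  intros Hr. simpl. f_equal. apply functional_extensionality; intros q.
  apply propositional_extensionality. split.
  - intros [A [B C]]. split; auto. apply sparse_equiv; auto.
  - intros [A B]. split; auto. split; [apply (ray_sub sparse G); auto using sparse_sub|].
    apply sparse_equiv; auto.
Qed.

Lemma loop_cases x : 0 <= x <= 1 -> (exists v, f x = inl (vtx v)) \/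
  (exists u w s a b, a < x < b /\ sparse u w /\ 0 < s < 1 /\ f x = inl (ept u w s) /\
     edge_arc G f a b u w) \/
  (exists r, is_ray sparse r /\ f x = inr (endof G r)).
Proof.
  intros Hx. destruct (cplx_cases G (f x)) as [[v E]|[[u [w [s [A [B E]]]]]|[r [Hr E]]]].
  - apply L; auto.
  - left; eauto.
  - right; left. destruct (inner_arc G f v0 x u w HV OK L) as [a [b [Hab [Harc|Harc]]]]; eauto.
    + exists u, w, s, a, b. split; [lra|]. split; [left; exists a, b; auto|auto].
    + exists w, u, (1 - s), a, b. repeat split; auto; try lra; try apply Harc.
      left. exists a, b; auto. rewrite <- ept_swap; auto. eapply edge_neq; eauto.
  - right; right. apply sparse_ray with r; auto. eapply end_pos; eauto.
Qed.

Lemma lift_inl x a : lift_end (f x) = inl a <-> f x = inl a.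
Proof. destruct (f x); simpl; split; intros E; congruence. Qed.

Lemma sparse_loop : loop sparse (fun x => lift_end (f x)) v0.
Proof.
  split.
  - apply lift_inl, L.
  - apply lift_inl, L.
  - intros x Hx. destruct (loop_cases x Hx) as [[v E]|[[u [w [s [a [b [A [B [C [D _]]]]]]]]]|[r [Hr E]]]].
    + left. exists v. apply lift_inl; auto.
    + right; left. exists u, w, s. rewrite lift_inl. auto.
    + right; right. exists (endof sparse r). split; [apply endof_end; auto|]. rewrite E. apply lift_endof; auto.
  - intros x N Hx HN.
    destruct (loop_cases x Hx) as [[v E]|[[u [w [s [a [b [A [B [C [D _]]]]]]]]]|[r [Hr E]]]].
    + assert (E' : lift_end (f x) = inl (vtx v)) by (apply lift_inl; auto).
      rewrite E' in HN. apply bn_vtx in HN; [|exact sparse_ok]. destruct HN as [eps [He ->]].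
      destruct (lp_cont _ _ _ L x (star G v eps)) as [d [Hd K]]; [lra|rewrite E; apply bn_star; auto|].
      exists d. split; auto. intros y Hy Hxy. destruct (K y Hy Hxy) as [F|[w [t [F1 [F2 [F3 F4]]]]]].
      * left. apply lift_inl; auto.
      * right. exists w, t. split; [|split; [auto|split; [auto|apply lift_inl; auto]]].
        left. destruct (inner_arc G f v0 y v w HV OK L) as [a [b [_ Harc]]]; eauto.
        exists a, b; auto.
    + assert (E' : lift_end (f x) = inl (ept u w s)) by (apply lift_inl; auto).
      rewrite E' in HN. apply bn_ept in HN; auto; [|exact sparse_ok].
      destruct HN as [a' [b' [Ha' [Hb' NE]]]].
      destruct (lp_cont _ _ _ L x (seg u w a' b')) as [d [Hd K]]; [lra|rewrite D; apply bn_seg; try lra; apply sparse_sub; auto|].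
      exists d. split; auto. intros y Hy Hxy. apply NE. destruct (K y Hy Hxy) as [t [Ht F]].
      exists t. split; auto. apply lift_inl; auto.
    + rewrite E, lift_endof in HN; auto. apply bn_end in HN; auto; [|exact sparse_ok].
      destruct HN as [S ->]. assert (Gr := ray_sub _ G _ sparse_sub Hr).
      assert (Hx1 : 0 < x < 1) by (eapply end_pos; eauto).
      (* The interval chosen around [x] contains no position of [T n], so all vertices visited there
         lie in one gap, hence in the component of the end. *)
      destruct (Tfin S) as [n Hn].
      destruct (list_dist p x (T n)) as [d [Hd A]].
      { intros t Ht C. destruct (pos_spec G f v0 t L) as [_ P]. unfold p in C. rewrite C in P. congruence. }
      assert (K := tail_gap n x r Gr Hx1 E).
      assert (KV : forall y v, 0 <= y < 1 -> x - d < y < x + d -> f y = inl (vtx v) -> rcomp sparse S r v).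
      { intros y v Hy Hxy Ey. apply (gap_comp n x); auto. assert (Ep := pos_eq G f v0 v y L Hy Ey).
        fold p in Ep. intros t Ht. destruct (A t Ht); lra. }
      (* Staying below 1 excludes the second parameter of [v0], where parameter and position
         differ. *)
      exists (Rmin d (1 - x)). split; [apply Rmin_glb_lt; lra|].
      assert (M1 := Rmin_l d (1 - x)). assert (M2 := Rmin_r d (1 - x)).
      intros y Hy Hxy.
      destruct (loop_cases y Hy) as [[v Ey]|[[u [w [s [a [b [B1 [B2 [B3 [B4 B5]]]]]]]]]|[q [Hq Ey]]]].
      * assert (Ey' : lift_end (f y) = inl (vtx v)) by (apply lift_inl; auto).
        rewrite Ey'. apply end_nbhd_vtx; auto; [exact sparse_ok|]. apply (KV y); auto; lra.
      * assert (Ey' : lift_end (f y) = inl (ept u w s)) by (apply lift_inl; auto).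
        rewrite Ey'. apply end_nbhd_ept; auto; [exact sparse_ok|].
        (* An arc cannot contain [x] in its interior, so one of its end vertices lies between [x]
           and [y] and is covered by [KV]. *)
        assert (Hend : rcomp sparse S r u \/ rcomp sparse S r w).
        { destruct (Rle_dec x a); [left|right].
          - apply (KV a); try lra. apply B5.
          - assert (b <= x). { destruct (Rle_dec b x); auto. exfalso.
              apply (arc_no_end _ _ _ _ _ _ x (endof G r) B5); auto; lra. }
            apply (KV b); try lra. apply B5. }
        assert (Hnb : forall u w, sparse u w -> rcomp sparse S r u -> rcomp sparse S r w \/ In w S).
        { intros u' w' Hs Hc. destruct (classic (In w' S)); auto. left. eapply comp_edge; eauto. }
        split; auto. destruct Hend as [Hc|Hc].
        -- split; auto. eapply Hnb; eauto.
        -- split; auto. apply (Hnb w u); auto using sparse_sym.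
      * rewrite Ey, lift_endof; auto. apply end_nbhd_end; auto; [exact sparse_ok|].
        assert (Hy1 : 0 < y < 1) by (eapply end_pos; eauto).
        assert (Gq := ray_sub _ G _ sparse_sub Hq).
        eapply ev_in_mono; [|apply (tail_gap n y q Gq Hy1 Ey)]. intros v Hv.
        apply (gap_comp n x); auto. intros t Ht. destruct (A t Ht), (Hv t Ht); lra.
  - intros v. destruct (lp_ex _ _ _ L v) as [x [Hx E]]. exists x. rewrite lift_inl. auto.
  - intros v x y Hx Hy. rewrite !lift_inl. apply (lp_uniq _ _ _ L); auto.
Qed.

Lemma sparse_simple : simple (fun x => lift_end (f x)).
Proof.
  intros x y Hx Hy E. apply Hi; auto.
  destruct (f x) as [a|A] eqn:Ex; destruct (f y) as [b|B] eqn:Ey; try (simpl in E; congruence).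
  destruct (loop_cases x) as [[v F]|[[u [w [s [_ [_ [_ [_ [_ [F _]]]]]]]]]|[r [Hr F]]]]; try lra; try congruence.
  destruct (loop_cases y) as [[v F']|[[u [w [s [_ [_ [_ [_ [_ [F' _]]]]]]]]]|[q [Hq F']]]]; try lra; try congruence.
  rewrite <- Ex, <- Ey, F, F' in E |- *. rewrite !lift_endof in E; auto. injection E as E.
  apply endof_eq in E; auto using sparse_sym. f_equal. apply endof_eq.
  - apply OK.
  - apply (ray_sub sparse G); auto using sparse_sub.
  - apply (ray_sub sparse G); auto using sparse_sub.
  - apply sparse_equiv; auto.
Qed.

Lemma sparse_faithful : faithful V sparse G.
Proof.
  split.
  - intros A [r [Hr ->]]. destruct (ray_limit G f v0 r OK L Hr) as [x [Hx E]].
    destruct (sparse_ray x r Hr Hx E) as [r' [A B]]. exists r'. split; auto.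
    rewrite E in B. injection B as B. change (endof G r r'). rewrite B. apply endof_self; [apply OK|].
    apply (ray_sub sparse G); auto using sparse_sub.
  - intros r1 r2 H1 H2. apply sparse_equiv; auto.
Qed.

Lemma sparse_degree A : is_end V sparse A -> end_degree_eq V A 2.
Proof.
  intros [r [Hr ->]]. change (fun r' => is_ray sparse r' /\ ray_equiv sparse r r') with (endof sparse r).
  split.
  - exact (two_rays sparse _ v0 r HV sparse_ok sparse_loop sparse_simple Hr).
  - intros [rs [H1 H2]]. assert (Gr := ray_sub _ G _ sparse_sub Hr).
    destruct (ray_limit G f v0 r OK L Gr) as [x [Hx E]].
    (* With the three starting vertices in [T n], each ray begins outside the gap around [x], so its
       first vertex inside the gap is extreme. Two of three such vertices are extreme on the same
       side and hence equal. *)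
    destruct (Tfin (rs 0%nat 0%nat :: rs 1%nat 0%nat :: rs 2%nat 0%nat :: nil)) as [n Hn].
    assert (K : forall i, (i < 3)%nat -> exists m, gap (T n) x (rs i m) /\ extreme n x (rs i m)).
    { intros i Hi'. destruct (H1 i Hi') as [Ri Ei].
      assert (Gi := ray_sub _ G _ sparse_sub Ri).
      assert (Fi : f x = inr (endof G (rs i))).
      { rewrite E. f_equal. apply endof_eq; auto; [apply OK|]. apply sparse_equiv; auto. }
      destruct (nat_least (fun m => gap (T n) x (rs i m)) (ev_in_ex _ _ (tail_gap n x _ Gi Hx Fi)))
        as [m [M1 M2]].
      exists m. split; auto. destruct m as [|m].
      - exfalso. apply (gap_notin _ _ _ M1), Hn. destruct i as [|[|[|i]]]; simpl; auto; lia.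
      - apply (gap_exit n x _ (rs i m)); auto.
        + intros C. apply M2 in C. lia.
        + apply sparse_sym, Ri. }
    assert (D : forall i j a b, (i < 3)%nat -> (j < 3)%nat -> i <> j -> p (rs i a) = p (rs j b) -> False).
    { intros i j a b Hi' Hj Hij C. apply (H2 i j Hi' Hj Hij a b). apply (pos_inj G f v0); auto. }
    destruct (K 0%nat) as [a [A1 A2]]; [lia|]. destruct (K 1%nat) as [b [B1 B2]]; [lia|].
    destruct (K 2%nat) as [c [C1 C2]]; [lia|].
    assert (D1 := D 0%nat 1%nat a b). assert (D2 := D 0%nat 2%nat a c). assert (D3 := D 1%nat 2%nat b c).
    destruct A2 as [A2|A2], B2 as [B2|B2], C2 as [C2|C2];
      assert (Aa := A2 _ A1); assert (Ab := A2 _ B1); assert (Ac := A2 _ C1);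
      assert (Ba := B2 _ A1); assert (Bb := B2 _ B1); assert (Bc := B2 _ C1);
      assert (Ca := C2 _ A1); assert (Cb := C2 _ B1); assert (Cc := C2 _ C1);
      solve [apply D1; try lia; lra | apply D2; try lia; lra | apply D3; try lia; lra].
Qed.

End CircleToSubgraph.

Lemma circle_subgraph {V : Type} (G : V -> V -> Prop) (v0 : V) :
  infinite_vertices V -> lf_graph G -> ham_circle V G ->
  exists F : V -> V -> Prop, spanning_subgraph V F G /\ faithful V F G /\ ham_curve V F /\
    forall A, is_end V F A -> end_degree_eq V A 2.
Proof.
  intros HV OK HC. destruct (ham_circle_loop G v0 OK HC) as [f [L Hi]].
  destruct (gap_sequence G f v0 OK L Hi) as [T [T0 [T1 [T2 [T3 T4]]]]].
  exists (sparse G f T). split; [|split; [|split]].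
  - split; [apply sparse_sym|apply sparse_sub]; auto.
  - apply (sparse_faithful G f v0); auto.
  - eapply loop_curve. apply (sparse_loop G f v0); auto.
  - apply (sparse_degree G f v0); auto.
Qed.

(** * Separators of ends *)

Lemma list_partition {X : Type} (D : X -> Prop) (l : list X) : NoDup l ->
  exists l1 l2, NoDup l1 /\ NoDup l2 /\ (forall x, In x l1 <-> In x l /\ D x) /\
    (forall x, In x l2 <-> In x l /\ ~ D x) /\ (length l1 + length l2 = length l)%nat.
Proof.
  induction 1 as [|a l Ha Hl [l1 [l2 [A [B [C [D' E]]]]]]].
  - exists nil, nil. repeat split; try constructor; simpl; tauto.
  - destruct (classic (D a)) as [HD|HD].
    + exists (a :: l1), l2. split; [constructor; auto; rewrite C; tauto|]. split; auto.
      split; [|split]; [| |simpl; lia]; intros x; simpl; rewrite ?C, ?D'; split; intros K;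
        try (destruct K as [[->|K] K2] || destruct K as [->|K]); try tauto; subst; tauto.
    + exists l1, (a :: l2). split; auto. split; [constructor; auto; rewrite D'; tauto|].
      split; [|split]; [| |simpl; lia]; intros x; simpl; rewrite ?C, ?D'; split; intros K;
        try (destruct K as [[->|K] K2] || destruct K as [->|K]); try tauto; subst; tauto.
Qed.

Lemma list_nodup {X : Type} (l : list X) :
  exists l', NoDup l' /\ (forall x, In x l' <-> In x l) /\ (length l' <= length l)%nat.
Proof.
  induction l as [|a l [l' [A [B C]]]]; [exists nil; repeat split; auto; constructor|].
  destruct (classic (In a l)) as [Ha|Ha].
  - exists l'. split; auto. split; [|simpl; lia]. intros x; simpl; rewrite B.
    split; [tauto|intros [<-|]; auto].
  - exists (a :: l'). split; [constructor; auto; rewrite B; auto|]. split; [|simpl; lia].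
    intros x; simpl; rewrite B; tauto.
Qed.

(** Hall's marriage theorem, with the neighbourhood of [U] replaced by an arbitrary list [N] covering it. *)
Lemma hall {X Y : Type} (d : X -> Y) (n : nat) : forall (R : X -> Y -> Prop) (L : list X),
  (length L <= n)%nat -> NoDup L ->
  (forall U N, NoDup U -> incl U L -> (forall x y, In x U -> R x y -> In y N) ->
     (length U <= length N)%nat) ->
  exists phi : X -> Y, (forall x, In x L -> R x (phi x)) /\
    (forall x x', In x L -> In x' L -> phi x = phi x' -> x = x').
Proof.
  induction n as [|n IH]; intros R L Hn HL Hall.
  { destruct L; [|simpl in Hn; lia]. exists d; split; [intros ? []|intros ? ? []]. }
  destruct L as [|x L]; [exists d; split; [intros ? []|intros ? ? []]|].
  inversion HL as [|? ? Hx HL']; subst.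
  (* The dichotomy of Halmos and Vaughan: a tight proper subset is matched separately from the rest;
     without one, every nonempty proper subset has a surplus, and [x] may be matched to any
     partner. *)
  destruct (classic (exists U N, NoDup U /\ U <> nil /\ incl U (x :: L) /\ (length U < S (length L))%nat /\
    (forall a b, In a U -> R a b -> In b N) /\ (length N <= length U)%nat)) as [Tight|Loose].
  - destruct Tight as [U [N [HU [Hne [HUL [HlU [HN HNU]]]]]]].
    destruct (IH R U) as [phi1 [A1 A2]]; auto.
    { simpl in Hn; lia. }
    { intros W M HW HWU. apply Hall; auto. eapply incl_tran; eauto. }
    destruct (list_partition (fun a => In a U) (x :: L) HL) as [L1 [L2 [B1 [B2 [B3 [B4 B5]]]]]].
    assert (HL1 : (length U <= length L1)%nat).
    { apply NoDup_incl_length; auto. intros a Ha. apply B3; auto. }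
    assert (HU1 : (1 <= length U)%nat) by (destruct U; [congruence|simpl; lia]).
    destruct (IH (fun a b => R a b /\ ~ In b N) L2) as [phi2 [C1 C2]]; auto.
    { simpl in B5, Hn. lia. }
    { intros W M HW HWL HM.
      assert (K : (length (U ++ W) <= length (N ++ M))%nat).
      { apply Hall.
        - apply NoDup_app; auto. intros a Ha Ha'. apply HWL, B4 in Ha'. tauto.
        - apply incl_app; auto. intros a Ha. apply HWL, B4 in Ha. tauto.
        - intros a b Ha Hab. apply in_or_app. apply in_app_or in Ha. destruct (classic (In b N)); auto.
          destruct Ha as [Ha|Ha]; [left; eauto|right; eauto]. }
      rewrite !length_app in K. lia. }
    exists (fun a => if excluded_middle_informative (In a U) then phi1 a else phi2 a). split.
    + intros a Ha. destruct (excluded_middle_informative (In a U)); auto. apply C1, B4; auto.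
    + intros a b Ha Hb.
      destruct (excluded_middle_informative (In a U)) as [Ka|Ka];
      destruct (excluded_middle_informative (In b U)) as [Kb|Kb]; intros E; auto.
      * exfalso. assert (K : In b L2) by (apply B4; auto). apply C1 in K. apply (proj2 K).
        rewrite <- E. eapply HN; eauto.
      * exfalso. assert (K : In a L2) by (apply B4; auto). apply C1 in K. apply (proj2 K).
        rewrite E. eapply HN; eauto.
      * apply C2; auto; apply B4; auto.
  - assert (Hy : exists y, R x y).
    { apply NNPP; intros C. assert (K : (length (x :: nil) <= @length Y nil)%nat).
      { apply Hall; [constructor; [intros []|constructor]|intros a [<-|[]]; left; auto|].
        intros a b [<-|[]] Hab. apply C; eauto. }
      simpl in K; lia. }
    destruct Hy as [y Hy].
    destruct (IH (fun a b => R a b /\ b <> y) L) as [phi [A1 A2]]; auto.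
    { simpl in Hn; lia. }
    { intros U N HU HUL HN. destruct (Nat.le_gt_cases (length U) (length N)) as [|Hgt]; auto.
      exfalso. apply Loose. exists U, (y :: N). split; auto. split; [intros ->; simpl in Hgt; lia|].
      split; [apply incl_tl; auto|]. assert (K := NoDup_incl_length HU HUL).
      split; [lia|]. split; [|simpl; lia].
      intros a b Ha Hab. simpl. destruct (classic (b = y)); auto. right. eapply HN; eauto. }
    exists (fun a => if excluded_middle_informative (a = x) then y else phi a). split.
    + intros a Ha. destruct (excluded_middle_informative (a = x)) as [->|Ka]; auto.
      apply A1. destruct Ha; congruence.
    + intros a b Ha Hb.
      destruct (excluded_middle_informative (a = x)) as [Ka|Ka];
      destruct (excluded_middle_informative (b = x)) as [Kb|Kb]; intros E; try congruence.
      * exfalso. assert (K : In b L) by (destruct Hb; congruence). apply A1 in K. apply (proj2 K); auto.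
      * exfalso. assert (K : In a L) by (destruct Ha; congruence). apply A1 in K. apply (proj2 K); auto.
      * apply A2; auto; [destruct Ha|destruct Hb]; congruence.
Qed.

(** * Menger's theorem via Hall's theorem *)

Section Menger.
Context {V : Type}.
Implicit Types (H : V -> V -> Prop) (A B S W : list V) (phi : V -> V).

(** [track phi A B v]: iterating [phi] from some vertex of [A] reaches [v] before meeting [B].
    A linkage encodes disjoint A-B paths, one from each vertex of [A], by the successor function [phi]. *)
Definition track phi A B (v : V) : Prop :=
  exists a i, In a A /\ v = Nat.iter i phi a /\ forall j, (j <= i)%nat -> ~ In (Nat.iter j phi a) B.

Definition linkage H phi A B : Prop :=
  (forall v, track phi A B v -> H v (phi v) /\ ~ In (phi v) A) /\
  (forall v w, track phi A B v -> track phi A B w -> phi v = phi w -> v = w) /\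
  (forall a, In a A -> exists i, In (Nat.iter i phi a) B).

(** By injectivity two orbits that meet can be traced back in step. Since [phi] never leads into
    [A], both reach their starting points at the same time. *)
Lemma orbits_disjoint (P : V -> Prop) phi A :
  (forall v, P v -> ~ In (phi v) A) -> (forall v w, P v -> P w -> phi v = phi w -> v = w) ->
  forall i j a b, In a A -> In b A ->
  (forall k, (k < i)%nat -> P (Nat.iter k phi a)) -> (forall k, (k < j)%nat -> P (Nat.iter k phi b)) ->
  Nat.iter i phi a = Nat.iter j phi b -> i = j /\ a = b.
Proof.
  intros HA Hinj. induction i as [|i IH]; intros [|j] a b Ha Hb Pa Pb E; auto.
  - exfalso. simpl in E. apply (HA (Nat.iter j phi b)); [apply Pb; lia|]. rewrite <- E; auto.
  - exfalso. simpl in E. apply (HA (Nat.iter i phi a)); [apply Pa; lia|]. rewrite E; auto.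
  - simpl in E. apply Hinj in E; [|apply Pa; lia|apply Pb; lia].
    destruct (IH j a b Ha Hb) as [-> ->]; auto.
Qed.

(** The vertices of [W] outside [B] are to be matched with the vertices of [W] outside [A]. A
    matching is a successor function whose orbits from [A] are disjoint and, the set being finite,
    must run into [B]; a set violating Hall's condition yields a small separator. *)
Lemma menger_finite H A B W : (forall v, ~ H v v) -> NoDup A -> incl A W ->
  (forall v, In v A -> ~ In v B) ->
  (exists S, (length S < length A)%nat /\ forall a b, In a A -> In b B ->
     ~ conn H (fun v => In v W /\ avoid S v) a b) \/
  exists phi, linkage H phi A B.
Proof.
  intros Hirr HA HAW HAB.
  destruct (list_nodup W) as [W' [HW1 [HW2 _]]].
  destruct (list_partition (fun v => In v B) W' HW1) as [_ [L [_ [HL [_ [HLW _]]]]]].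
  (* Allowing a vertex to be matched with itself takes care of the vertices on no path. *)
  set (R := fun v w => (w = v \/ H v w) /\ ~ In w A /\ In w W).
  destruct (classic (forall U N, NoDup U -> incl U L -> (forall x y, In x U -> R x y -> In y N) ->
     (length U <= length N)%nat)) as [Hall|Hnot].
  - right. destruct (hall (fun v => v) (length L) R L (le_n _) HL Hall) as [phi [P1 P2]].
    assert (HLin : forall v, In v L <-> In v W /\ ~ In v B) by (intros v; rewrite HLW, HW2; tauto).
    assert (Orb : forall a i, In a A -> (forall j, (j <= i)%nat -> ~ In (Nat.iter j phi a) B) ->
       In (Nat.iter i phi a) L).
    { intros a i Ha. induction i as [|i IHi]; intros Hj.
      - apply HLin. split; auto. 
      - apply HLin. split; [|apply Hj; auto]. apply (P1 (Nat.iter i phi a)). apply IHi. auto. }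
    assert (TL : forall v, track phi A B v -> In v L) by (intros v [a [i [Ha [-> Hj]]]]; auto).
    exists phi. split; [|split].
    (* A fixed point on an orbit would be reached after i and after i+1 steps, contrary to
       [orbits_disjoint]. *)
    + intros v Hv. assert (Hv' := TL v Hv). destruct (P1 v Hv') as [[E|E] [F _]]; auto. exfalso.
      destruct Hv as [a [i [Ha [-> Hj]]]].
      destruct (orbits_disjoint (fun v => In v L) phi A) with (i := S i) (j := i) (a := a) (b := a)
        as [C _]; auto; try lia.
      * intros v Hv. apply P1; auto.
      * intros k Hk. apply Orb; auto. intros j Hjk. apply Hj; lia.
      * intros k Hk. apply Orb; auto. intros j Hjk. apply Hj; lia.
    + intros v w Hv Hw. apply P2; auto.
    + intros a Ha. apply NNPP; intros Hn.
      assert (All : forall i, In (Nat.iter i phi a) L).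
      { intros i. apply Orb; auto. intros j _ C. apply Hn; eauto. }
      assert (K : (length (map (fun i => Nat.iter i phi a) (seq 0 (S (length L)))) <= length L)%nat).
      { apply NoDup_incl_length.
        - apply NoDup_map_NoDup_ForallPairs; [|apply seq_NoDup].
          intros i j _ _ E.
          destruct (orbits_disjoint (fun v => In v L) phi A) with (i := i) (j := j) (a := a) (b := a)
            as [C _]; auto. intros v Hv. apply P1; auto.
        - intros v Hv. apply in_map_iff in Hv. destruct Hv as [i [<- _]]; auto. }
      rewrite length_map, length_seq in K. lia.
  - left. apply not_all_ex_not in Hnot. destruct Hnot as [U Hnot].
    apply not_all_ex_not in Hnot. destruct Hnot as [N0 Hnot].
    assert (HU : NoDup U) by tauto. assert (HUL : incl U L) by tauto.
    assert (HN0 : forall x y, In x U -> R x y -> In y N0) by tauto.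
    assert (Hlt : (length N0 < length U)%nat) by (apply Nat.nle_gt; tauto). clear Hnot.
    destruct (list_nodup N0) as [N [HN1 [HN2 HN3]]].
    destruct (list_partition (fun v => In v U) A HA) as [A1 [A2 [_ [_ [HA1 [HA2 HA3]]]]]].
    destruct (list_partition (fun v => In v U) N HN1) as [N1 [N2 [_ [_ [HN4 [HN5 HN6]]]]]].
    destruct (list_partition (fun v => In v A) U HU) as [U1 [U2 [HU1 [HU2 [HU3 [HU4 HU5]]]]]].
    assert (K1 : (length U1 <= length A1)%nat).
    { apply NoDup_incl_length; auto. intros v Hv. apply HU3 in Hv. apply HA1. tauto. }
    assert (K2 : (length U2 <= length N1)%nat).
    { apply NoDup_incl_length; auto. intros v Hv. apply HU4 in Hv. apply HN4. split; [|tauto].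
      apply HN2. apply (HN0 v v); [tauto|]. split; auto. split; [tauto|].
      apply HW2. apply HLW. apply HUL; tauto. }
    (* The separator consists of the part of [A] outside [U] and the neighbours of [U] outside [U].
       Vertices of [U] outside [A] are their own neighbours, so the deficit of [N] shows that [N2]
       is smaller than the part of [A] inside [U]. *)
    exists (A2 ++ N2). split; [rewrite length_app; lia|].
    intros a b Ha Hb Hc.
    assert (HaU : In a U).
    { apply NNPP; intros C. apply conn_dom_l in Hc. apply (proj2 Hc). apply in_or_app; left.
      apply HA2; auto. }
    assert (HbU : ~ In b U).
    { intros C. apply HUL, HLW in C. tauto. }
    destruct (conn_exit _ _ _ _ (fun v => In v U) Hc HaU HbU) as [u [w [C1 [C2 [C3 [C4 _]]]]]].
    apply conn_dom_r in C1. apply (proj2 C4). apply in_or_app.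
    destruct (classic (In w A)) as [Hw|Hw]; [left; apply HA2; auto|right].
    apply HN5. split; auto. apply HN2. apply (HN0 u w); [tauto|]. split; auto. tauto.
Qed.

Lemma list_collect {X Y : Type} (Q : X -> list Y -> Prop) (l : list X) :
  (forall x (W W' : list Y), incl W W' -> Q x W -> Q x W') -> (forall x, In x l -> exists W : list Y, Q x W) ->
  exists W : list Y, forall x, In x l -> Q x W.
Proof.
  intros Hm. induction l as [|a l IH]; intros Hl; [exists nil; intros ? []|].
  destruct IH as [W HW]; [intros; apply Hl; right; auto|].
  destruct (Hl a) as [W1 HW1]; [left; auto|]. exists (W1 ++ W). intros x [<-|Hx].
  - eapply Hm; [|exact HW1]. apply incl_appl, incl_refl.
  - eapply Hm; [|apply HW; auto]. apply incl_appr, incl_refl.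
Qed.

Definition separates H A B S (D : V -> Prop) : Prop :=
  forall a b, In a A -> In b B -> ~ conn H (fun v => D v /\ avoid S v) a b.

(** Compactness: a set [Z] contained in small separators of arbitrarily large finite subgraphs is enlarged
    until it separates in the whole graph. *)
Lemma separator_limit H A B k m : forall Z, NoDup Z -> (length Z + m = k)%nat ->
  (forall W, exists W' S, incl W W' /\ incl Z S /\ (length S < k)%nat /\
     separates H A B S (fun v => In v W')) ->
  exists S, (length S < k)%nat /\ separates H A B S (fun _ => True).
Proof.
  induction m as [|m IH]; intros Z HZ Hk Hcof.
  - exfalso. destruct (Hcof nil) as [W' [S [_ [HS [Hl _]]]]].
    assert (K := NoDup_incl_length HZ HS). lia.
  - destruct (classic (separates H A B Z (fun _ => True))) as [Hsep|Hn]; [exists Z; split; auto; lia|].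
    unfold separates in Hn.
    apply not_all_ex_not in Hn. destruct Hn as [a Hn]. apply not_all_ex_not in Hn. destruct Hn as [b Hn].
    assert (Ha : In a A) by tauto. assert (Hb : In b B) by tauto.
    assert (Hc : conn H (fun v => True /\ avoid Z v) a b) by (apply NNPP; tauto).
    destruct (conn_support _ _ _ _ Hc) as [l [L1 [L2 _]]].
    (* Every separator of a subgraph containing the walk meets its finite support [l], so one vertex
       of [l] lies in separators of arbitrarily large subgraphs. If not, the finitely many bounds
       witnessing failure are collected into one [W], a contradiction. *)
    destruct (classic (exists p, In p l /\ forall W, exists W' S, incl W W' /\ incl (p :: Z) S /\
       (length S < k)%nat /\ separates H A B S (fun v => In v W'))) as [[p [Hp Hp']]|Hno].
    + apply (IH (p :: Z)); auto; [|simpl; lia]. constructor; auto. apply L1; auto.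
    + exfalso.
      destruct (list_collect (fun p W => forall W' S, incl W W' -> incl (p :: Z) S -> (length S < k)%nat ->
        ~ separates H A B S (fun v => In v W')) l) as [W HW].
      { intros x W W' Hi HQ W'' S Hi' . apply HQ. eapply incl_tran; eauto. }
      { intros p Hp. apply NNPP; intros C. apply Hno. exists p. split; auto. intros W.
        apply NNPP; intros C'. apply C. exists W. intros W' S D1 D2 D3 D4. apply C'. eauto 8. }
      destruct (Hcof (l ++ W)) as [W' [S [D1 [D2 [D3 D4]]]]].
      assert (Hhit : exists p, In p l /\ In p S).
      { apply NNPP; intros C. apply (D4 a b Ha Hb).
        eapply conn_mono; [intros ? ? Z'; exact Z'| |exact L2]. intros v Hv; cbv beta in Hv. split.
        - apply D1, in_or_app; auto.
        - intros Hv'. apply C; eauto. }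
      destruct Hhit as [p [Hp1 Hp2]].
      apply (HW p Hp1 W' S); auto.
      * intros v Hv. apply D1, in_or_app; auto.
      * apply incl_cons; auto.
Qed.

Lemma menger H A B : (forall v, ~ H v v) -> NoDup A -> (forall v, In v A -> ~ In v B) ->
  (exists S, (length S < length A)%nat /\ separates H A B S (fun _ => True)) \/
  exists phi, linkage H phi A B.
Proof.
  intros Hirr HA HAB. destruct (classic (exists phi, linkage H phi A B)) as [|Hn]; auto. left.
  apply (separator_limit H A B _ (length A) nil); [constructor|auto|].
  intros W. destruct (menger_finite H A B (A ++ W)) as [[S [S1 S2]]|C]; auto.
  - apply incl_appl, incl_refl.
  - exists (A ++ W), S. split; [apply incl_appr, incl_refl|]. split; [intros ? []|]. auto.
  - contradiction.
Qed.

(** * Disjoint rays from large separators of an end *)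

Section EndSeparators.
Variables (H : V -> V -> Prop) (r : nat -> V) (Bs : nat -> list V).
Hypotheses (OK : lf_graph H) (Hr : is_ray H r) (Bs_incl : forall n, incl (Bs n) (Bs (n + 1)%nat))
  (Bs_all : forall v, exists n, In v (Bs n)).

(** [S] separates [X] from the end of [r]; vertices of [X] lying in [S] count as separated. *)
Definition far (X S : list V) : Prop := forall x, In x X -> ~ rcomp H S r x.

Lemma min_far X : exists S, far X S /\ NoDup S /\ forall S', far X S' -> (length S <= length S')%nat.
Proof.
  destruct (nat_least (fun n => exists S, far X S /\ length S = n)) as [n [[S [A B]] C]].
  { exists (length X), X. split; auto. intros x Hx Hc. apply (comp_avoid _ _ _ _ Hc); auto. }
  destruct (list_nodup S) as [S' [D1 [D2 D3]]]. exists S'. split; [|split; auto].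
  - intros x Hx Hc. apply (A x Hx). eapply comp_mono; [|exact Hc]. intros v; apply D2.
  - intros S'' HS''. assert (n <= length S'')%nat by (apply C; eauto). lia.
Qed.

Variables (k : nat) (X : list V).
Hypothesis (Hbig : forall S, far X S -> (k < length S)%nat).

(** Because the separators [Sq n] are of minimum size, fewer vertices cannot separate [Sq n] from
    [Sq (S n)], and Menger's theorem links all of [Sq n] into [Sq (S n)]. Linkages of different
    levels occupy disjoint shells between consecutive separators, so they join to one ray from each
    vertex of [Sq O], and these rays converge to the end. *)
Lemma rays_of_large_separators : has_disjoint_rays (endof H r) (S k).
Proof.
  assert (Hs := lf_sym _ OK).
  destruct (neighbours H (lf_fin _ OK)) as [nb Hnb].
  set (msep := fun Y => proj1_sig (constructive_indefinite_description _ (min_far Y))).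
  assert (Hmsep : forall Y, far Y (msep Y) /\ NoDup (msep Y) /\
     forall S', far Y S' -> (length (msep Y) <= length S')%nat).
  { intros Y. exact (proj2_sig (constructive_indefinite_description _ (min_far Y))). }
  (* Separating [Bs n] as well drives the separators towards the end; including [Y] and its
     neighbours puts the next separator strictly inside the component cut off by [Y]. *)
  set (nxt := fun n Y => X ++ Bs n ++ Y ++ flat_map nb Y).
  set (Sq := fix Sq n := match n with O => msep X | S n => msep (nxt n (Sq n)) end).
  set (Xq := fun n => match n with O => X | S n => nxt n (Sq n) end).
  assert (HSq : forall n, Sq n = msep (Xq n)) by (intros [|n]; reflexivity).
  set (C := fun n => rcomp H (Sq n) r).
  assert (S_far : forall n, far (Xq n) (Sq n)) by (intros n; rewrite HSq; apply Hmsep).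
  assert (S_min : forall n S', far (Xq n) S' -> (length (Sq n) <= length S')%nat)
    by (intros n; rewrite HSq; apply Hmsep).
  assert (S_nd : forall n, NoDup (Sq n)) by (intros n; rewrite HSq; apply Hmsep).
  assert (B_out : forall n v, In v (Bs n) -> ~ C (S n) v).
  { intros n v Hv. apply (S_far (S n)). simpl. apply in_or_app; right. apply in_or_app; auto. }
  assert (S_out : forall n v, In v (Sq n) -> ~ C (S n) v).
  { intros n v Hv. apply (S_far (S n)). simpl. unfold nxt. rewrite !in_app_iff; auto. }
  assert (N_out : forall n u v, In u (Sq n) -> H u v -> ~ C (S n) v).
  { intros n u v Hu Huv. apply (S_far (S n)). simpl. unfold nxt. rewrite !in_app_iff.
    right; right; right. apply in_flat_map; eauto. }
  assert (C_dec : forall n v, C (S n) v -> C n v).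
  { intros n v Hv. eapply ev_in_mono; [|apply (comp_tail H (Sq (S n)) r Hs Hr)].
    intros u Hu; cbv beta. eapply conn_mono; [intros ? ? Z; exact Z| |apply (comp_conn H (Sq (S n)) r); auto].
    intros z Hz Hz'. apply (S_out n z); auto. }
  assert (C_dec' : forall m n v, (n <= m)%nat -> C m v -> C n v).
  { induction 1; auto. }
  (* If [s] had no neighbour in the component, the other vertices of [Sq n] would still separate,
     contrary to minimality. *)
  assert (S_nbr : forall n s, In s (Sq n) -> exists u, C n u /\ H u s).
  { intros n s Hsn. destruct (list_partition (fun v => v = s) (Sq n) (S_nd n)) as [P [Q [_ [_ [P1 [Q1 E]]]]]].
    assert (P0 : (1 <= length P)%nat).
    { destruct P as [|p P]; [exfalso; apply (proj2 (P1 s)); auto|simpl; lia]. }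
    assert (Hnf : ~ far (Xq n) Q) by (intros F; apply S_min in F; lia).
    apply not_all_ex_not in Hnf. destruct Hnf as [x Hx].
    assert (Hx1 : In x (Xq n)) by tauto. assert (Hx2 : rcomp H Q r x) by tauto.
    destruct (ev_in_ex _ _ (ev_in_and _ _ _ Hx2 (comp_tail H (Sq n) r Hs Hr))) as [i [I1 I2]].
    destruct (conn_exit _ _ _ _ (C n) I1 I2 (S_far n x Hx1)) as [u [w [D1 [D2 [D3 [D4 _]]]]]].
    apply conn_dom_r in D1. exists u. split; [tauto|].
    destruct (classic (w = s)) as [<-|Hws]; auto. exfalso. apply D3.
    apply (comp_edge H (Sq n) r u w); auto; [tauto|]. intros Hw. apply D4. apply Q1; auto. }
  assert (S_in : forall n s, In s (Sq (S n)) -> C n s).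
  { intros n s Hsn. destruct (S_nbr _ _ Hsn) as [u [U1 U2]].
    apply (comp_edge H (Sq n) r u s); auto; [apply C_dec; auto|].
    intros Hs'. apply (N_out n s u); auto. }
  assert (S_disj : forall n v, In v (Sq n) -> ~ In v (Sq (S n))).
  { intros n v Hv Hv'. apply S_in in Hv'. apply (comp_avoid _ _ _ _ Hv'); auto. }
  (* A walk from a tail of [r] to [Xq n] passes [Sq (S n)] and later [Sq n]. So a set separating
     these two also separates [Xq n] from the end and cannot be smaller than [Sq n]. *)
  assert (Link : forall n, exists phi, linkage H phi (Sq n) (Sq (S n))).
  { intros n. destruct (menger H (Sq n) (Sq (S n)) (lf_irr _ OK) (S_nd n) (S_disj n)) as [[Z [Z1 Z2]]|]; auto.
    exfalso. assert (Hnf : ~ far (Xq n) Z) by (intros F; apply S_min in F; lia).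
    apply not_all_ex_not in Hnf. destruct Hnf as [x Hx].
    assert (Hx1 : In x (Xq n)) by tauto. assert (Hx2 : rcomp H Z r x) by tauto.
    destruct (ev_in_ex _ _ (ev_in_and _ _ _ Hx2 (comp_tail H (Sq (S n)) r Hs Hr))) as [i [I1 I2]].
    destruct (conn_exit _ _ _ _ (C n) I1 (C_dec _ _ I2) (S_far n x Hx1)) as [u [w [D1 [D2 [D3 [D4 _]]]]]].
    assert (Hw : In w (Sq n)).
    { apply NNPP; intros E. apply D3. apply conn_dom_r in D1. apply (comp_edge H (Sq n) r u w); auto; tauto. }
    assert (Dw : conn H (avoid Z) (r i) w).
    { apply conn_trans with u; [|apply conn_edge; auto; apply conn_dom_r in D1; tauto].
      eapply conn_mono; [intros ? ? Y; exact Y| |exact D1]. intros v; tauto. }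
    destruct (conn_exit _ _ _ _ (C (S n)) Dw I2 (S_out n w Hw)) as [u' [w' [E1 [E2 [E3 [E4 E5]]]]]].
    assert (Hw' : In w' (Sq (S n))).
    { apply NNPP; intros E. apply E3. apply conn_dom_r in E1. apply (comp_edge H (Sq (S n)) r u' w'); auto; tauto. }
    apply (Z2 w w' Hw Hw'). apply conn_sym; auto.
    eapply conn_mono; [intros ? ? Y; exact Y| |exact E5]. auto. }
  set (phi := fun n => proj1_sig (constructive_indefinite_description _ (Link n))).
  assert (Hphi : forall n, linkage H (phi n) (Sq n) (Sq (S n))).
  { intros n. exact (proj2_sig (constructive_indefinite_description _ (Link n))). }
  set (P := fun n => track (phi n) (Sq n) (Sq (S n))).
  assert (P_end : forall n v, P n v -> ~ In v (Sq (S n))).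
  { intros n v [a [i [Ha [-> Hj]]]]. apply Hj; auto. }
  assert (P_reach : forall n v, P n v -> exists j, In (Nat.iter j (phi n) v) (Sq (S n))).
  { intros n v [a [i [Ha [-> Hj]]]]. destruct (Hphi n) as [_ [_ T]]. destruct (T a Ha) as [m Hm].
    assert (i < m)%nat. { destruct (Nat.le_gt_cases m i); auto. exfalso; apply (Hj m); auto. }
    exists (m - i)%nat. rewrite <- Nat.iter_add. replace (m - i + i)%nat with m by lia. auto. }
  assert (P_next : forall n v, P n v -> In (phi n v) (Sq (S n)) \/ P n (phi n v)).
  { intros n v [a [i [Ha [-> Hj]]]]. destruct (classic (In (phi n (Nat.iter i (phi n) a)) (Sq (S n)))); auto.
    right. exists a, (S i). split; auto. split; auto. intros j Hji.
    destruct (Nat.eq_dec j (S i)) as [->|]; auto. apply Hj; lia. }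
  assert (P_img : forall n v, P n v -> C n (phi n v)).
  { intros n. assert (K : forall j v, P n v -> In (Nat.iter j (phi n) v) (Sq (S n)) -> C n (phi n v)).
    { induction j as [|j IHj]; intros v Hv Hin; [exfalso; exact (P_end n v Hv Hin)|].
      destruct (P_next n v Hv) as [D|D]; [auto|].
      rewrite Nat.iter_succ_r in Hin. apply IHj in Hin; auto. destruct (Hphi n) as [T1 _].
      apply (comp_edge H (Sq n) r (phi n (phi n v))); auto; [apply Hs, (T1 (phi n v) D)|apply (T1 v Hv)]. }
    intros v Hv. destruct (P_reach n v Hv) as [j Hj]. eauto. }
  assert (P_out : forall n v, P n v -> ~ C (S n) v).
  { intros n v [a [i [Ha [-> Hj]]]]. induction i as [|i IHi]; [apply S_out; auto|].
    intros Hc. apply IHi; [intros; apply Hj; lia|]. destruct (Hphi n) as [T1 _].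
    apply (comp_edge H (Sq (S n)) r (Nat.iter (S i) (phi n) a)); auto.
    apply Hs. apply T1. exists a, i. split; auto. }
  assert (img_out : forall n v, P n v -> ~ C (S n) (phi n v)).
  { intros n v Hv. destruct (P_next n v Hv) as [D|D]; auto.
    intros Hc. apply (comp_avoid _ _ _ _ Hc); auto. }
  assert (P_in : forall n v, P n v -> In v (Sq n) \/ C n v).
  { intros n v [a [[|i] [Ha [-> Hj]]]]; auto. right. apply (P_img n (Nat.iter i (phi n) a)).
    exists a, i. split; auto. }
  assert (P_in' : forall n v, P (S n) v -> C n v).
  { intros n v Hv. destruct (P_in _ _ Hv); auto. }
  (* Vertices used at level [n] lie outside the component of the next separator, those used at later
     levels inside it or on that separator. Hence the level of a vertex is unique and the successor
     functions can be combined. *)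
  assert (P_lt : forall n m v, (n < m)%nat -> P n v -> P m v -> False).
  { intros n m v Hnm Hn Hm. destruct m as [|m]; [lia|].
    destruct (Nat.eq_dec n m) as [<-|Hne].
    - destruct (P_in _ _ Hm) as [D|D]; [apply (P_end n v)|apply (P_out n v)]; auto.
    - apply (P_out n v Hn). apply (C_dec' m); [lia|]. auto. }
  set (lev := fun v => epsilon (inhabits O) (fun n => P n v)).
  assert (Hlev : forall n v, P n v -> lev v = n).
  { intros n v Hv. assert (Q : P (lev v) v) by (apply (epsilon_spec (inhabits O) (fun n => P n v)); eauto).
    destruct (Nat.lt_trichotomy (lev v) n) as [D|[D|D]]; auto; exfalso; eauto. }
  set (dd := fun v => epsilon (inhabits O) (fun j => In (Nat.iter j (phi (lev v)) v) (Sq (S (lev v))) /\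
     forall m, In (Nat.iter m (phi (lev v)) v) (Sq (S (lev v))) -> (j <= m)%nat)).
  assert (Hdd : forall n v, P n v -> In (Nat.iter (dd v) (phi n) v) (Sq (S n)) /\
     forall m, In (Nat.iter m (phi n) v) (Sq (S n)) -> (dd v <= m)%nat).
  { intros n v Hv. unfold dd. rewrite (Hlev n v Hv).
    apply (epsilon_spec (inhabits O) (fun j => In (Nat.iter j (phi n) v) (Sq (S n)) /\
      forall m, In (Nat.iter m (phi n) v) (Sq (S n)) -> (j <= m)%nat)).
    apply nat_least. apply P_reach; auto. }
  set (Phi := fun v => phi (lev v) v).
  set (PP := fun v => exists n, P n v).
  assert (S_P : forall n s, In s (Sq n) -> P n s).
  { intros n s Hsn. exists s, O. split; auto. split; auto. intros j Hj.
    replace j with O by lia. apply S_disj; auto. }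
  assert (HPhi : forall v, PP v -> PP (Phi v) /\ H v (Phi v) /\
    ((lev (Phi v) = lev v /\ dd (Phi v) < dd v)%nat \/ (lev v < lev (Phi v))%nat)).
  { intros v [n Hv]. unfold Phi. rewrite (Hlev n v Hv). destruct (Hphi n) as [T1 _].
    split; [|split; [apply T1; auto|]]; destruct (P_next n v Hv) as [D|D].
    - exists (S n). auto.
    - exists n; auto.
    - right. rewrite (Hlev (S n)); auto.
    - left. split; [apply Hlev; auto|]. destruct (Hdd n v Hv) as [E1 E2]. destruct (Hdd n _ D) as [F1 F2].
      destruct (dd v) as [|j]; [exfalso; exact (P_end n v Hv E1)|].
      rewrite Nat.iter_succ_r in E1. apply F2 in E1. lia. }
  assert (Phi_inj : forall v w, PP v -> PP w -> Phi v = Phi w -> v = w).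
  { intros v w [n Hv] [m Hw]. unfold Phi. rewrite (Hlev n v Hv), (Hlev m w Hw). intros E.
    destruct (Nat.lt_trichotomy n m) as [D|[D|D]].
    - exfalso. apply (img_out n v Hv). rewrite E. apply (C_dec' m); [lia|]. auto.
    - subst m. destruct (Hphi n) as [_ [T2 _]]. apply T2; auto.
    - exfalso. apply (img_out m w Hw). rewrite <- E. apply (C_dec' n); [lia|]. auto. }
  assert (Phi_out : forall v, PP v -> ~ In (Phi v) (Sq O)).
  { intros v [n Hv] Hin. unfold Phi in Hin. rewrite (Hlev n v Hv) in Hin.
    assert (Hc : C O (phi n v)) by (apply (C_dec' n); [lia|auto]).
    apply (comp_avoid _ _ _ _ Hc); auto. }
  assert (Rays : forall s, In s (Sq O) -> endof H r (fun i => Nat.iter i Phi s) /\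
     forall i, PP (Nat.iter i Phi s)).
  { intros s Hs0. destruct (rank_ray H PP Phi lev dd s HPhi) as [R1 [R2 R3]]; [exists O; auto|].
    split; auto. split; auto. apply ray_equiv_comp; auto. intros Y.
    assert (HY : exists n, incl Y (Bs n)).
    { induction Y as [|y Y [n Hn]]; [exists O; intros ? []|]. destruct (Bs_all y) as [m Hm].
      assert (Mon : forall a b, (a <= b)%nat -> incl (Bs a) (Bs b)).
      { induction 1 as [|b Hab IHb]; [apply incl_refl|]. eapply incl_tran; [exact IHb|].
        replace (S b) with (b + 1)%nat by lia. auto. }
      exists (max m n). apply incl_cons; [apply (Mon m); auto; lia|].
      eapply incl_tran; [exact Hn|apply Mon; lia]. }
    destruct HY as [n Hn]. destruct (R3 (S (S n))) as [m Hm]. exists m. intros i Hi.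
    destruct (R2 i) as [q Hq]. assert (Eq := Hlev q _ Hq). specialize (Hm i Hi). rewrite Eq in Hm.
    destruct q as [|q]; [lia|]. assert (Hc : C (S n) (Nat.iter i Phi s)).
    { apply (C_dec' q); [lia|]. auto. }
    eapply ev_in_mono; [|apply (comp_tail H (Sq (S n)) r Hs Hr)].
    intros u Hu; cbv beta. eapply conn_mono; [intros ? ? Z; exact Z| |apply (comp_conn H (Sq (S n)) r); auto].
    intros z Hz Hz'. apply (B_out n z); auto. }
  assert (Hlen : (k < length (Sq O))%nat) by (apply Hbig, (S_far O)).
  destruct (Sq O) as [|s0 Q0] eqn:ES; [simpl in Hlen; lia|]. rewrite <- ES in *.
  exists (fun i j => Nat.iter j Phi (nth i (Sq O) s0)). split.
  - intros i Hi. apply Rays, nth_In. lia.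
  - intros i j Hi Hj Hij m n E.
    assert (I1 : In (nth i (Sq O) s0) (Sq O)) by (apply nth_In; lia).
    assert (I2 : In (nth j (Sq O) s0) (Sq O)) by (apply nth_In; lia).
    destruct (orbits_disjoint PP Phi (Sq O) Phi_out Phi_inj m n _ _ I1 I2) as [_ Eq]; auto.
    { intros; apply Rays; auto. } { intros; apply Rays; auto. }
    apply Hij. apply (proj1 (NoDup_nth (Sq O) s0) (S_nd O)); auto; lia.
Qed.

End EndSeparators.

Lemma small_separator H f v0 r k X : lf_graph H -> loop H f v0 -> is_ray H r ->
  ~ has_disjoint_rays (endof H r) (S k) ->
  exists S, (length S <= k)%nat /\ forall x, In x X -> ~ rcomp H S r x.
Proof.
  intros OK L Hr Hd.
  destruct (exhaustion H v0 (lf_fin _ OK)) as [B [B1 B2]]; [intros; apply (loop_connected H f); auto|].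
  apply NNPP; intros Hn. apply Hd. apply (rays_of_large_separators H r B OK Hr B1 B2 k X).
  intros S HS. destruct (Nat.le_gt_cases (length S) k); auto. exfalso. apply Hn; eauto.
Qed.

End Menger.

(** * A monotone map that is flat exactly on the intervals of a closed set *)

Section FlatParametrization.
Import Coquelicot.Coquelicot.

(** [g] is the normalised integral of the distance to [E]. *)
Lemma flat_parametrization (E : R -> Prop) :
  (forall x, 0 <= x <= 1 -> ~ E x -> exists d, 0 < d /\
     forall y, 0 <= y <= 1 -> x - d < y < x + d -> ~ E y) ->
  (exists e, 0 <= e <= 1 /\ E e) -> (exists x, 0 <= x <= 1 /\ ~ E x) ->
  exists g : R -> R, g 0 = 0 /\ g 1 = 1 /\
    (forall x y, 0 <= x <= y -> y <= 1 -> g x <= g y) /\ continuity g /\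
    (forall x y, 0 <= x < y -> y <= 1 -> g x = g y <-> forall t, x <= t <= y -> E t).
Proof.
  intros Hcl [e [He0 He]] [x0 [Hx0 Hx0']].
  set (E' := fun t => 0 <= t <= 1 /\ E t).
  (* The distance to [E'], an infimum, obtained as the negative of a supremum of negatives. *)
  assert (Hex : forall x, exists m, (forall t, E' t -> m <= Rabs (x - t)) /\
     forall m', (forall t, E' t -> m' <= Rabs (x - t)) -> m' <= m).
  { intros x. destruct (completeness (fun y => exists t, E' t /\ y = - Rabs (x - t))) as [m [M1 M2]].
    - exists 0. intros y [t [_ ->]]. assert (K := Rabs_pos (x - t)). lra.
    - exists (- Rabs (x - e)), e. split; auto. split; auto.
    - exists (- m). split.
      + intros t Ht. assert (- Rabs (x - t) <= m) by (apply M1; eauto). lra.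
      + intros m' Hm'. assert (m <= - m'); [|lra]. apply M2. intros y [t [Ht ->]].
        specialize (Hm' t Ht). lra. }
  set (h := fun x => proj1_sig (constructive_indefinite_description _ (Hex x))).
  assert (Hh : forall x, (forall t, E' t -> h x <= Rabs (x - t)) /\
     forall m', (forall t, E' t -> m' <= Rabs (x - t)) -> m' <= h x).
  { intros x. exact (proj2_sig (constructive_indefinite_description _ (Hex x))). }
  assert (h_pos : forall x, 0 <= h x).
  { intros x. apply Hh. intros t _. apply Rabs_pos. }
  assert (h_lip1 : forall x y, h x <= h y + Rabs (x - y)).
  { intros x y. assert (h x - Rabs (x - y) <= h y); [|lra]. apply (proj2 (Hh y)). intros t Ht.
    assert (K := proj1 (Hh x) t Ht). assert (K2 := Rabs_triang (x - y) (y - t)).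
    replace (x - y + (y - t)) with (x - t) in K2 by ring. lra. }
  assert (h_zero : forall x, 0 <= x <= 1 -> E x -> h x = 0).
  { intros x Hx HE. assert (K := proj1 (Hh x) x (conj Hx HE)). rewrite Rminus_diag, Rabs_R0 in K.
    specialize (h_pos x). lra. }
  assert (h_gt : forall x, 0 <= x <= 1 -> ~ E x -> 0 < h x).
  { intros x Hx HE. destruct (Hcl x Hx HE) as [d [Hd A]]. assert (d <= h x); [|lra].
    apply (proj2 (Hh x)). intros t [Ht HEt]. destruct (Rle_dec d (Rabs (x - t))); auto.
    exfalso. apply (A t Ht); auto. assert (K : Rabs (x - t) < d) by lra. apply Rabs_def2 in K. lra. }
  assert (h_cont : forall x, continuous h x).
  { intros x. apply continuity_pt_filterlim. intros eps Heps. exists eps. split; auto.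
    intros y [_ Hy]. unfold dist in *; simpl in *. unfold Rdist in *.
    assert (K1 := h_lip1 x y). assert (K2 := h_lip1 y x). rewrite (Rabs_minus_sym x y) in K1.
    apply Rabs_def1; lra. }
  assert (h_int : forall a b, ex_RInt h a b).
  { intros a b. apply (@ex_RInt_continuous R_CompleteNormedModule). intros; apply h_cont. }
  assert (chas : forall x y, RInt h 0 y = RInt h 0 x + RInt h x y).
  { intros x y. symmetry. exact (RInt_Chasles h 0 x y (h_int _ _) (h_int _ _)). }
  assert (ge0 : forall x y, x <= y -> 0 <= RInt h x y).
  { intros x y Hxy. apply RInt_ge_0; auto. }
  (* The distance is 1-Lipschitz, so within [h t / 2] of a point [t] outside [E] it is at least
     [h t / 2]; this bounds the integral from below. *)
  assert (strict : forall x y t, 0 <= x < y -> y <= 1 -> x <= t <= y -> ~ E t -> 0 < RInt h x y).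
  { intros x y t Hxy Hy Ht HE. assert (Hg : 0 < h t) by (apply h_gt; auto; lra).
    set (c := Rmax x (t - h t / 2)). set (d := Rmin y (t + h t / 2)).
    assert (Hc : x <= c /\ c <= t /\ t - h t / 2 <= c /\ (c = x \/ c = t - h t/2)).
    { unfold c, Rmax. destruct (Rle_dec x (t - h t / 2)); lra. }
    assert (Hd : d <= y /\ t <= d /\ d <= t + h t / 2 /\ (d = y \/ d = t + h t/2)).
    { unfold d, Rmin. destruct (Rle_dec y (t + h t / 2)); lra. }
    assert (Hcd : c < d) by lra.
    assert (K : (d - c) * (h t / 2) <= RInt h c d).
    { replace ((d - c) * (h t / 2)) with (RInt (fun _ => h t / 2) c d).
      - apply RInt_le; auto; [lra|apply ex_RInt_const|]. intros z Hz.
        assert (K := h_lip1 t z). assert (Rabs (t - z) <= h t / 2) by (apply Rabs_le; lra). lra.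
      - rewrite RInt_const. unfold scal; simpl; unfold mult; simpl. ring. }
    assert (K1 := ge0 x c ltac:(lra)). assert (K2 := ge0 d y ltac:(lra)).
    assert (C1 := chas x c). assert (C2 := chas c d). assert (C3 := chas d y). assert (C4 := chas x y).
    assert (0 < (d - c) * (h t / 2)) by (apply Rmult_lt_0_compat; lra). lra. }
  assert (I1 : 0 < RInt h 0 1) by (apply (strict 0 1 x0); auto; lra).
  set (I := RInt h 0 1) in *.
  exists (fun x => RInt h 0 x / I). split; [|split; [|split; [|split]]].
  - rewrite RInt_point. unfold zero; simpl. unfold Rdiv; ring.
  - unfold I. field. fold I. lra.
  - intros x y Hxy Hy. apply Rmult_le_compat_r; [apply Rlt_le, Rinv_0_lt_compat; auto|].
    rewrite (chas x y). assert (K := ge0 x y ltac:(lra)). lra.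
  - intros x. apply continuity_pt_mult; [|apply continuity_pt_const; intros ? ?; reflexivity].
    apply continuity_pt_filterlim. apply (continuous_RInt_1 h 0 x (fun z => RInt h 0 z)).
    exists (mkposreal 1 Rlt_0_1). intros z _. exact (@RInt_correct R_CompleteNormedModule h 0 z (h_int 0 z)).
  - intros x y Hxy Hy. split.
    + intros HE t Ht. apply NNPP; intros Hn. assert (K := strict x y t Hxy Hy Ht Hn).
      apply Rmult_eq_reg_r in HE; [|apply Rinv_neq_0_compat; lra]. assert (K2 := chas x y). lra.
    + intros HE. rewrite (chas x y). replace (RInt h x y) with 0; [rewrite Rplus_0_r; auto|].
      transitivity (RInt (fun _ => 0) x y).
      * rewrite RInt_const. unfold scal; simpl; unfold mult; simpl. ring.
      * apply RInt_ext. intros z Hz. rewrite Rmin_left, Rmax_right in Hz by lra.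
        symmetry. apply h_zero; [lra|]. apply HE; lra.
Qed.

End FlatParametrization.

(** * From a curve to a circle *)

Section CurveToCircle.
Context {V : Type}.
Implicit Types (H : V -> V -> Prop) (f : R -> pt V).

Lemma crossing_left H f v0 S r x y : lf_graph H -> loop H f v0 -> is_ray H r -> 0 <= y < x -> x <= 1 ->
  end_nbhd H S (endof H r) (f x) -> ~ end_nbhd H S (endof H r) (f y) ->
  exists t s, y <= t < x /\ In s S /\ f t = inl (vtx s).
Proof.
  intros OK L Hr Hy Hx Px Py.
  destruct (crossing H _ v0 S r (1 - x) (1 - y) OK (loop_rev _ _ _ L) Hr) as [t [s [Ht [Hs E]]]]; try lra.
  - replace (1 - (1 - x)) with x by ring; auto.
  - replace (1 - (1 - y)) with y by ring; auto.
  - exists (1 - t), s. split; [lra|auto].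
Qed.

(** If a vertex lies between two visits of an end, each of the four passages of the curve between that end and
    a far vertex needs its own vertex in every separator. *)
Lemma no_vertex_between H f v0 A z1 z2 v : infinite_vertices V -> lf_graph H -> loop H f v0 ->
  is_end V H A -> end_degree_le V A 3 ->
  0 <= z1 -> z2 <= 1 -> f z1 = inr A -> f z2 = inr A -> ~ z1 < place f v < z2.
Proof.
  intros HV OK L [r [Hr HA]] Hdeg Hz1 Hz2 E1 E2 Hv.
  change (A = endof H r) in HA. subst A.
  assert (B1 : 0 < z1 < 1) by (eapply end_pos; eauto; lra).
  assert (B2 : 0 < z2 < 1) by (eapply end_pos; eauto; lra).
  destruct (pos_spec _ _ _ v L) as [Pv1 Pv2].
  (* The passages towards the end start from the successors of [v] and [v0] rather than from these
     vertices. Otherwise [v] could serve two consecutive passages, and [v0] both the first and the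
     last. *)
  destruct (next_vertex H f v0 (place f v) z2 v (endof H r) HV OK L) as [y [w [Hy Hyw]]]; auto; try lra.
  destruct (next_vertex H f v0 0 z1 v0 (endof H r) HV OK L) as [y0 [w0 [Hy0 Hyw0]]]; auto; try lra; [apply L|].
  assert (Ew : f y = inl (vtx w)) by apply Hyw. assert (Ew0 : f y0 = inl (vtx w0)) by apply Hyw0.
  destruct (small_separator H f v0 r 3 (v0 :: w0 :: v :: w :: nil) OK L Hr Hdeg) as [S [S1 S2]].
  assert (Out : forall x t, In x (v0 :: w0 :: v :: w :: nil) -> f t = inl (vtx x) ->
     ~ end_nbhd H S (endof H r) (f t)).
  { intros x t Hx Et C. rewrite Et in C. apply end_nbhd_vtx in C; auto. exact (S2 x Hx C). }
  assert (In1 : end_nbhd H S (endof H r) (f z1)) by (rewrite E1; apply end_nbhd_self; auto).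
  assert (In2 : end_nbhd H S (endof H r) (f z2)) by (rewrite E2; apply end_nbhd_self; auto).
  destruct (crossing_left H f v0 S r z1 y0 OK L Hr) as [t1 [s1 [T1 [I1 F1]]]]; auto; try lra.
  { apply (Out w0); simpl; auto. }
  destruct (crossing H f v0 S r z1 (place f v) OK L Hr) as [t2 [s2 [T2 [I2 F2]]]]; auto; try lra.
  { apply (Out v); simpl; auto. }
  destruct (crossing_left H f v0 S r z2 y OK L Hr) as [t3 [s3 [T3 [I3 F3]]]]; auto; try lra.
  { apply (Out w); simpl; auto 6. }
  destruct (crossing H f v0 S r z2 1 OK L Hr) as [t4 [s4 [T4 [I4 F4]]]]; auto; try lra.
  { apply (Out v0); simpl; auto. apply L. }
  assert (Dist : forall t t' s s', 0 < t < t' -> t' <= 1 -> f t = inl (vtx s) -> f t' = inl (vtx s') -> s <> s').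
  { intros t t' s s' Ht Ht' Fs Fs' <-. assert (K := pos_eq H f v0 s t L ltac:(lra) Fs).
    destruct (pos_close H f v0 s t' L ltac:(lra) Fs') as [K'|[_ ->]]; [lra|].
    rewrite (pos_v0 _ _ _ L) in K. lra. }
  assert (D12 : s1 <> s2) by (apply (Dist t1 t2); auto; lra).
  assert (D13 : s1 <> s3) by (apply (Dist t1 t3); auto; lra).
  assert (D14 : s1 <> s4) by (apply (Dist t1 t4); auto; lra).
  assert (D23 : s2 <> s3) by (apply (Dist t2 t3); auto; lra).
  assert (D24 : s2 <> s4) by (apply (Dist t2 t4); auto; lra).
  assert (D34 : s3 <> s4) by (apply (Dist t3 t4); auto; lra).
  assert (K : (length (s1 :: s2 :: s3 :: s4 :: nil) <= length S)%nat).
  { apply NoDup_incl_length.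
    - repeat constructor; simpl; intuition congruence.
    - intros x [<-|[<-|[<-|[<-|[]]]]]; auto. }
  simpl in K. lia.
Qed.

Definition end_fibers f : Prop := forall x y A, 0 <= x <= y -> y <= 1 -> f x = inr A -> f y = inr A ->
  forall t, x <= t <= y -> f t = inr A.

Lemma arc_unique H f a b u w a' b' u' w' x : lf_graph H -> edge_arc H f a b u w ->
  edge_arc H f a' b' u' w' -> a < x < b -> a' < x < b' -> a = a' /\ b = b' /\ u = u' /\ w = w'.
Proof.
  intros OK A A' Hx Hx'. assert (B := A). assert (B' := A').
  destruct B as [_ [_ [Ba [Bb _]]]]. destruct B' as [_ [_ [Ba' [Bb' _]]]].
  assert (Ea : a = a').
  { destruct (Rtotal_order a a') as [D|[D|D]]; auto; exfalso.
    - apply (arc_no_vtx H f a b u w a' u' OK A); auto; lra.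
    - apply (arc_no_vtx H f a' b' u' w' a u OK A'); auto; lra. }
  assert (Eb : b = b').
  { destruct (Rtotal_order b b') as [D|[D|D]]; auto; exfalso.
    - apply (arc_no_vtx H f a' b' u' w' b w OK A'); auto; lra.
    - apply (arc_no_vtx H f a b u w b' w' OK A); auto; lra. }
  subst. split; auto. split; auto. split; apply vtx_inj; congruence.
Qed.

(** Between two visits of an end there is no vertex, and hence no edge either, because its arc would
    finish at a vertex before the second visit. What remains is a stretch of ends, which is
    constant. *)
Lemma degree_end_fibers H f v0 : infinite_vertices V -> lf_graph H -> loop H f v0 ->
  (forall A, is_end V H A -> end_degree_le V A 3) -> end_fibers f.
Proof.
  intros HV OK L Hdeg x y A Hxy Hy Ex Ey t Ht.
  assert (HA : is_end V H A).
  { destruct (cplx_cases H (f x)) as [[v E]|[[u [w [s [_ [_ E]]]]]|[r [Hr E]]]]; try congruence.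
    - apply L; lra. - rewrite Ex in E. injection E as ->. apply endof_end; auto. }
  assert (NV := fun v => no_vertex_between H f v0 A x y v HV OK L HA (Hdeg A HA) ltac:(lra) Hy Ex Ey).
  assert (By : 0 < y < 1) by (eapply end_pos; eauto; lra).
  assert (All : forall s, x <= s <= y -> exists B, f s = inr B).
  { intros s Hs. destruct (cplx_cases H (f s)) as [[v E]|[[u [w [q [B [C E]]]]]|[r [_ E]]]].
    - apply L; lra.
    - exfalso. apply (NV v). rewrite <- (pos_eq H f v0 v s); auto; [|lra].
      destruct (Req_dec s x) as [->|]; [congruence|]. destruct (Req_dec s y) as [->|]; [congruence|]. lra.
    - exfalso. destruct (inner_arc H f v0 s u w HV OK L) as [a [b [Hab Harc]]]; auto; [lra|eauto|].
      assert (Hb : exists v, f b = inl (vtx v)) by (destruct Harc as [[_ [_ [_ [? _]]]]|[_ [_ [_ [? _]]]]]; eauto).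
      destruct Hb as [v Fv].
      assert (Hby : b <= y).
      { destruct (Rle_dec b y); auto. exfalso.
        destruct Harc as [Harc|Harc]; apply (arc_no_end _ _ _ _ _ _ y A Harc); auto; lra. }
      destruct (Req_dec b y) as [->|]; [congruence|].
      apply (NV v). rewrite <- (pos_eq H f v0 v b); auto; lra.
    - eauto. }
  rewrite <- Ex. symmetry. apply (ends_const H f v0); auto; try lra. intros s Hs. apply All; lra.
Qed.

(** On each edge arc the curve is made to run uniformly from [u], whose coefficient is 1 at [a], to
    [w]; this removes all turning back inside edges. *)
Definition linearize H f (x : R) : pt V :=
  match excluded_middle_informative (exists q : R * R * V * V,
      let '(a, b, u, w) := q in edge_arc H f a b u w /\ a < x < b) with
  | left e => let '(a, b, u, w) := proj1_sig (constructive_indefinite_description _ e) in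
              inl (ept u w ((b - x) / (b - a)))
  | right _ => f x
  end.

Lemma linearize_arc H f a b u w x : lf_graph H -> edge_arc H f a b u w -> a < x < b ->
  linearize H f x = inl (ept u w ((b - x) / (b - a))).
Proof.
  intros OK A Hx. unfold linearize.
  destruct (excluded_middle_informative _) as [e|n].
  - destruct (constructive_indefinite_description _ e) as [[[[a' b'] u'] w'] [A' Hx']]. simpl.
    destruct (arc_unique H f a b u w a' b' u' w' x OK A A' Hx Hx') as [-> [-> [-> ->]]]. auto.
  - exfalso. apply n. exists (a, b, u, w). auto.
Qed.

Lemma linearize_vtx H f x v : lf_graph H -> f x = inl (vtx v) -> linearize H f x = f x.
Proof.
  intros OK E. unfold linearize. destruct (excluded_middle_informative _) as [e|n]; auto. exfalso.
  destruct e as [[[[a b] u] w] [A Hx]]. exact (arc_no_vtx _ _ _ _ _ _ _ v OK A Hx E).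
Qed.

Lemma linearize_end H f x A : f x = inr A -> linearize H f x = f x.
Proof.
  intros E. unfold linearize. destruct (excluded_middle_informative _) as [e|n]; auto. exfalso.
  destruct e as [[[[a b] u] w] [B Hx]]. exact (arc_no_end _ _ _ _ _ _ _ A B Hx E).
Qed.

Lemma arc_frac a b x : a < x < b -> 0 < (b - x) / (b - a) < 1.
Proof.
  intros Hx. split; [apply Rdiv_lt_0_compat; lra|].
  apply Rmult_lt_reg_r with (b - a); [lra|]. field_simplify; lra.
Qed.

Lemma point_cases H f v0 x : infinite_vertices V -> lf_graph H -> loop H f v0 -> 0 <= x <= 1 ->
  (exists v, f x = inl (vtx v)) \/
  (exists a b u w s, edge_arc H f a b u w /\ a < x < b /\ 0 < s < 1 /\ f x = inl (ept u w s)) \/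
  (exists r, is_ray H r /\ f x = inr (endof H r)).
Proof.
  intros HV OK L Hx. destruct (cplx_cases H (f x)) as [[v E]|[[u [w [q [B [C E]]]]]|E]]; eauto.
  - apply L; auto.
  - right; left. destruct (inner_arc H f v0 x u w HV OK L) as [a [b [Hab [Harc|Harc]]]]; eauto.
    + exists a, b, u, w, q. auto.
    + exists a, b, w, u, (1 - q). repeat split; auto; try lra; try apply Harc.
      rewrite <- ept_swap; auto. eapply edge_neq; eauto.
Qed.

Lemma pred_arc H f v0 x v : infinite_vertices V -> lf_graph H -> loop H f v0 -> 0 < x <= 1 ->
  f x = inl (vtx v) -> exists a u, edge_arc H f a x u v.
Proof.
  intros HV OK L Hx E.
  destruct (succ_arc H _ v0 (1 - x) v HV OK (loop_rev _ _ _ L)) as [b [u A]]; [lra| |].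
  - replace (1 - (1 - x)) with x by ring; auto.
  - apply edge_arc_rev in A; auto. exists (1 - b), u.
    replace (1 - (1 - x)) with x in A by ring.
    replace f with (fun z => f (1 - (1 - z))); auto.
    apply functional_extensionality; intros z. f_equal; ring.
Qed.

Lemma linearize_loop H f v0 : infinite_vertices V -> lf_graph H -> loop H f v0 ->
  loop H (linearize H f) v0.
Proof.
  intros HV OK L.
  assert (Vtx : forall x v, 0 <= x <= 1 -> linearize H f x = inl (vtx v) -> f x = inl (vtx v)).
  { intros x v Hx E. destruct (point_cases H f v0 x HV OK L Hx) as [[v' E']|[[a [b [u [w [s [A [B _]]]]]]]|[r [_ E']]]].
    - rewrite (linearize_vtx H f x v' OK E') in E. auto.
    - rewrite (linearize_arc H f a b u w x OK A B) in E. injection E as E. symmetry in E.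
      apply vtx_ept in E; [contradiction|eapply edge_neq; eauto; apply A|apply arc_frac; auto].
    - rewrite (linearize_end H f x _ E') in E. auto. }
  split.
  - rewrite (linearize_vtx H f 0 v0 OK); apply L.
  - rewrite (linearize_vtx H f 1 v0 OK); apply L.
  - intros x Hx. destruct (point_cases H f v0 x HV OK L Hx) as [[v' E']|[[a [b [u [w [s [A [B _]]]]]]]|[r [_ E']]]].
    + rewrite (linearize_vtx H f x v' OK E'). apply L; auto.
    + rewrite (linearize_arc H f a b u w x OK A B). right; left. exists u, w, ((b - x)/(b - a)).
      split; [apply A|]. split; auto. apply arc_frac; auto.
    + rewrite (linearize_end H f x _ E'). apply L; auto.
  - intros x N Hx HN. destruct (point_cases H f v0 x HV OK L Hx) as [[v E]|[[a [b [u [w [s [A [B [C D]]]]]]]]|[r [Hr E]]]].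
    + rewrite (linearize_vtx H f x v OK E), E in HN. apply bn_vtx in HN; auto. destruct HN as [eps [He ->]].
      assert (Hself : star H v eps (linearize H f x)) by (rewrite (linearize_vtx H f x v OK E), E; left; auto).
      (* The speed on the arc is 1/(b - x), so a time below eps (b - x) keeps the coefficient of [v]
         above 1 - eps. *)
      assert (Right : exists d, 0 < d /\ forall y, 0 <= y <= 1 -> x <= y < x + d -> star H v eps (linearize H f y)).
      { destruct (Req_dec x 1) as [->|Hx1].
        - exists 1. split; [lra|]. intros y Hy Hxy. replace y with 1 by lra. auto.
        - destruct (succ_arc H f v0 x v HV OK L) as [b [w A]]; auto; [lra|].
          assert (Hxb : x < b) by (destruct A; lra).
          exists (eps * (b - x)). split; [apply Rmult_lt_0_compat; lra|]. intros y Hy Hxy.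
          destruct (Req_dec y x) as [->|Hne]; auto.
          assert (Hyb : x < y < b) by nra.
          rewrite (linearize_arc H f x b v w y OK A Hyb). assert (F := arc_frac x b y Hyb).
          apply star_ept; auto; [apply A|lra|]. left. split; auto.
          apply Rmult_lt_reg_r with (b - x); [lra|]. unfold Rdiv. rewrite Rmult_assoc, Rinv_l by lra. nra. }
      assert (Left : exists d, 0 < d /\ forall y, 0 <= y <= 1 -> x - d < y <= x -> star H v eps (linearize H f y)).
      { destruct (Req_dec x 0) as [->|Hx0].
        - exists 1. split; [lra|]. intros y Hy Hxy. replace y with 0 by lra. auto.
        - destruct (pred_arc H f v0 x v HV OK L) as [a [u A]]; auto; [lra|].
          assert (Hax : a < x) by (destruct A; lra).
          exists (eps * (x - a)). split; [apply Rmult_lt_0_compat; lra|]. intros y Hy Hxy.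
          destruct (Req_dec y x) as [->|Hne]; auto.
          assert (Hya : a < y < x) by nra.
          rewrite (linearize_arc H f a x u v y OK A Hya). assert (F := arc_frac a x y Hya).
          apply star_ept; auto; [apply A|lra|]. right. split; auto.
          apply Rmult_lt_reg_r with (x - a); [lra|]. unfold Rdiv. rewrite Rmult_assoc, Rinv_l by lra. nra. }
      destruct Right as [d1 [D1 R1]]. destruct Left as [d2 [D2 R2]].
      exists (Rmin d1 d2). split; [apply Rmin_glb_lt; auto|].
      assert (M1 := Rmin_l d1 d2). assert (M2 := Rmin_r d1 d2). intros y Hy Hxy.
      destruct (Rle_dec x y); [apply R1|apply R2]; lra.
    + rewrite (linearize_arc H f a b u w x OK A B) in HN.
      apply bn_ept in HN; auto; [|apply A|apply arc_frac; auto].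
      destruct HN as [a' [b' [Ha' [Hb' NE]]]]. set (t := (b - x)/(b - a)) in *.
      assert (Et : b - x = t * (b - a)) by (unfold t; field; lra).
      exists (Rmin ((t - a') * (b - a)) ((b' - t) * (b - a))).
      assert (M1 := Rmin_l ((t - a') * (b - a)) ((b' - t) * (b - a))).
      assert (M2 := Rmin_r ((t - a') * (b - a)) ((b' - t) * (b - a))).
      split; [apply Rmin_glb_lt; apply Rmult_lt_0_compat; lra|].
      intros y Hy Hxy. apply NE.
      assert (Y1 : a' * (b - a) < b - y) by nra. assert (Y2 : b - y < b' * (b - a)) by nra.
      assert (Hyab : a < y < b) by nra.
      rewrite (linearize_arc H f a b u w y OK A Hyab). exists ((b - y)/(b - a)). split; auto.
      split; apply Rmult_lt_reg_r with (b - a); try lra; unfold Rdiv; rewrite Rmult_assoc, Rinv_l by lra; lra.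
    (* Whether an inner point belongs to an end neighbourhood depends only on its edge, so moving
       points along their edges preserves continuity at ends. *)
    + assert (HN' := HN). rewrite (linearize_end H f x _ E) in HN'.
      destruct (lp_cont _ _ _ L x N Hx HN') as [d [Hd K]]. exists d. split; auto. intros y Hy Hxy.
      rewrite E in HN'. apply bn_end in HN'; auto. destruct HN' as [S ->].
      destruct (point_cases H f v0 y HV OK L Hy) as [[v' E']|[[a [b [u [w [s [A [B [C D]]]]]]]]|[r' [_ E']]]].
      * rewrite (linearize_vtx H f y v' OK E'). auto.
      * specialize (K y Hy Hxy). rewrite D in K. rewrite (linearize_arc H f a b u w y OK A B).
        assert (Huw : H u w) by apply A.
        apply end_nbhd_ept in K; auto. apply end_nbhd_ept; auto. apply arc_frac; auto.
      * rewrite (linearize_end H f y _ E'). auto.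
  - intros v. destruct (lp_ex _ _ _ L v) as [x [Hx E]]. exists x. split; auto.
    rewrite (linearize_vtx H f x v OK E). auto.
  - intros v x y Hx Hy E1 E2. apply (lp_uniq _ _ _ L v); auto; apply Vtx; auto; lra.
Qed.

(** The coincidences still tolerated are those a monotone reparametrisation can remove: the seam and
    stretches of ends, which are constant by [ends_const]. *)
Definition monotone_fibers f : Prop := forall x y, 0 <= x < y -> y <= 1 -> f x = f y ->
  (x = 0 /\ y = 1) \/ forall t, x <= t <= y -> exists A, f t = inr A.

Lemma linearize_fibers H f v0 : infinite_vertices V -> lf_graph H -> loop H f v0 ->
  end_fibers f -> monotone_fibers (linearize H f).
Proof.
  intros HV OK L HE x y Hxy Hy E.
  destruct (point_cases H f v0 x HV OK L ltac:(lra)) as [[v Ex]|[[a [b [u [w [s [A [B _]]]]]]]|[r [_ Ex]]]];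
  destruct (point_cases H f v0 y HV OK L ltac:(lra)) as [[v' Ey]|[[a' [b' [u' [w' [s' [A' [B' _]]]]]]]|[r' [_ Ey]]]];
  rewrite ?(linearize_arc H f a b u w x OK A B), ?(linearize_arc H f a' b' u' w' y OK A' B') in E;
  rewrite ?(linearize_vtx H f x v OK Ex), ?(linearize_vtx H f y v' OK Ey),
    ?(linearize_end H f x _ Ex), ?(linearize_end H f y _ Ey), ?Ex, ?Ey in E; try congruence.
  - injection E as E. apply vtx_inj in E. subst v'. left.
    assert (K := pos_eq H f v0 v x L ltac:(lra) Ex).
    destruct (pos_close H f v0 v y L ltac:(lra) Ey) as [K'|[-> ->]]; [lra|].
    rewrite (pos_v0 _ _ _ L) in K. auto.
  - injection E as E. apply vtx_ept in E; [contradiction|eapply edge_neq; eauto; apply A'|apply arc_frac; auto].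
  - injection E as E. symmetry in E.
    apply vtx_ept in E; [contradiction|eapply edge_neq; eauto; apply A|apply arc_frac; auto].
  (* Two arcs on one edge in the same direction coincide, because vertices are visited once. In
     opposite directions they either contradict the order of the parameters or fill the whole loop,
     leaving no place for a further vertex. *)
  - exfalso. assert (A0 := A). assert (A0' := A').
    destruct A0 as [A1 [A2 [A3 [A4 _]]]]. destruct A0' as [A1' [A2' [A3' [A4' _]]]].
    assert (Hn := edge_neq _ _ _ OK A2).
    assert (Ca := pos_close _ _ _ _ a L ltac:(lra) A3). assert (Cb := pos_close _ _ _ _ b L ltac:(lra) A4).
    assert (Ca' := pos_close _ _ _ _ a' L ltac:(lra) A3'). assert (Cb' := pos_close _ _ _ _ b' L ltac:(lra) A4').
    destruct Ca as [Ca|[Ca _]]; [|lra]. destruct Ca' as [Ca'|[Ca' _]]; [|lra].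
    assert (Z := pos_v0 _ _ _ L).
    assert (Fresh : ~ (forall t, 0 < t < 1 -> f t = inl (vtx u) \/ f t = inl (vtx w) \/ a < t < b \/ a' < t < b')).
    { intros Hall. destruct (inf_fresh HV (v0 :: u :: w :: nil)) as [z Hz].
      assert (Hz0 : z <> v0) by (intros ->; apply Hz; left; auto).
      destruct (pos_spec _ _ _ z L) as [_ Ez].
      destruct (Hall (place f z) (pos_pos _ _ _ z L Hz0)) as [D|[D|[D|D]]].
      - rewrite Ez in D. injection D as D. apply vtx_inj in D. apply Hz; simpl; auto.
      - rewrite Ez in D. injection D as D. apply vtx_inj in D. apply Hz; simpl; auto.
      - exact (arc_no_vtx _ _ _ _ _ _ _ z OK A D Ez).
      - exact (arc_no_vtx _ _ _ _ _ _ _ z OK A' D Ez). }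
    injection E as E. apply ept_inj in E; try (apply arc_frac; auto); auto; [|eapply edge_neq; eauto].
    destruct E as [[<- [<- E]]|[<- [<- E]]].
    + assert (Haa : a' = a) by congruence.
      assert (Hbb : b' = b).
      { destruct Cb as [Cb|[Cb Cw]], Cb' as [Cb'|[Cb' Cw']]; try congruence.
        - rewrite Cw' in Cb; lra. - rewrite Cw in Cb'; lra. }
      rewrite Haa, Hbb in E. unfold Rdiv in E. apply Rmult_eq_reg_r in E; [lra|apply Rinv_neq_0_compat; lra].
    + destruct Cb as [Cb|[Cb ->]], Cb' as [Cb'|[Cb' ->]]; try lra.
      * apply Fresh. intros t Ht. destruct (Rtotal_order t b) as [D|[->|D]]; auto; lra.
      * apply Fresh. intros t Ht. destruct (Rtotal_order t a) as [D|[->|D]]; auto; lra.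
  - right. intros t Ht. exists (endof H r). rewrite (linearize_end H f t (endof H r)).
    + apply (HE x y (endof H r)); auto; try lra. congruence.
    + apply (HE x y (endof H r)); auto; try lra. congruence.
Qed.

End CurveToCircle.

(** * Collapsing the fibres and passing to the larger graph *)

Lemma intermediate_value (g : R -> R) y : continuity g -> g 0 = 0 -> g 1 = 1 -> 0 <= y <= 1 ->
  exists x, 0 <= x <= 1 /\ g x = y.
Proof.
  intros Hg G0 G1 Hy. destruct (Req_dec y 0) as [->|Hy0]; [exists 0; split; [lra|auto]|].
  destruct (Req_dec y 1) as [->|Hy1]; [exists 1; split; [lra|auto]|].
  destruct (IVT (fun x => g x - y) 0 1) as [x [Hx E]]; try lra.
  - intros x. apply continuity_pt_minus; [apply Hg|]. apply continuity_pt_const. intros ? ?; auto.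
  - exists x. split; auto; lra.
Qed.

Section Reparametrization.
Context {V : Type}.

Lemma simple_reparametrization (H : V -> V -> Prop) (f : R -> pt V) v0 :
  lf_graph H -> loop H f v0 -> monotone_fibers f -> exists f', loop H f' v0 /\ simple f'.
Proof.
  intros OK L HM.
  (* A loop without ends is already simple; otherwise the set to be collapsed is nonempty, and the
     distance to it makes sense. *)
  destruct (classic (exists e A, 0 <= e <= 1 /\ f e = inr A)) as [[e [A0 [He Ee]]]|Hno].
  2:{ exists f. split; auto.
      assert (K : forall x y, 0 <= x < y -> y < 1 -> f x <> f y).
      { intros x y Hx Hy E. destruct (HM x y Hx ltac:(lra) E) as [?|D]; [lra|].
        destruct (D x ltac:(lra)) as [A EA]. apply Hno. exists x, A. split; auto; lra. }
      intros x y Hx Hy E. destruct (Rtotal_order x y) as [D|[D|D]]; auto; exfalso.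
      - apply (K x y); auto; lra. - apply (K y x); auto; lra. }
  set (E := fun t => exists A, f t = inr A).
  assert (E1 : ~ E 1) by (intros [A EA]; rewrite (lp_1 _ _ _ L) in EA; congruence).
  destruct (flat_parametrization E) as [g [G0 [G1 [Gmon [Gc Gflat]]]]].
  - intros x Hx Hn. destruct (cplx_cases H (f x)) as [[v Ex]|[[u [w [s [B [C Ex]]]]]|[r [_ Ex]]]].
    + apply L; auto.
    + destruct (lp_cont _ _ _ L x (star H v 1) Hx) as [d [Hd K]]; [rewrite Ex; apply bn_star; lra|].
      exists d. split; auto. intros y Hy Hxy [A EA].
      destruct (K y Hy Hxy) as [F|[w [t [_ [_ [_ F]]]]]]; congruence.
    + destruct (lp_cont _ _ _ L x (seg u w (s/2) ((1+s)/2)) Hx) as [d [Hd K]];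
        [rewrite Ex; apply bn_seg; auto; lra|].
      exists d. split; auto. intros y Hy Hxy [A EA]. destruct (K y Hy Hxy) as [t [_ F]]. congruence.
    + exfalso; apply Hn; exists (endof H r); auto.
  - exists e. split; auto. exists A0; auto.
  - exists 1. split; auto; lra.
  - assert (Gflat' : forall x y, 0 <= x <= y -> y <= 1 -> g x = g y -> f x = f y).
    { intros x y Hx Hy Eg. destruct (Req_dec x y) as [->|]; auto.
      apply (ends_const H f v0); auto. apply (Gflat x y); auto; lra. }
    assert (Gsame : forall x y, 0 <= x <= 1 -> 0 <= y <= 1 -> g x = g y -> f x = f y).
    { intros x y Hx Hy Eg. destruct (Rle_dec x y); [apply Gflat'; auto; lra|].
      symmetry; apply Gflat'; auto; lra. }
    (* Any preimage under [g] will do, since [f] is constant on the fibres of [g]. *)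
    set (inv := fun y => epsilon (inhabits 0) (fun x => 0 <= x <= 1 /\ g x = y)).
    assert (Hinv : forall y, 0 <= y <= 1 -> 0 <= inv y <= 1 /\ g (inv y) = y).
    { intros y Hy. unfold inv. apply epsilon_spec. apply intermediate_value; auto. }
    assert (Grange : forall x, 0 <= x <= 1 -> 0 <= g x <= 1).
    { intros x Hx. rewrite <- G0 at 1. rewrite <- G1. split; apply Gmon; lra. }
    assert (Ff : forall x, 0 <= x <= 1 -> f (inv (g x)) = f x).
    { intros x Hx. destruct (Hinv (g x) (Grange x Hx)). apply Gsame; auto. }
    assert (Hsimple : simple (fun y => f (inv y))).
    { assert (K : forall x y, 0 <= x < y -> y <= 1 -> g y < 1 -> f x = f y -> g x = g y).
      { intros x y Hx Hy Hgy Exy. destruct (HM x y Hx Hy Exy) as [[-> ->]|D]; [lra|].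
        apply Gflat; auto. }
      intros y1 y2 H1 H2 Ey. destruct (Hinv y1) as [I1 J1]; [lra|]. destruct (Hinv y2) as [I2 J2]; [lra|].
      rewrite <- J1, <- J2. destruct (Rtotal_order (inv y1) (inv y2)) as [D|[D|D]].
      - apply K; auto; lra.
      - congruence.
      - symmetry; apply K; auto; lra. }
    exists (fun y => f (inv y)). split; auto. split.
    + rewrite <- G0. rewrite Ff; [apply L|lra].
    + rewrite <- G1. rewrite Ff; [apply L|lra].
    + intros y Hy. apply L. apply Hinv; auto.
    + intros y N Hy HN. destruct (Hinv y Hy) as [I J]. set (x := inv y) in *.
      (* The choice of preimages is not continuous, but by compactness a parameter whose [g]-value
         is close to [y] lies close to the fibre over [y], on which [f] takes the value [f x]. *)
      assert (K : exists eps, 0 < eps /\ forall z, 0 <= z <= 1 -> y - eps < g z < y + eps -> N (f z)).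
      { apply (cousin 0 1 (fun a b => exists eps, 0 < eps /\
          forall z, a <= z <= b -> y - eps < g z < y + eps -> N (f z))); [lra| |].
        - intros a b c _ _ [e1 [P1 Q1]] [e2 [P2 Q2]]. exists (Rmin e1 e2).
          split; [apply Rmin_glb_lt; auto|].
          assert (M1 := Rmin_l e1 e2). assert (M2 := Rmin_r e1 e2). intros z Hz Hgz.
          destruct (Rle_dec z b); [apply Q1|apply Q2]; lra.
        - intros z Hz. destruct (Req_dec (g z) y) as [Egz|Egz].
          + assert (Ez : f z = f x) by (apply Gsame; auto; congruence).
            rewrite <- Ez in HN. destruct (lp_cont _ _ _ L z N Hz HN) as [d [Hd K]].
            exists d. split; auto. intros a b Ha Hb Ha' Hb'. exists 1. split; [lra|].
            intros t Ht _. apply K; lra.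
          + set (eta := Rabs (g z - y) / 2).
            assert (Heta : 0 < eta).
            { unfold eta. assert (0 < Rabs (g z - y)) by (apply Rabs_pos_lt; lra). lra. }
            destruct (Gc z eta Heta) as [d [Hd K]]. exists d. split; auto.
            intros a b Ha Hb Ha' Hb'. exists eta. split; auto. intros t Ht Hgt. exfalso.
            assert (Kt : Rabs (g t - g z) < eta).
            { destruct (Req_dec t z) as [->|Htz]; [rewrite Rminus_diag, Rabs_R0; auto|].
              apply (K t). split; [split; [exact Logic.I|auto]|]. simpl. unfold Rdist. apply Rabs_def1; lra. }
            apply Rabs_def2 in Kt. unfold eta, Rabs in *. destruct (Rcase_abs (g z - y)); lra. }
      destruct K as [eps [He' K]]. exists eps. split; auto. intros y' Hy' Hyy.
      destruct (Hinv y' Hy') as [I' J']. apply K; auto. rewrite J'; lra.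
    + intros v. destruct (lp_ex _ _ _ L v) as [x [Hx Ex]]. exists (g x).
      rewrite Ff by lra. split; auto. assert (R1 := Grange x ltac:(lra)).
      (* If [g] took the value 1 before the parameter 1, it would be flat up to 1, and the loop
         would finish at an end instead of [v0]. *)
      destruct (Req_dec (g x) 1) as [Eg|]; [|lra]. exfalso. apply E1.
      apply (proj1 (Gflat x 1 Hx (Rle_refl 1))); [congruence|lra].
    + intros v x y Hx Hy Ex Ey. apply Hsimple; auto. congruence.
Qed.

(** The map of compactifications induced by inclusion of a subgraph. It is continuous on a loop
    because components of the subgraph lie in components of [G], and the second clause of
    faithfulness makes it injective on ends. *)
Definition push_end (G : V -> V -> Prop) (q : pt V) : pt V :=
  match q with
  | inl a => inl a
  | inr A => inr (fun r' => exists r, A r /\ is_ray G r' /\ ray_equiv G r r')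
  end.

Section Push.
Variables (F G : V -> V -> Prop).
Hypotheses (OKF : lf_graph F) (OKG : lf_graph G) (HFG : forall u v, F u v -> G u v)
  (Heq : forall r1 r2, is_ray F r1 -> is_ray F r2 -> (ray_equiv F r1 r2 <-> ray_equiv G r1 r2)).

Lemma push_endof r : is_ray F r -> push_end G (inr (endof F r)) = inr (endof G r).
Proof.
  intros Hr. simpl. f_equal. apply functional_extensionality; intros q.
  assert (Gs := lf_sym _ OKG). assert (Gr := ray_sub F G r HFG Hr).
  apply propositional_extensionality. split.
  - intros [r' [[R1 R2] [R3 R4]]]. split; auto. apply ray_equiv_trans with r'; auto.
    + apply (ray_sub F G); auto. + apply Heq; auto.
  - intros [R1 R2]. exists r. split; auto. apply endof_self; auto. apply OKF.
Qed.

Lemma push_inl q a : push_end G q = inl a <-> q = inl a.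
Proof. destruct q; simpl; split; congruence. Qed.

Lemma push_loop f v0 : loop F f v0 -> loop G (fun x => push_end G (f x)) v0.
Proof.
  intros L. assert (Gs := lf_sym _ OKG). split.
  - apply push_inl, L.
  - apply push_inl, L.
  - intros x Hx. destruct (cplx_cases F (f x)) as [[v E]|[[u [w [s [A [B E]]]]]|[r [Hr E]]]].
    + apply L; auto.
    + left. exists v. apply push_inl; auto.
    + right; left. exists u, w, s. rewrite push_inl. auto.
    + right; right. exists (endof G r). rewrite E, push_endof; auto. split; auto.
      apply endof_end. apply (ray_sub F G); auto.
  - intros x N Hx HN. destruct (cplx_cases F (f x)) as [[v E]|[[u [w [s [A [B E]]]]]|[r [Hr E]]]].
    + apply L; auto.
    + rewrite (proj2 (push_inl _ _) E) in HN. apply bn_vtx in HN; auto. destruct HN as [eps [He ->]].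
      destruct (lp_cont _ _ _ L x (star F v eps) Hx) as [d [Hd K]]; [rewrite E; apply bn_star; auto|].
      exists d. split; auto. intros y Hy Hxy. destruct (K y Hy Hxy) as [D|[w [t [D1 [D2 [D3 D4]]]]]].
      * left. apply push_inl; auto.
      * right. exists w, t. rewrite push_inl. auto.
    + rewrite (proj2 (push_inl _ _) E) in HN. apply bn_ept in HN; auto.
      destruct HN as [a [b [Ha [Hb HN]]]].
      destruct (lp_cont _ _ _ L x (seg u w a b) Hx) as [d [Hd K]]; [rewrite E; apply bn_seg; auto; lra|].
      exists d. split; auto. intros y Hy Hxy. apply HN. destruct (K y Hy Hxy) as [t [Ht D]].
      exists t. rewrite push_inl. auto.
    + rewrite E, push_endof in HN; auto. assert (Gr := ray_sub F G r HFG Hr).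
      apply bn_end in HN; auto. destruct HN as [S ->].
      destruct (lp_cont _ _ _ L x (end_nbhd F S (endof F r)) Hx) as [d [Hd K]]; [rewrite E; apply bn_end; eauto|].
      exists d. split; auto. intros y Hy Hxy. specialize (K y Hy Hxy).
      apply end_nbhdE in K; auto; [|apply OKF].
      destruct K as [[z [D1 D2]]|[[u [w [t [D1 [D2 [D3 [D4 D5]]]]]]]|[q [D1 [D2 D3]]]]].
      * rewrite (proj2 (push_inl _ _) D2). apply end_nbhd_vtx; auto. apply (rcomp_sub F G); auto.
      * rewrite (proj2 (push_inl _ _) D5). assert (D3' := rcomp_sub F G S r u HFG D3).
        apply end_nbhd_ept; auto. split; auto. split; auto. destruct D4; auto. left.
        apply (rcomp_sub F G); auto.
      * rewrite D3, push_endof; auto. apply end_nbhd_end; auto; [apply (ray_sub F G); auto|].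
        eapply ev_in_mono; [|exact D2]. intros v. apply rcomp_sub; auto.
  - intros v. destruct (lp_ex _ _ _ L v) as [x [Hx E]]. exists x. rewrite push_inl. auto.
  - intros v x y Hx Hy. rewrite !push_inl. apply (lp_uniq _ _ _ L); auto.
Qed.

Lemma push_fibers f v0 : loop F f v0 -> monotone_fibers f -> monotone_fibers (fun x => push_end G (f x)).
Proof.
  intros L HM x y Hx Hy E.
  assert (Exy : f x = f y).
  { destruct (f x) as [a|A] eqn:Ex; destruct (f y) as [b|B] eqn:Ey; try (simpl in E; congruence).
    assert (Kx := lp_in _ _ _ L x ltac:(lra)). assert (Ky := lp_in _ _ _ L y ltac:(lra)).
    rewrite Ex in Kx. rewrite Ey in Ky.
    destruct (cplx_cases F _ Kx) as [[? ?]|[[? [? [? [? [? ?]]]]]|[r [Hr Er]]]]; try congruence.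
    destruct (cplx_cases F _ Ky) as [[? ?]|[[? [? [? [? [? ?]]]]]|[q [Hq Eq]]]]; try congruence.
    rewrite Er, Eq, !push_endof in E; auto. injection E as E.
    apply endof_eq in E; [|apply OKG|apply (ray_sub F G); auto|apply (ray_sub F G); auto].
    rewrite Er, Eq. f_equal. apply endof_eq; auto; [apply OKF|]. apply Heq; auto. }
  destruct (HM x y Hx Hy Exy) as [D|D]; auto. right. intros t Ht. destruct (D t Ht) as [A ->].
  simpl. eauto.
Qed.

End Push.

(** The degree bound concerns ends of [F], so the fibres over ends are controlled in [F]; only the
    straightened curve is carried over to [G], where the collapse takes place. *)
Lemma subgraph_circle (G F : V -> V -> Prop) (v0 : V) : infinite_vertices V -> lf_graph G ->
  spanning_subgraph V F G -> faithful V F G -> ham_curve V F ->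
  (forall A, is_end V F A -> end_degree_le V A 3) -> ham_circle V G.
Proof.
  intros HV OK [Fs FG] [_ Heq] HC Hdeg. assert (OKF := lf_subgraph F G OK Fs FG).
  destruct (ham_curve_loop F v0 OKF HC) as [f L].
  assert (HE := degree_end_fibers F f v0 HV OKF L Hdeg).
  assert (L1 := linearize_loop F f v0 HV OKF L). assert (M1 := linearize_fibers F f v0 HV OKF L HE).
  assert (L2 := push_loop F G OKF OK FG Heq _ v0 L1).
  assert (M2 := push_fibers F G OKF OK FG Heq _ v0 L1 M1).
  destruct (simple_reparametrization G _ v0 OK L2 M2) as [f' [L3 S3]].
  exact (loop_circle G f' v0 OK L3 S3).
Qed.

End Reparametrization.

Theorem theorem1 (V : Type) (G : V -> V -> Prop)
  (Gsym : forall u v, G u v -> G v u) (Girr : forall v, ~ G v v)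
  (Glf : locally_finite V G) (Ginf : infinite_vertices V) :
  (ham_circle V G <->
     exists F : V -> V -> Prop,
       spanning_subgraph V F G /\ faithful V F G /\ ham_curve V F /\
       forall A, is_end V F A -> end_degree_eq V A 2) /\
  (ham_circle V G <->
     exists F : V -> V -> Prop,
       spanning_subgraph V F G /\ faithful V F G /\ ham_curve V F /\
       forall A, is_end V F A -> end_degree_le V A 3).
Proof.
  assert (OK : lf_graph G) by (split; auto).
  destruct (inf_fresh Ginf nil) as [v0 _].
  (* Of four disjoint rays the first three already contradict degree 2. *)
  assert (Le : forall A, end_degree_eq V A 2 -> end_degree_le V A 3).
  { intros A [_ HA] [rs [R1 R2]]. apply HA. exists rs. split; intros; [apply R1|apply R2]; auto. }
  assert (C12 := circle_subgraph G v0 Ginf OK).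
  assert (C31 : forall F, spanning_subgraph V F G /\ faithful V F G /\ ham_curve V F /\
     (forall A, is_end V F A -> end_degree_le V A 3) -> ham_circle V G).
  { intros F [A [B [C D]]]. exact (subgraph_circle G F v0 Ginf OK A B C D). }
  split; split; auto.
  - intros [F [A [B [C D]]]]. apply (C31 F). auto 6.
  - intros HC. destruct (C12 HC) as [F [A [B [C D]]]]. exists F. auto 6.
  - intros [F HF]. exact (C31 F HF).
Qed.
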